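(* Let $\ell$ be a prime and let $\alpha\in\mathbb{Q}_\ell\setminus\mathbb{Q}$ be a quadratic irrational over $\mathbb{Q}$. Then the Ruban continued fraction expansion of $\alpha$ is periodic if and only if there exists a unique real embedding $j:\mathbb{Q}(\alpha)\to\mathbb{R}$ such that the image $j(\alpha_n)$ of each complete quotient $\alpha_n$ of $\alpha$ is positive. Moreover, there is an effectively computable constant $N_\alpha$ with the property that either there exists $n\le N_\alpha$ such that $\alpha_n$ does not have a positive real embedding (i.e. there is no embedding $j:\mathbb{Q}(\alpha)\to\mathbb{R}$ with $j(\alpha_n)>0$), and therefore the expansion is not periodic, or there exist $n_1<n_2\le N_\alpha$ such that $\alpha_{n_1}=\alpha_{n_2}$, hence the expansion is periodic. In particular, both the pre-periodic and the periodic part of a periodic expansion can be computed with a finite algorithm.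
   Context: Let $\ell$ be a prime, $v$ the $\ell$-adic valuation on $\mathbb{Q}_\ell$ and $|x|_\ell=\ell^{-v(x)}$. For $\alpha\in\mathbb{Q}_\ell$ the $\ell$-adic integral part $\lfloor\alpha\rfloor_\ell$ is the unique $a\in\mathbb{Z}[1/\ell]$ with $0\le a<\ell$ and $|\alpha-a|_\ell<1$. The Ruban continued fraction expansion of $\alpha$ is defined by $\alpha_0:=\alpha$, $a_n:=\lfloor\alpha_n\rfloor_\ell$, $r_n:=\alpha_n-a_n$, and $\alpha_{n+1}:=1/r_n$ whenever $r_n\neq 0$ (for irrational $\alpha$ one never has $r_n=0$). The $a_n$ are the partial quotients and the $\alpha_n\in\mathbb{Q}(\alpha)$, $n\ge 0$, the complete quotients. ''Periodic'' means eventually periodic: there are $N\ge 0$ and $k\ge 1$ with $a_{n+k}=a_n$ for all $n\ge N$. *)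

(* Defs.v *)
From HB Require Import structures.
From mathcomp Require Import all_boot all_order all_algebra.
From mathcomp Require Import generic_quotient ring_quotient.
From mathcomp Require Import boolp classical_sets functions reals.
From mathcomp Require Import ring lra zify.

Set Implicit Arguments.
Unset Strict Implicit.
Unset Printing Implicit Defensive.

Import Order.TTheory GRing.Theory Num.Theory.

Local Open Scope ring_scope.
Local Open Scope quotient_scope.

(* The case q = 0 is separate because [logn ell 0 = 0]. *)
Definition rat_abs (ell : nat) (q : rat) : rat :=
  if q == 0 then 0
  else ell%:R ^+ logn ell `|denq q|%N / ell%:R ^+ logn ell `|numq q|%N.

Section RatAbs.
Variables (ell : nat) (pr : prime ell).
Local Notation "|` x |" := (rat_abs ell x) (at level 0, x at level 99).

Let ell_gt0 : 0 < ell%:R :> rat.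
Proof. by rewrite ltr0n prime_gt0. Qed.

Lemma rat_abs0 : |` 0 | = 0. Proof. by rewrite /rat_abs eqxx. Qed.

Lemma rat_abs_gt0 x : (0 < |` x |) = (x != 0).
Proof.
rewrite /rat_abs; case: (eqVneq x 0) => [_|_]; first by rewrite ltxx.
by rewrite divr_gt0 ?exprn_gt0 ?ell_gt0.
Qed.

Lemma rat_abs_ge0 x : 0 <= |` x |.
Proof.
by rewrite le_eqVlt rat_abs_gt0; case: (eqVneq x 0) => [->|]; rewrite ?rat_abs0 ?eqxx ?orbT.
Qed.

Lemma rat_abs_frac (m n : int) : m != 0 -> n != 0 ->
  |` m%:~R / n%:~R | = ell%:R ^+ logn ell `|n|%N / ell%:R ^+ logn ell `|m|%N.
Proof.
move=> m0 n0; set q : rat := m%:~R / n%:~R.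
have mn0 : q != 0 by rewrite mulf_neq0 ?invr_eq0 ?intr_eq0.
rewrite /rat_abs (negPf mn0).
have nq0 : numq q != 0 by rewrite numq_eq0.
have /(congr1 absz) : numq q * n = m * denq q.
  apply/eqP; rewrite -(eqr_int rat) !intrM numqE /q mulrAC divfK ?intr_eq0 //.
rewrite !abszM => /(congr1 (logn ell)); rewrite !lognM ?absz_gt0 ?denq_neq0 //.
move=> e; apply/eqP; rewrite eqr_div ?expf_neq0 ?(gt_eqF ell_gt0) //.
by rewrite -!exprD addnC -e addnC.
Qed.

Lemma rat_absM x y : |` x * y | = |` x | * |` y |.
Proof.
case: (eqVneq x 0) => [->|x0]; first by rewrite mul0r rat_abs0 mul0r.
case: (eqVneq y 0) => [->|y0]; first by rewrite mulr0 rat_abs0 mulr0.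
have -> : x * y = (numq x * numq y)%:~R / (denq x * denq y)%:~R.
  by rewrite !intrM -mulf_div !divq_num_den.
rewrite rat_abs_frac ?mulf_neq0 ?denq_neq0 ?numq_eq0 //.
rewrite /rat_abs (negPf x0) (negPf y0) !abszM.
by rewrite !lognM ?absz_gt0 ?denq_neq0 ?numq_eq0 // !exprD mulf_div.
Qed.

Lemma rat_abs1 : |` 1 | = 1.
Proof. by have := @rat_abs_frac 1 1 isT isT; rewrite !divr1 logn1. Qed.

Lemma rat_absN x : |` - x | = |` x |.
Proof. by rewrite /rat_abs oppr_eq0 numqN denqN abszN. Qed.

Lemma rat_absV x : |` x^-1 | = (|` x |)^-1.
Proof.
case: (eqVneq x 0) => [->|x0]; first by rewrite !(invr0, rat_abs0).
apply: (@mulfI _ (|` x |)); first by rewrite gt_eqF // rat_abs_gt0.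
by rewrite -rat_absM mulfV // rat_abs1 divff // gt_eqF // rat_abs_gt0.
Qed.

Lemma rat_abs_int (m : int) : m != 0 -> |` m%:~R | = (ell%:R ^+ logn ell `|m|%N)^-1.
Proof. by move=> m0; have := @rat_abs_frac m 1 m0 isT; rewrite divr1 logn1 div1r. Qed.

Lemma rat_absD x y : |` x + y | <= Num.max |` x | |` y |.
Proof.
case: (eqVneq x 0) => [->|x0]; first by rewrite add0r le_max lexx orbT.
case: (eqVneq y 0) => [->|y0]; first by rewrite addr0 le_max lexx.
case: (eqVneq (x + y) 0) => [->|xy0]; first by rewrite rat_abs0 le_max rat_abs_ge0.
pose a := numq x * denq y; pose b := numq y * denq x; pose d := denq x * denq y.
have d0 : d != 0 by rewrite mulf_neq0 ?denq_neq0.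
have dq0 : d%:~R != 0 :> rat by rewrite intr_eq0.
have ex : x = a%:~R / d%:~R.
  by rewrite !intrM -mulf_div divff ?intr_eq0 ?denq_neq0 // mulr1 divq_num_den.
have ey : y = b%:~R / d%:~R.
  rewrite !intrM [X in _ / X]mulrC -mulf_div divff ?intr_eq0 ?denq_neq0 //.
  by rewrite mulr1 divq_num_den.
have a0 : a != 0 by rewrite mulf_neq0 ?numq_eq0 ?denq_neq0.
have b0 : b != 0 by rewrite mulf_neq0 ?numq_eq0 ?denq_neq0.
have exy : x + y = (a + b)%:~R / d%:~R by rewrite ex ey intrD mulrDl.
have ab0 : a + b != 0.
  by apply: contraNneq xy0 => ab0; rewrite exy ab0 mul0r.
rewrite exy ex ey !rat_absM -maxr_pMl ?rat_abs_ge0 //.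
rewrite ler_wpM2r ?rat_abs_ge0 // !rat_abs_int //.
set i := logn ell `|a|; set j := logn ell `|b|.
have h : (minn i j <= logn ell `|(a + b)%R|)%N.
  rewrite -pfactor_dvdn ?absz_gt0 // -[(ell ^ _)%N]absz_nat -dvdzE rpredD //.
    by rewrite dvdzE /= pfactor_dvdn ?absz_gt0 ?geq_minl.
  by rewrite dvdzE /= pfactor_dvdn ?absz_gt0 ?geq_minr.
have e1 : 1 <= ell%:R :> rat by rewrite ler1n prime_gt0.
have mono (m n : nat) : (m <= n)%N -> (ell%:R ^+ n)^-1 <= (ell%:R ^+ m)^-1 :> rat.
  by move=> mn; rewrite lef_pV2 ?posrE ?exprn_gt0 // ler_weXn2l.
by rewrite le_max; case: (leqP i j) h => ij h; rewrite (mono _ _ h) ?orbT.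
Qed.

Lemma rat_absB x y : |` x - y | <= Num.max |` x | |` y |.
Proof. by rewrite -(rat_absN y) rat_absD. Qed.

End RatAbs.

Section CauchySequences.
Variables (ell : nat) (pr : prime ell).
Local Notation "|` x |" := (rat_abs ell x) (at level 0, x at level 99).

Definition is_cauchy (u : nat -> rat) : Prop :=
  forall eps, 0 < eps ->
  exists N, forall m n, (N <= m)%N -> (N <= n)%N -> |` u m - u n | < eps.

Definition is_null (u : nat -> rat) : Prop :=
  forall eps, 0 < eps -> exists N, forall n, (N <= n)%N -> |` u n | < eps.

Let absM := rat_absM pr.
Let absB := rat_absB pr.
Let absD := rat_absD pr.
Let abs_ge0 := rat_abs_ge0 pr.

Lemma cauchyB u v : is_cauchy u -> is_cauchy v -> is_cauchy (u - v).
Proof.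
move=> cu cv e e0; have [M hM] := cu e e0; have [N hN] := cv e e0.
exists (maxn M N) => m n; rewrite !geq_max => /andP[Mm Nm] /andP[Mn Nn].
have -> : (u - v) m - (u - v) n = (u m - u n) - (v m - v n).
  by rewrite !fctE; ring.
by apply: le_lt_trans (absB _ _) _; rewrite gt_max hM ?hN.
Qed.

Lemma cauchy_bounded u : is_cauchy u ->
  exists2 B, 0 < B & forall n, |` u n | <= B.
Proof.
move=> cu; have [N hN] := cu 1 ltr01.
pose B := 1 + \sum_(i < N.+1) |` u i |.
have hS (i : 'I_N.+1) : |` u i | <= \sum_(i < N.+1) |` u i |.
  by rewrite (bigD1 i) //= lerDl sumr_ge0.
have B1 : 1 <= B by rewrite /B lerDl sumr_ge0.
exists B => [|n]; first exact: lt_le_trans B1.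
case: (ltnP n N.+1) => nN.
  by apply: le_trans (hS (Ordinal nN)) _; rewrite /B lerDr.
rewrite -(subrK (u N) (u n)); apply: le_trans (absD _ _) _.
rewrite ge_max (le_trans (ltW (hN n N (ltnW nN) (leqnn _)))) //=.
by apply: le_trans (hS ord_max) _; rewrite /B lerDr.
Qed.

Lemma cauchyM u v : is_cauchy u -> is_cauchy v -> is_cauchy (u * v).
Proof.
move=> cu cv e e0.
have [A A0 hA] := cauchy_bounded cu; have [B B0 hB] := cauchy_bounded cv.
have [M hM] := cu (e / B) (divr_gt0 e0 B0).
have [N hN] := cv (e / A) (divr_gt0 e0 A0).
exists (maxn M N) => m n; rewrite !geq_max => /andP[Mm Nm] /andP[Mn Nn].
have -> : (u * v) m - (u * v) n = u m * (v m - v n) - (u n - u m) * v n.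
  by rewrite !fctE; ring.
apply: le_lt_trans (absB _ _) _; rewrite gt_max !absM; apply/andP; split.
  apply: le_lt_trans (ler_wpM2r (abs_ge0 _) (hA m)) _.
  by rewrite mulrC -ltr_pdivlMr ?hN.
apply: le_lt_trans (ler_wpM2l (abs_ge0 _) (hB n)) _.
by rewrite -ltr_pdivlMr ?hM.
Qed.

Lemma cauchy_cst (c : rat) : is_cauchy (fun=> c).
Proof. by move=> e e0; exists 0%N => m n _ _; rewrite subrr rat_abs0. Qed.

Lemma null_cauchy u : is_null u -> is_cauchy u.
Proof.
move=> nu e e0; have [N hN] := nu e e0; exists N => m n Nm Nn.
by apply: le_lt_trans (absB _ _) _; rewrite gt_max !hN.
Qed.

Lemma null_cst0 : is_null 0.
Proof. by move=> e e0; exists 0%N => n _; rewrite rat_abs0. Qed.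

Lemma nullB u v : is_null u -> is_null v -> is_null (u - v).
Proof.
move=> cu cv e e0; have [M hM] := cu e e0; have [N hN] := cv e e0.
exists (maxn M N) => m; rewrite !geq_max => /andP[Mm Nm].
by apply: le_lt_trans (absB _ _) _; rewrite gt_max hM ?hN.
Qed.

Lemma nullM u v : is_cauchy u -> is_null v -> is_null (u * v).
Proof.
move=> cu nv e e0; have [A A0 hA] := cauchy_bounded cu.
have [N hN] := nv (e / A) (divr_gt0 e0 A0); exists N => m Nm.
rewrite absM; apply: le_lt_trans (ler_wpM2r (abs_ge0 _) (hA m)) _.
by rewrite mulrC -ltr_pdivlMr ?hN.
Qed.

Lemma cauchy_away u : is_cauchy u -> ~ is_null u ->
  exists2 e, 0 < e & exists N, forall n, (N <= n)%N -> e <= |` u n |.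
Proof.
move=> cu /existsNP[e /not_implyP[e0 /forallNP he]].
exists e => //; have [N hN] := cu e e0; exists N => n Nn.
have /existsNP[m /not_implyP[Nm /negP hm]] := he N.
rewrite leNgt; apply: contra hm => hn; rewrite -(subrK (u n) (u m)).
by apply: le_lt_trans (absD _ _) _; rewrite gt_max hN.
Qed.

Lemma cauchy_inv u : is_cauchy u -> ~ is_null u ->
  is_cauchy (fun n => (u n)^-1).
Proof.
move=> cu nu; have [d d0 [M hM]] := cauchy_away cu nu.
have nz n : (M <= n)%N -> u n != 0.
  by move=> /hM h; rewrite -(rat_abs_gt0 pr) (lt_le_trans d0).
move=> e e0; have [N hN] := cu (e * d * d) (mulr_gt0 (mulr_gt0 e0 d0) d0).
exists (maxn M N) => m n; rewrite !geq_max => /andP[Mm Nm] /andP[Mn Nn].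
have -> : (u m)^-1 - (u n)^-1 = (u n - u m) * (u m)^-1 * (u n)^-1.
  by field; rewrite !nz.
rewrite !absM !rat_absV // -?ltr_pdivlMr ?invr_gt0 ?rat_abs_gt0 ?nz // !invrK.
apply: lt_le_trans (hN _ _ Nn Nm) _.
rewrite -!mulrA ler_wpM2l ?(ltW e0) // ler_pM ?(ltW d0) ?hM //.
Qed.

End CauchySequences.

Section Padic.
Variables (ell : nat) (pr : prime ell).

(* The unused argument [pr] lets the closure instances below, whose proofs need
   the primality of [ell], be found from the predicate. *)
Definition cauchy_pred of prime ell : {pred (nat -> rat)} :=
  fun u => `[< is_cauchy ell u >].

Lemma cauchy_pred_subring : subring_closed (cauchy_pred pr).
Proof.
split=> [|u v /asboolP cu /asboolP cv|u v /asboolP cu /asboolP cv]; apply/asboolP.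
- exact: cauchy_cst.
- exact: cauchyB.
- exact: cauchyM.
Qed.

HB.instance Definition _ :=
  GRing.isSubringClosed.Build (nat -> rat) (cauchy_pred pr) cauchy_pred_subring.

Record cauchy_rat := CauchyRat {
  cauchy_seq :> nat -> rat; cauchy_seqP : cauchy_seq \in cauchy_pred pr }.

HB.instance Definition _ := [isSub for cauchy_seq].
HB.instance Definition _ := [Choice of cauchy_rat by <:].
HB.instance Definition _ := [SubChoice_isSubComNzRing of cauchy_rat by <:].

Definition null_pred : {pred cauchy_rat} := fun u => `[< is_null ell u >].

Lemma null_pred_ideal : idealr_closed null_pred.
Proof.
split=> [||a u v /asboolP nu /asboolP nv].
- by apply/asboolP => e e0; exists 0%N => n _; rewrite rat_abs0.
- apply/asboolP => /(_ 1 ltr01)[N /(_ N (leqnn _))].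
  by rewrite rat_abs1 // ltxx.
- apply/asboolP; have /asboolP ca := cauchy_seqP a.
  have -> : cauchy_seq (a * u + v) = cauchy_seq a * cauchy_seq u - (0 - cauchy_seq v).
    by rewrite sub0r opprK -[LHS]/(val _) rmorphD rmorphM.
  by apply: (nullB pr); [exact: (nullM pr)|exact: (nullB pr (null_cst0 ell))].
Qed.

HB.instance Definition _ :=
  isIdealr.Build cauchy_rat null_pred null_pred_ideal.

(* The field Q_ell, as the completion of Q: Cauchy sequences modulo null
   sequences. *)
Definition padic := {ideal_quot null_pred}.

HB.instance Definition _ := GRing.ComNzRing.on padic.
HB.instance Definition _ := EqQuotient.on padic.

Definition padic_inv (x : padic) : padic := xget 0 [set y | y * x = 1].

Lemma padic_mulVf x : x != 0 -> padic_inv x * x = 1.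
Proof.
move=> x0; rewrite /padic_inv; apply: (@xgetPex _ 0 [set y | y * x = 1]).
rewrite -[x]reprK in x0 *; set u : cauchy_rat := repr x in x0 *.
have nu : ~ is_null ell u.
  by move=> nu; case/eqP: x0; apply/eqP; rewrite piE /= Quotient.equivE subr0; apply/asboolP.
have cu : is_cauchy ell u by apply/asboolP/(cauchy_seqP u).
have [d d0 [N hN]] := cauchy_away pr cu nu.
exists (\pi_padic (CauchyRat (asboolT (cauchy_inv pr cu nu)))) => /=.
apply/eqP; rewrite piE /= Quotient.equivE; apply/asboolP => e e0; exists N => n /hN un.
have unz : u n != 0 by rewrite -(rat_abs_gt0 pr) (lt_le_trans d0).
set w := cauchy_seq _; have -> : w n = (u n)^-1 * u n - 1 by [].
by rewrite mulVf // subrr rat_abs0.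
Qed.

Lemma padic_inv0 : padic_inv 0 = 0.
Proof.
rewrite /padic_inv; case: xgetP => // y _ /esym/eqP.
by rewrite mulr0 oner_eq0.
Qed.

HB.instance Definition _ :=
  GRing.ComNzRing_isField.Build padic padic_mulVf padic_inv0.

Lemma padic_eqP (u v : cauchy_rat) :
  reflect (is_null ell (cauchy_seq u - cauchy_seq v)) (\pi_padic u == \pi_padic v).
Proof.
by rewrite piE Quotient.equivE; apply: (iffP (asboolP _)).
Qed.

Definition rat_lim (u : nat -> rat) (c : rat) : Prop :=
  forall eps, 0 < eps -> exists N, forall n, (N <= n)%N -> `|u n - c| < eps.

(* The limit is rational because the values of |.|_ell on Q_ell are 0 and the
   powers of ell; it does not depend on the representative by [padic_absP]. *)
Definition padic_abs (x : padic) : rat :=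
  xget 0 [set c | rat_lim (fun n => rat_abs ell ((repr x : cauchy_rat) n)) c].

Lemma rat_lim_unique u c c' : rat_lim u c -> rat_lim u c' -> c = c'.
Proof.
move=> h h'; apply/eqP/negPn/negP => cc'.
have e0 : 0 < `|c - c'| / 2 by rewrite divr_gt0 // normr_gt0 subr_eq0.
have [N hN] := h _ e0; have [M hM] := h' _ e0.
suff : `|c - c'| < `|c - c'| by rewrite ltxx.
apply: le_lt_trans (ler_distD (u (maxn N M)) c c') _.
by rewrite [ltRHS]splitr ltrD ?hM ?leq_maxr // distrC hN ?leq_maxl.
Qed.

Lemma rat_abs_dist (x y : rat) :
  `|rat_abs ell x - rat_abs ell y| <= rat_abs ell (x - y).
Proof.
have h (a b : rat) : rat_abs ell a <= rat_abs ell b + rat_abs ell (a - b).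
  rewrite -[in leLHS](subrK b a); apply: le_trans (rat_absD pr _ _) _.
  by rewrite ge_max lerDl lerDr !rat_abs_ge0.
have := h x y; have := h y x; rewrite -(rat_absN _ (y - x)) opprB => h1 h2.
by rewrite ler_norml; lra.
Qed.

Lemma rat_abs_near (x y : rat) :
  rat_abs ell (x - y) < rat_abs ell y -> rat_abs ell x = rat_abs ell y.
Proof.
move=> h; apply/eqP; rewrite eq_le; apply/andP; split.
  rewrite -[in leLHS](subrK y x); apply: le_trans (rat_absD pr _ _) _.
  by rewrite ge_max lexx ltW.
rewrite leNgt; apply/negP => xy; suff : rat_abs ell y < rat_abs ell y by rewrite ltxx.
rewrite -[in ltLHS](subKr x y); apply: le_lt_trans (rat_absB pr _ _) _.
by rewrite gt_max xy h.
Qed.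

Lemma cauchy_abs_cvg u : is_cauchy ell u ->
  exists c, rat_lim (fun n => rat_abs ell (u n)) c.
Proof.
move=> cu; have [nu|nu] := pselect (is_null ell u).
  exists 0 => e /nu[N hN]; exists N => n Nn.
  by rewrite subr0 ger0_norm ?rat_abs_ge0 ?hN.
have [d d0 [N hN]] := cauchy_away pr cu nu; have [M hM] := cu _ d0.
exists (rat_abs ell (u (maxn M N))) => e e0; exists (maxn M N) => n hn.
rewrite [X in X - _](_ : _ = rat_abs ell (u (maxn M N))) ?subrr ?normr0 //.
apply: rat_abs_near; apply: lt_le_trans (hN _ (leq_maxr _ _)).
by rewrite hM ?leq_maxl // (leq_trans (leq_maxl _ _) hn).
Qed.

Lemma padic_absP (u : cauchy_rat) :
  rat_lim (fun n => rat_abs ell (u n)) (padic_abs (\pi_padic u)).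
Proof.
rewrite /padic_abs; set v : cauchy_rat := repr _.
have := cauchy_abs_cvg (elimT (asboolP _) (cauchy_seqP v)).
move=> /(@xgetPex _ 0 [set c | rat_lim (fun n => rat_abs ell (v n)) c]) /=.
set c := xget _ _ => hc e e0; have e2 : 0 < e / 2 by rewrite divr_gt0.
have nuv : is_null ell (cauchy_seq v - cauchy_seq u).
  by apply/padic_eqP; rewrite reprK.
have [N hN] := hc _ e2; have [M hM] := nuv _ e2.
exists (maxn M N) => n; rewrite geq_max => /andP[/hM {}hM /hN {}hN].
apply: le_lt_trans (ler_distD (rat_abs ell (v n)) _ _) _.
rewrite [ltRHS]splitr ltrD // distrC.
exact: le_lt_trans (rat_abs_dist _ _) hM.
Qed.

Definition cauchy_const (q : rat) : cauchy_rat :=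
  CauchyRat (asboolT (cauchy_cst ell q) : (fun=> q) \in cauchy_pred pr).

Let padic_const (q : rat) : padic := \pi_padic (cauchy_const q).

Fact padic_const_zmod_morphism : zmod_morphism padic_const.
Proof.
move=> x y; rewrite /padic_const.
have -> : cauchy_const (x - y) = cauchy_const x - cauchy_const y by exact: val_inj.
by rewrite pi_addr pi_oppr.
Qed.

Fact padic_const_monoid_morphism : monoid_morphism padic_const.
Proof.
split=> [|x y]; rewrite /padic_const.
  have -> : cauchy_const 1 = 1 by exact: val_inj.
  by rewrite pi_oner.
have -> : cauchy_const (x * y) = cauchy_const x * cauchy_const y by exact: val_inj.
by rewrite pi_mulr.
Qed.

HB.instance Definition _ :=
  GRing.isZmodMorphism.Build rat padic padic_const padic_const_zmod_morphism.
HB.instance Definition _ :=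
  GRing.isMonoidMorphism.Build rat padic padic_const padic_const_monoid_morphism.

Lemma padic_ratr q : ratr q = \pi_padic (cauchy_const q).
Proof. by rewrite -(fmorph_eq_rat padic_const). Qed.

Lemma padic_abs_ratr q : padic_abs (ratr q) = rat_abs ell q.
Proof.
apply: (@rat_lim_unique (fun=> rat_abs ell q)).
  by rewrite padic_ratr; exact: padic_absP.
by move=> e e0; exists 0%N => n _; rewrite subrr normr0.
Qed.

End Padic.

Section PadicAbs.
Variables (ell : nat) (pr : prime ell).
Implicit Types x y : padic pr.

Lemma padicW (P : padic pr -> Prop) : (forall u, P (\pi_(padic pr) u)) -> forall x, P x.
Proof. by move=> h x; rewrite -[x]reprK. Qed.

Lemma rat_lim_le (u : nat -> rat) c b :
  rat_lim u c -> (exists N, forall n, (N <= n)%N -> u n <= b) -> c <= b.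
Proof.
move=> h [N hN]; rewrite leNgt; apply/negP => bc.
have [|M hM] := h (c - b); first by rewrite subr_gt0.
have := hM _ (leq_maxr N M); have := hN _ (leq_maxl N M).
by rewrite ltr_norml; lra.
Qed.

Lemma padic_dense x (eps : rat) : 0 < eps ->
  exists q : rat, padic_abs (x - ratr q) < eps.
Proof.
move: x; apply: padicW => u e0; have cu : is_cauchy ell u by apply/asboolP/cauchy_seqP.
have [|N hN] := cu (eps / 2); first by rewrite divr_gt0.
exists (u N); rewrite padic_ratr -pi_oppr -pi_addr.
apply: (@le_lt_trans _ _ (eps / 2)); last by lra.
apply: rat_lim_le (padic_absP _) _; exists N => n Nn; exact/ltW/hN.
Qed.

Lemma padic_abs_ge0 x : 0 <= padic_abs x.
Proof.
move: x; apply: padicW => u; rewrite leNgt; apply/negP => h.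
have [|N /(_ N (leqnn _))] := padic_absP u (eps := - padic_abs (\pi_(padic pr) u)).
  by rewrite oppr_gt0.
by have := rat_abs_ge0 pr (u N); rewrite ltr_norml; lra.
Qed.

Lemma padic_absD x y : padic_abs (x + y) <= Num.max (padic_abs x) (padic_abs y).
Proof.
move: x y; apply: padicW => u; apply: padicW => v; rewrite -pi_addr.
apply/ler_addgt0Pr => e e0; apply: rat_lim_le (padic_absP _) _.
have [N hN] := padic_absP u e0; have [K hK] := padic_absP v e0.
exists (maxn N K) => n; rewrite geq_max => /andP[/hN {}hN /hK {}hK].
apply: le_trans (rat_absD pr _ _) _.
set M := Num.max _ (padic_abs _).
have hu : padic_abs (\pi_(padic pr) u) <= M by rewrite /M le_max lexx.
have hv : padic_abs (\pi_(padic pr) v) <= M by rewrite /M le_max lexx orbT.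
clearbody M.
by move: hN hK; rewrite ge_max !ltr_norml => /andP[_ h1] /andP[_ h2]; apply/andP; split; lra.
Qed.

Lemma padic_abs0 : padic_abs (0 : padic pr) = 0.
Proof. by have := padic_abs_ratr pr 0; rewrite rat_abs0 (_ : ratr 0 = 0) // /ratr mul0r. Qed.

Lemma padic_absN x : padic_abs (- x) = padic_abs x.
Proof.
move: x; apply: padicW => u; rewrite -pi_oppr; apply: rat_lim_unique (padic_absP _) _.
move=> e e0; have [N hN] := padic_absP u e0; exists N => n /hN.
by rewrite -[rat_abs ell ((- u : cauchy_rat pr) n)]/(rat_abs ell (- u n)) rat_absN.
Qed.

Lemma padic_abs_gt0 x : (0 < padic_abs x) = (x != 0).
Proof.
rewrite lt_neqAle padic_abs_ge0 andbT eq_sym; congr (~~ _); apply/eqP/eqP; last first.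
  by move=> ->; rewrite padic_abs0.
move: x; apply: padicW => u h0; apply/eqP; have <- : \pi_(padic pr) 0 = 0 by exact: pi_zeror.
apply/padic_eqP => e e0; have [N hN] := padic_absP u e0.
exists N => n /hN; rewrite h0 subr0 ger0_norm ?rat_abs_ge0 // => hu.
by rewrite -[X in rat_abs ell X]/(u n - 0) subr0.
Qed.

Lemma padic_absM x y : padic_abs (x * y) = padic_abs x * padic_abs y.
Proof.
move: x y; apply: padicW => u; apply: padicW => v; rewrite -pi_mulr.
apply: rat_lim_unique (padic_absP _) _.
have := padic_absP u; have := padic_absP v.
set c := padic_abs (\pi_(padic pr) u); set d := padic_abs (\pi_(padic pr) v) => hv hu e e0.
have c1 : 0 < 2 * (`|c| + 1) by rewrite mulr_gt0 // ltr_wpDl.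
have d1 : 0 < 2 * (`|d| + 1) by rewrite mulr_gt0 // ltr_wpDl.
have [N hN] := hu _ (divr_gt0 e0 d1); have [K hK] := hv _ (divr_gt0 e0 c1).
have [L hL] := hv _ ltr01.
exists (maxn L (maxn N K)) => n; rewrite !geq_max => /and3P[/hL {}hL /hN {}hN /hK {}hK].
rewrite -[rat_abs ell ((u * v : cauchy_rat pr) n)]/(rat_abs ell (u n * v n)).
rewrite rat_absM // [X in `|X|](_ : _ = (rat_abs ell (u n) - c) * rat_abs ell (v n)
  + c * (rat_abs ell (v n) - d)); last by ring.
apply: le_lt_trans (ler_normD _ _) _; rewrite !normrM [ltRHS]splitr ltr_leD //.
  have vd : `|rat_abs ell (v n)| < `|d| + 1.
    rewrite -[rat_abs ell (v n)](subrK d); apply: le_lt_trans (ler_normD _ _) _.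
    by rewrite addrC ltrD2l.
  have [->|u0] := eqVneq (rat_abs ell (u n) - c) 0; first by rewrite normr0 mul0r divr_gt0.
  apply: lt_trans (_ : _ < `|rat_abs ell (u n) - c| * (`|d| + 1)) _.
    by rewrite ltr_pM2l // normr_gt0.
  rewrite -ltr_pdivlMr ?ltr_wpDl //; apply: lt_le_trans hN _.
  by rewrite invfM mulrA.
apply: le_trans (_ : _ <= (`|c| + 1) * `|rat_abs ell (v n) - d|) _.
  by rewrite ler_wpM2r // lerDl.
rewrite mulrC -ler_pdivlMr ?ltr_wpDl //; apply: le_trans (ltW hK) _.
by rewrite invfM mulrA.
Qed.

End PadicAbs.

Section AdjoinField.
Variables (ell : nat) (pr : prime ell) (alpha : padic pr).

(* Q(alpha) is the smallest subfield containing alpha. *)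
Definition Qadj_pred : {pred padic pr} := fun x =>
  `[< forall S : {pred padic pr}, divring_closed S -> alpha \in S -> x \in S >].

Lemma Qadj_closed : divring_closed Qadj_pred.
Proof.
split=> [|x y /asboolP hx /asboolP hy|x y /asboolP hx /asboolP hy].
- by apply/asboolP => S [].
- by apply/asboolP => S hS aS; case: (hS) => _ hB _; rewrite hB ?hx ?hy.
- by apply/asboolP => S hS aS; case: (hS) => _ _ hV; rewrite hV ?hx ?hy.
Qed.

HB.instance Definition _ :=
  GRing.isDivringClosed.Build (padic pr) Qadj_pred Qadj_closed.

Record Qadj := MkQadj { Qadj_val :> padic pr; Qadj_valP : Qadj_val \in Qadj_pred }.

HB.instance Definition _ := [isSub for Qadj_val].
HB.instance Definition _ := [Choice of Qadj by <:].
HB.instance Definition _ := [SubChoice_isSubIntegralDomain of Qadj by <:].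
Lemma Qadj_fieldP : GRing.field_axiom Qadj.
Proof.
move=> x x0; have vx : Qadj_val x != 0 by apply: contra_neq x0 => x0; apply: val_inj.
rewrite unitrE; apply/eqP/val_inj; rewrite rmorphM rmorph1.
by rewrite -[X in _ * X]/((Qadj_val x)^-1) divff.
Qed.

HB.instance Definition _ := GRing.UnitRing_isField.Build Qadj Qadj_fieldP.

Lemma Qadj_gen : alpha \in Qadj_pred. Proof. exact/asboolP. Qed.

End AdjoinField.

Section Ruban.
Variables (ell : nat) (pr : prime ell).
Implicit Types alpha : padic pr.

Definition quadratic_irrational alpha : Prop :=
  (forall q : rat, alpha != ratr q) /\
  exists p : {poly rat}, size p = 3 /\ root (map_poly ratr p) alpha.

(* a \in Z[1/ell] *)
Definition in_Zinv (a : rat) : Prop :=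
  exists n : nat, a * ell%:R ^+ n \is a Num.int.

Definition is_padic_floor alpha (a : rat) : Prop :=
  [/\ in_Zinv a, 0 <= a < ell%:R & padic_abs (alpha - ratr a) < 1].

Definition padic_floor alpha : rat := xget 0 [set a | is_padic_floor alpha a].

(* When a remainder vanishes the expansion should stop; here it continues with
   0^-1 = 0, which never happens for irrational [alpha]. *)
Fixpoint complete_quotient alpha (n : nat) : padic pr :=
  if n is m.+1 then
    (complete_quotient alpha m - ratr (padic_floor (complete_quotient alpha m)))^-1
  else alpha.

Definition partial_quotient alpha n : rat := padic_floor (complete_quotient alpha n).

Definition periodic_from alpha (N k : nat) : Prop :=
  forall n, (N <= n)%N -> partial_quotient alpha (n + k) = partial_quotient alpha n.

Definition periodic alpha : Prop := exists N k, (0 < k)%N /\ periodic_from alpha N k.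

(* N and k are the least lengths of a pre-period and of a period; if the
   expansion is periodic, both minima are attained by the same pair. *)
Definition preperiod_period alpha (N k : nat) : Prop :=
  [/\ (0 < k)%N, periodic_from alpha N k &
      forall N' k', (0 < k')%N -> periodic_from alpha N' k' -> (N <= N')%N /\ (k <= k')%N].

Lemma complete_quotient_Qadj alpha n : complete_quotient alpha n \in Qadj_pred alpha.
Proof.
elim: n => [|n IHn]; first exact: Qadj_gen.
by rewrite /= rpredV rpredB // rpred_rat.
Qed.

Definition complete_quotientQ alpha n : Qadj alpha :=
  MkQadj (complete_quotient_Qadj alpha n).

End Ruban.

Section Computability.
Local Open Scope nat_scope.

Definition prim_rec k (f : k.-tuple nat -> nat) (g : k.+2.-tuple nat -> nat)
    (v : k.+1.-tuple nat) : nat :=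
  let w : k.-tuple nat := [tuple of behead v] in
  (fix loop n := if n is m.+1 then g [tuple of m :: loop m :: w] else f w) (thead v).

(* Total recursive functions: minimisation is only allowed on functions that
   have a zero for every value of the parameters. *)
Inductive recursive : forall k, (k.-tuple nat -> nat) -> Prop :=
| rec_zero k : recursive (fun _ : k.-tuple nat => 0)
| rec_succ : recursive (fun v : 1.-tuple nat => (thead v).+1)
| rec_proj k (i : 'I_k) : recursive (fun v : k.-tuple nat => tnth v i)
| rec_comp k m (f : m.-tuple nat -> nat) (gs : m.-tuple (k.-tuple nat -> nat)) :
    recursive f -> (forall i, recursive (tnth gs i)) ->
    recursive (fun v => f (map_tuple (fun g => g v) gs))
| rec_prim k (f : k.-tuple nat -> nat) (g : k.+2.-tuple nat -> nat) :
    recursive f -> recursive g -> recursive (prim_rec f g)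
| rec_min k (f : k.+1.-tuple nat -> nat)
    (f0 : forall v : k.-tuple nat, exists n, f [tuple of n :: v] == 0) :
    recursive f -> recursive (fun v => ex_minn (f0 v)).

End Computability.

(* Finite data determining a quadratic irrational of the ell-adic field: the
   coefficients of its primitive minimal polynomial over Z, and a rational
   number that is closer to it than to its conjugate. *)
Record quad_data := QuadData {
  qd_lead : nat; qd_lin : int; qd_cst : int; qd_approx : rat }.

Definition quad_eval (F : fieldType) (d : quad_data) (x : F) : F :=
  (qd_lead d)%:R * x ^+ 2 + (qd_lin d)%:~R * x + (qd_cst d)%:~R.

Definition describes ell (pr : prime ell) (d : quad_data) (alpha : padic pr) : Prop :=
  [/\ (0 < qd_lead d)%N,
      gcdn (gcdn (qd_lead d) `|qd_lin d|) `|qd_cst d| = 1%N,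
      quad_eval d alpha = 0 &
      forall beta : padic pr, quad_eval d beta = 0 -> beta != alpha ->
        padic_abs (alpha - ratr (qd_approx d)) < padic_abs (beta - ratr (qd_approx d))].

Definition quad_code (ell : nat) (d : quad_data) : 9.-tuple nat :=
  [tuple ell; qd_lead d;
         nat_of_bool (qd_lin d < 0); `|qd_lin d|%N;
         nat_of_bool (qd_cst d < 0); `|qd_cst d|%N;
         nat_of_bool (qd_approx d < 0); `|numq (qd_approx d)|%N;
         `|denq (qd_approx d)|%N].

(* [N] is computed by a recursive function from any description of [alpha]. *)
Definition effectively_computable
    (N : forall ell (pr : prime ell), padic pr -> nat) : Prop :=
  exists2 F : 9.-tuple nat -> nat, recursive F &
    forall ell (pr : prime ell) (alpha : padic pr) (d : quad_data),
      quadratic_irrational alpha -> describes d alpha ->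
      F (quad_code ell d) = N ell pr alpha.

Section Floor.
Variables (ell : nat) (pr : prime ell).
Implicit Types x y : padic pr.

Let ell_gt0 : 0 < ell%:R :> rat.
Proof. by rewrite ltr0n prime_gt0. Qed.

Lemma rat_abs_int_le1 (m : int) : rat_abs ell m%:~R <= 1.
Proof.
have [->|m0] := eqVneq m 0; first by rewrite rat_abs0.
by rewrite rat_abs_int // invf_le1 ?exprn_gt0 // exprn_ege1 // ler1n prime_gt0.
Qed.

Lemma rat_abs_ell : rat_abs ell ell%:R = ell%:R^-1.
Proof.
have -> : ell%:R = (ell%:Z)%:~R :> rat by [].
rewrite rat_abs_int //=; last by rewrite -lt0n prime_gt0.
by rewrite (pfactorK 1) // expr1.
Qed.

Lemma rat_abs_ellX n : rat_abs ell (ell%:R ^+ n) = ell%:R ^- n.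
Proof.
elim: n => [|n IHn]; first by rewrite expr0 rat_abs1 // invr1.
by rewrite exprS rat_absM // IHn rat_abs_ell invfM.
Qed.

Lemma rat_abs_lt1_mul (k : int) : rat_abs ell (ell%:R * k%:~R) < 1.
Proof.
rewrite rat_absM // rat_abs_ell; apply: le_lt_trans (_ : _ <= ell%:R^-1) _.
  by rewrite ler_piMr ?rat_abs_int_le1 // invr_ge0 ltW.
by rewrite invf_lt1 // ltr1n prime_gt1.
Qed.

Lemma in_ZinvB (a b : rat) : in_Zinv ell a -> in_Zinv ell b -> in_Zinv ell (a - b).
Proof.
move=> [m am] [n bn]; exists (m + n)%N; rewrite mulrBl exprD.
by rewrite rpredB //; [rewrite mulrA|rewrite mulrCA]; rewrite rpredM // rpredX ?natr_int.
Qed.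

Lemma in_Zinv_lt1 (a : rat) : in_Zinv ell a -> rat_abs ell a < 1 ->
  exists k : int, a = ell%:R * k%:~R.
Proof.
move=> [n /intrP[m am]] a1; have en0 : ell%:R ^+ n != 0 :> rat by rewrite expf_neq0 ?gt_eqF.
have [m0|m0] := eqVneq m 0.
  by exists 0; rewrite mulr0; apply: (mulIf en0); rewrite am m0 mul0r.
have : (ell ^ n.+1 %| `|m|)%N.
  rewrite pfactor_dvdn ?absz_gt0 // ltnNge; apply/negP => h.
  move: a1; rewrite -[a](mulfK en0) am rat_absM // rat_absV // rat_abs_ellX invrK.
  rewrite rat_abs_int // mulrC ltr_pdivrMr ?exprn_gt0 // mul1r ltNge => /negP; apply.
  by rewrite ler_weXn2l // ler1n prime_gt0.
rewrite -[(ell ^ n.+1)%N]absz_nat -dvdzE => /dvdzP[k mk].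
exists k; apply: (mulIf en0); rewrite am mk intrM -pmulrn natrX exprS; ring.
Qed.

Lemma padic_floor_unique x a b : is_padic_floor x a -> is_padic_floor x b -> a = b.
Proof.
move=> [aZ /andP[a0 al] xa] [bZ /andP[b0 bl] xb].
have : rat_abs ell (a - b) < 1.
  rewrite -(padic_abs_ratr pr) (_ : ratr (a - b) = (x - ratr b) - (x - ratr a)).
    by apply: le_lt_trans (padic_absD _ _) _; rewrite padic_absN gt_max xa xb.
  have -> : (x - ratr b) - (x - ratr a) = ratr a - ratr b.
    by rewrite opprB [LHS]addrC addrA subrK.
  rewrite !padic_ratr -pi_oppr -pi_addr.
  by congr (\pi_(padic pr) _); apply: val_inj.
case/(in_Zinv_lt1 (in_ZinvB aZ bZ)) => k abk; apply/eqP; rewrite -subr_eq0 abk.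
have k1 : `|k| < 1.
  rewrite -(ltr_int rat) intr_norm -(ltr_pM2l ell_gt0) mulr1 -[X in X * _]ger0_norm ?ltW //.
  by rewrite -normrM -abk ltr_norml; lra.
have -> : k = 0 by lia.
by rewrite mulr0.
Qed.

Lemma padic_floorP x : is_padic_floor x (padic_floor x).
Proof.
apply: (@xgetPex _ 0 [set a | is_padic_floor x a]).
have [q xq] := padic_dense x ltr01.
have dq : (0 < `|denq q|)%N by rewrite absz_gt0 denq_neq0.
have [s sl ds] := pfactor_coprime pr dq; set k := logn _ _ in ds.
have [u [v uv]] := Bezoutz s%:Z (ell ^ k.+1)%N%:Z.
have {uv} uv : u%:~R * s%:R + v%:~R * ell%:R ^+ k.+1 = 1 :> rat.
  have : gcdz s%:Z (ell ^ k.+1)%N%:Z = 1.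
    by apply/eqP; rewrite eqz_nat -/(coprime _ _) coprimeXr // coprime_sym.
  by rewrite -uv => /(congr1 (fun z : int => z%:~R : rat)); rewrite intrD !intrM -!pmulrn natrX.
have s0 : s%:R != 0 :> rat.
  rewrite pnatr_eq0 -lt0n lt0n; apply: contraTneq dq => s0.
  by rewrite ds s0 mul0n.
have ek0 : ell%:R ^+ k != 0 :> rat by rewrite expf_neq0 // gt_eqF.
have qE : q * (ell%:R ^+ k * s%:R) = (numq q)%:~R.
  rewrite -natrX -natrM mulnC -ds numqE; congr (_ * _).
  by rewrite -[in RHS](gez0_abs (denq_ge0 q)).
pose a0 : rat := (numq q * u)%:~R / ell%:R ^+ k.
pose f : int := Num.floor (a0 / ell%:R).
exists (a0 - ell%:R * f%:~R); split.
- apply: in_ZinvB; first by exists k; rewrite divfK // intr_int.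
  by exists 0%N; rewrite expr0 mulr1 rpredM ?natr_int ?intr_int.
- have := floor_itv (a0 / ell%:R); rewrite -/f intrD ler_pdivlMr // ltr_pdivrMr //.
  by move=> /andP[]; rewrite mulrDl mul1r => h1 h2; apply/andP; split; lra.
have -> : x - ratr (a0 - ell%:R * f%:~R) =
    (x - ratr q) + (ratr ((q - a0) + ell%:R * f%:~R)).
  rewrite -addrA; congr (_ + _); rewrite !padic_ratr -!pi_oppr -pi_addr.
  by congr (\pi_(padic pr) _); apply/val_inj/funext => n; rewrite /= !fctE; ring.
apply: le_lt_trans (padic_absD _ _) _; rewrite gt_max xq padic_abs_ratr /=.
apply: le_lt_trans (rat_absD pr _ _) _; rewrite gt_max rat_abs_lt1_mul andbT.
have -> : q - a0 = ell%:R * (numq q * v)%:~R / s%:R.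
  apply: (mulIf (mulf_neq0 ek0 s0)); rewrite mulrBl qE /a0 !intrM.
  move: uv ek0 s0; rewrite exprS; move: (ell%:R ^+ k) (s%:R : rat) => E S uv E0 S0.
  apply/eqP; rewrite -subr_eq0.
  set z := (X in X == 0).
  have -> : z = (numq q)%:~R * (1 - (u%:~R * S + v%:~R * (ell%:R * E))).
    by rewrite /z; field; rewrite E0 S0.
  by rewrite uv subrr mulr0.
rewrite rat_absM // rat_absV //.
have -> : rat_abs ell s%:R = 1.
  have sz : (s%:Z)%:~R = s%:R :> rat by [].
  by rewrite -sz rat_abs_int ?logn_coprime ?invr1 // -(intr_eq0 rat) sz.
by rewrite invr1 mulr1 rat_abs_lt1_mul.
Qed.

End Floor.

Lemma conj_root (F : fieldType) (a b c x y : F) : a != 0 ->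
  (a * y ^+ 2 + b * y + c) - (a * x ^+ 2 + b * x + c) =
  (y - x) * (a * y) - (y - x) * (a * (- b / a - x)).
Proof. by move=> a0; field. Qed.

Section Description.
Variables (ell : nat) (pr : prime ell).
Implicit Types x y : padic pr.

Lemma padic_ratrM (a b : rat) : ratr (a * b) = ratr a * ratr b :> padic pr.
Proof. by rewrite !padic_ratr -pi_mulr; congr (\pi_(padic pr) _); apply: val_inj. Qed.

Lemma padic_ratr_eq0 (a : rat) : (ratr a == 0 :> padic pr) = (a == 0).
Proof.
by apply/idP/idP; apply: contraTT; rewrite -padic_abs_gt0 padic_abs_ratr rat_abs_gt0.
Qed.

Lemma describes_exists x : quadratic_irrational x -> exists d, describes d x.
Proof.
move=> [_ [p [sp /rootP px]]].
have [q [c c0 pq]] := rat_poly_scale p.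
have q0 : q != 0 by apply: contra_eq_neq sp => q0; rewrite pq q0 rmorph0 scaler0 size_poly0.
have sq : size q = 3.
  by rewrite -sp pq size_scale ?invr_eq0 ?intr_eq0 // size_map_inj_poly //; exact: intr_inj.
pose r := zprimitive q; have sr : size r = 3 by rewrite size_zprimitive.
have lr : lead_coef r = r`_2 by rewrite lead_coefE sr.
have r2 : 0 < r`_2 by rewrite -lr -sgz_gt0 sgz_lead_primitive q0.
have pE i : ratr p`_i = ratr (c%:~R^-1 * (zcontents q)%:~R) * (r`_i)%:~R :> padic pr.
  rewrite -(ratr_int (padic pr)) -padic_ratrM pq coefZ coef_map /= [in LHS](zpolyEprim q) coefZ.
  by rewrite intrM mulrA.
have k0 : ratr (c%:~R^-1 * (zcontents q)%:~R) != 0 :> padic pr.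
  by rewrite padic_ratr_eq0 mulf_neq0 ?invr_eq0 ?intr_eq0 // zcontents_eq0.
pose ev y : padic pr := (absz r`_2)%:R * y ^+ 2 + (r`_1)%:~R * y + (r`_0)%:~R.
have r2E : (absz r`_2)%:R = (r`_2)%:~R :> padic pr by rewrite pmulrn gez0_abs // ltW.
have evx : ev x = 0.
  apply: (mulfI k0); rewrite mulr0 -[RHS]px /map_poly horner_poly sp.
  rewrite !big_ord_recl big_ord0 /= !pE /ev r2E /bump /=; ring.
have a0 : (r`_2)%:~R != 0 :> padic pr.
  by rewrite -ratr_int padic_ratr_eq0 intr_eq0 gt_eqF.
pose x' := - (r`_1)%:~R / (r`_2)%:~R - x.
have xx' y : ev y = 0 -> y != x -> y = x'.
  move=> evy yx; have yx0 : y - x != 0 by rewrite subr_eq0.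
  apply: (mulfI a0); apply: (mulfI yx0).
  apply/eqP; rewrite -subr_eq0; have <- : ev y - ev x = 0 by rewrite evx evy subrr.
  by apply/eqP; rewrite /ev /x' r2E; exact: esym (conj_root _ _ _ _ a0).
pose eps := if x == x' then 1 else padic_abs (x - x').
have eps0 : 0 < eps.
  by rewrite /eps; have [//|xn] := eqVneq x x'; rewrite padic_abs_gt0 subr_eq0.
have [a xa] := padic_dense x eps0.
exists (QuadData (absz r`_2) r`_1 r`_0 a); split=> //=.
- by rewrite absz_gt0 gt_eqF.
- set g := gcdn _ _; have : (g%:Z %| zcontents r)%Z.
    rewrite dvdz_contents; apply/polyOverP => i; rewrite dvdzE /=.
    case: i => [|[|[|i]]]; last by rewrite nth_default ?sr.
    + by rewrite dvdn_gcdr.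
    + by apply: dvdn_trans (dvdn_gcdl _ _) _; rewrite dvdn_gcdr.
    + by apply: dvdn_trans (dvdn_gcdl _ _) _; rewrite dvdn_gcdl.
  by rewrite zcontents_primitive q0 dvdzE /= dvdn1 => /eqP.
- move=> y evy yx; have yE := xx' y evy yx.
  move: xa; rewrite /eps -yE eq_sym (negPf yx) => xa; rewrite ltNge; apply/negP => h.
  move: (xa); rewrite ltNge => /negP; apply.
  have -> : x - y = (x - ratr a) - (y - ratr a) by rewrite opprB addrA subrK.
  by apply: le_trans (padic_absD _ _) _; rewrite padic_absN ge_max lexx.
Qed.

End Description.

(* Main.v *)
From HB Require Import structures.
Require Import Defs.
From mathcomp Require Import all_boot all_order all_algebra.
From mathcomp Require Import boolp classical_sets functions reals.
From mathcomp Require Import ring lra zify.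

(** Let [a n] and [x n] be the partial and the complete quotients of alpha. If
    [x n] is a root of the form [A X^2 + B X + C], then putting
    [X = a n + 1 / Y] gives a form with root [x n.+1]. The coefficients
    [quadA n], [quadB n], [quadC n] obtained in this way have the same
    discriminant [D] for all [n], and [quadC n.+1 = quadA n].

    The ell-adic side makes the forms integral. The conjugate of alpha is
    transformed by the same digits [a n], and [|x n.+1| > 1]. As long as the
    conjugate also stays outside the unit disc, the product relation between
    successive leading coefficients makes [|quadA n|] decrease, which the fixed
    discriminant does not allow for long; so after a number of steps bounded in
    terms of [D] the conjugate lies inside the open unit disc and remains there
    ([abs_conj_lt1]). From then on the coefficients are ell-integral elements of
    Z[1/ell], that is, integers ([quad_coefs_int]).

    The real side makes them bounded. Suppose that every [x n], up to the bound
    in the theorem, is positive in some real embedding. While [A C > 0], the two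
    real roots have the same sign, so that both are positive and [A B < 0]
    ([positive_root_sign]); as [a n > 0], the integers [|B|] decrease
    ([descent]), and this ends after boundedly many steps. Once [A C < 0], the
    next form has [A C < 0] too, for otherwise its coefficients would all have
    the same sign ([escape]). Then [B^2 + 4 |A C| = D] leaves finitely many
    forms, two of them coincide, and the complete quotient is recovered from its
    form as the root outside the unit disc ([complete_quotient_repeats]).

    Conversely, if the expansion is periodic, then [quadA] changes sign
    infinitely often, since otherwise [B] would be strictly monotone
    ([sign_change]). At a change of sign, [A C < 0], and the form has exactly one
    positive real root. That root gives the embedding, and periodicity with
    [x n = a n + 1 / x n.+1] spreads positivity to all indices
    ([periodic_embedding]).

    For the algorithm, Newton iteration from the given rational approximation
    converges to alpha and not to its conjugate ([newton_converges]), and a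
    rational number close enough to alpha has the same first [n] partial
    quotients ([expansion_near]). The precision that suffices is explicit,
    because [|x n|] is at most the real size of [quadA n], by the product
    formula. Hence partial quotients are computed by rational arithmetic, which
    is recursive. As soon as a repetition below [b] is known to exist, periods
    and pre-periods are recognised on the first [2 b] partial quotients
    ([agreement_suffices]) and can be found by bounded search. *)

Set Implicit Arguments.
Unset Strict Implicit.
Unset Printing Implicit Defensive.

Import Order.TTheory GRing.Theory Num.Theory.
Local Open Scope ring_scope.

(** * The absolute value of Q_ell *)

(** A synonym of [ratr] that carries a morphism structure: the generic one needs
    a numeric target field. *)
Definition padic_of_rat (ell : nat) (pr : prime ell) : rat -> padic pr := ratr.

Section PadicOfRat.
Variables (ell : nat) (pr : prime ell).

Fact padic_of_rat_zmod : zmod_morphism (@padic_of_rat ell pr).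
Proof.
move=> x y; rewrite /padic_of_rat !padic_ratr -pi_oppr -pi_addr.
by congr (\pi_(padic pr) _)%qT; apply: val_inj.
Qed.

Fact padic_of_rat_monoid : monoid_morphism (@padic_of_rat ell pr).
Proof.
split=> [|x y]; last exact: padic_ratrM.
by rewrite /padic_of_rat /ratr divr1.
Qed.

HB.instance Definition _ :=
  GRing.isZmodMorphism.Build rat (padic pr) (@padic_of_rat ell pr) padic_of_rat_zmod.
HB.instance Definition _ :=
  GRing.isMonoidMorphism.Build rat (padic pr) (@padic_of_rat ell pr) padic_of_rat_monoid.

End PadicOfRat.

Section PadicAbsTheory.
Variables (ell : nat) (pr : prime ell).
Implicit Types x y : padic pr.
Local Notation "|` x |" := (padic_abs x) (at level 0, x at level 99).
Local Notation "q %:K" := (padic_of_rat pr q) (at level 2, format "q %:K").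

Lemma padic_abs_rat q : |` q%:K | = rat_abs ell q.
Proof. exact: padic_abs_ratr. Qed.

Lemma padic_abs1 : |` 1 : padic pr | = 1.
Proof. by rewrite -(rmorph1 (padic_of_rat pr)) padic_abs_rat rat_abs1. Qed.

Lemma padic_absV x : |` x^-1 | = |` x |^-1.
Proof.
have [->|x0] := eqVneq x 0; first by rewrite invr0 padic_abs0 invr0.
apply: (mulfI (lt0r_neq0 (_ : 0 < |` x |))); first by rewrite padic_abs_gt0.
by rewrite -padic_absM !divff ?padic_abs1 // gt_eqF // padic_abs_gt0.
Qed.

Lemma padic_absX x n : |` x ^+ n | = |` x | ^+ n.
Proof. by elim: n => [|n IHn]; rewrite ?padic_abs1 // !exprS padic_absM IHn. Qed.

Lemma padic_abs_dist x y : |` x - y | = |` y - x |.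
Proof. by rewrite -padic_absN opprB. Qed.

Lemma padic_abs_ltD x y c : |` x | < c -> |` y | < c -> |` x + y | < c.
Proof. by move=> xc yc; apply: le_lt_trans (padic_absD _ _) _; rewrite gt_max xc. Qed.

Lemma padic_abs_leD x y c : |` x | <= c -> |` y | <= c -> |` x + y | <= c.
Proof. by move=> xc yc; apply: le_trans (padic_absD _ _) _; rewrite ge_max xc. Qed.

Lemma padic_abs_dominant x y : |` y | < |` x | -> |` x + y | = |` x |.
Proof.
move=> yx; apply/eqP; rewrite eq_le padic_abs_leD ?(ltW yx) //= leNgt; apply/negP => h.
have : |` (x + y) + - y | < |` x | by rewrite padic_abs_ltD // padic_absN.
by rewrite addrK ltxx.
Qed.

Lemma padic_abs_near x y : |` x - y | < |` x | -> |` y | = |` x |.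
Proof.
rewrite padic_abs_dist => /padic_abs_dominant <-.
by congr padic_abs; rewrite addrC subrK.
Qed.

(** The values of the absolute value are discrete because Q is dense and the
    absolute value is locally constant away from 0. *)
Lemma padic_abs_ratP x : exists q, |` x | = rat_abs ell q.
Proof.
have [->|x0] := eqVneq x 0; first by exists 0; rewrite padic_abs0 rat_abs0.
have [|q xq] := @padic_dense _ _ x |` x |; first by rewrite padic_abs_gt0.
by exists q; rewrite -padic_abs_rat (padic_abs_near xq).
Qed.

(** Only 0 and powers of [ell] are values, so there is a gap below 1. *)
Lemma padic_abs_lt1 x : |` x | < 1 -> |` x | <= ell%:R^-1.
Proof.
have [q ->] := padic_abs_ratP x; rewrite /rat_abs; case: eqVneq => [_ _|q0].
  by rewrite invr_ge0 ler0n.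
have l1 : 1 < ell%:R :> rat by rewrite ltr1n prime_gt1.
have l0 : 0 < ell%:R :> rat by rewrite ltr0n prime_gt0.
rewrite ltr_pdivrMr ?exprn_gt0 // mul1r ltr_eXn2l // => h.
by rewrite ler_pdivrMr ?exprn_gt0 // ler_pdivlMl // -exprS ler_eXn2l.
Qed.

Lemma padic_abs_gt1 x : 1 < |` x | -> ell%:R <= |` x |.
Proof.
move=> x1; have x0 := lt_trans ltr01 x1; have l0 : 0 < ell%:R :> rat by rewrite ltr0n prime_gt0.
have /padic_abs_lt1 : |` x^-1 | < 1 by rewrite padic_absV invf_lt1.
by rewrite padic_absV lef_pV2.
Qed.

End PadicAbsTheory.

(** * Recursive functions of natural numbers *)

Definition ttail k (w : k.+1.-tuple nat) : k.-tuple nat := [tuple of behead w].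

Section NatFunctions.
Local Open Scope nat_scope.

Lemma eq_recursive k (f g : k.-tuple nat -> nat) :
  f =1 g -> recursive f -> recursive g.
Proof. by move=> /funext ->. Qed.

(** Composition in the form used below: variables are renamed, dropped or
    substituted by reading the arguments off an arbitrary tuple-valued map. *)
Lemma recursive_subst k m (f : m.-tuple nat -> nat) (t : k.-tuple nat -> m.-tuple nat) :
  recursive f -> (forall i, recursive (fun v => tnth (t v) i)) ->
  recursive (fun v => f (t v)).
Proof.
move=> Rf Rt; pose gs := [tuple (fun v : k.-tuple nat => tnth (t v) i) | i < m].
have Rgs i : recursive (tnth gs i) by rewrite tnth_mktuple.
apply: eq_recursive (rec_comp Rf Rgs) => v; congr f.
by apply: eq_from_tnth => i; rewrite tnth_map tnth_mktuple.
Qed.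

Lemma recursive_ttail k (f : k.-tuple nat -> nat) :
  recursive f -> recursive (fun w : k.+1.-tuple nat => f (ttail w)).
Proof.
move=> Rf; apply: recursive_subst Rf _ => i.
apply: eq_recursive (rec_proj (inord i.+1)) => w.
by rewrite tnth_behead.
Qed.

Lemma recursive_thead k : recursive (fun w : k.+1.-tuple nat => thead w).
Proof. exact: (rec_proj ord0). Qed.

Lemma recursive_cons k m (f : m.+1.-tuple nat -> nat) (b : k.-tuple nat -> nat)
    (t : k.-tuple nat -> m.-tuple nat) :
  recursive f -> recursive b -> (forall i, recursive (fun v => tnth (t v) i)) ->
  recursive (fun v => f [tuple of b v :: t v]).
Proof.
move=> Rf Rb Rt; apply: recursive_subst Rf _ => i.
by case: (unliftP ord0 i) => [j|] ->; [under [fun _ => _]funext => v do rewrite tnthS|].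
Qed.

Lemma recursive_succ k (f : k.-tuple nat -> nat) :
  recursive f -> recursive (fun v => (f v).+1).
Proof.
move=> Rf; apply: eq_recursive (recursive_cons (t := fun=> [tuple]) rec_succ Rf _) => //.
by case.
Qed.

Lemma recursive_cst k c : recursive (fun _ : k.-tuple nat => c).
Proof. by elim: c => [|c IHc]; [exact: rec_zero|exact: recursive_succ]. Qed.

(** Primitive recursion for a loop whose bound, initial value and step may all
    depend on the parameters. *)
Lemma recursive_loop k (b a : k.-tuple nat -> nat)
    (s : nat -> nat -> k.-tuple nat -> nat) :
  recursive b -> recursive a ->
  recursive (fun w : k.+2.-tuple nat => s (thead w) (thead (ttail w)) (ttail (ttail w))) ->
  recursive (fun v => nat_rect (fun=> nat) (a v) (fun i x => s i x v) (b v)).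
Proof.
move=> Rb Ra Rs.
have := recursive_cons (t := id) (rec_prim Ra Rs) Rb (@rec_proj k).
apply: eq_recursive => v; rewrite /prim_rec.
have -> : thead [tuple of b v :: v] = b v by [].
have -> : [tuple of behead [tuple of b v :: v]] = v by apply: val_inj.
elim: (b v) => //= m ->.
rewrite !theadE; congr (s _ _ _); last by apply: val_inj.
Qed.

Lemma recursive_add k (f g : k.-tuple nat -> nat) :
  recursive f -> recursive g -> recursive (fun v => f v + g v).
Proof.
move=> Rf Rg; apply: eq_recursive (recursive_loop (s := fun _ x _ => x.+1) Rg Rf _) => [v|].
  by elim: (g v) => [|m IHm]; rewrite ?addn0 //= IHm addnS.
by apply/recursive_succ/recursive_ttail/recursive_thead.
Qed.

Lemma recursive_mul k (f g : k.-tuple nat -> nat) :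
  recursive f -> recursive g -> recursive (fun v => f v * g v).
Proof.
move=> Rf Rg; have R0 := recursive_cst k 0.
apply: eq_recursive (recursive_loop (s := fun _ x v => x + f v) Rg R0 _) => [v|].
  by elim: (g v) => [|m IHm]; rewrite ?muln0 //= IHm mulnSr.
apply: recursive_add; first exact/recursive_ttail/recursive_thead.
exact: recursive_ttail (recursive_ttail Rf).
Qed.

Lemma recursive_exp k (f g : k.-tuple nat -> nat) :
  recursive f -> recursive g -> recursive (fun v => f v ^ g v).
Proof.
move=> Rf Rg; have R1 := recursive_cst k 1.
apply: eq_recursive (recursive_loop (s := fun _ x v => x * f v) Rg R1 _) => [v|].
  by elim: (g v) => [|m IHm]; rewrite ?expn0 //= IHm expnSr.
apply: recursive_mul; first exact/recursive_ttail/recursive_thead.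
exact: recursive_ttail (recursive_ttail Rf).
Qed.

Lemma recursive_pred k (f : k.-tuple nat -> nat) :
  recursive f -> recursive (fun v => (f v).-1).
Proof.
move=> Rf; have R0 := recursive_cst k 0.
apply: eq_recursive (recursive_loop (s := fun i _ _ => i) Rf R0 _) => [v|].
  by case: (f v).
exact: recursive_thead.
Qed.

Lemma recursive_sub k (f g : k.-tuple nat -> nat) :
  recursive f -> recursive g -> recursive (fun v => f v - g v).
Proof.
move=> Rf Rg; apply: eq_recursive (recursive_loop (s := fun _ x _ => x.-1) Rg Rf _) => [v|].
  by elim: (g v) => [|m IHm]; rewrite ?subn0 //= IHm subnS.
by apply/recursive_pred/recursive_ttail/recursive_thead.
Qed.

Lemma recursive_sum k (b : k.-tuple nat -> nat) (F : nat -> k.-tuple nat -> nat) :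
  recursive b -> recursive (fun w : k.+1.-tuple nat => F (thead w) (ttail w)) ->
  recursive (fun v => \sum_(i < b v) F i v).
Proof.
move=> Rb RF; have R0 := recursive_cst k 0.
apply: eq_recursive (recursive_loop (s := fun i x v => x + F i v) Rb R0 _) => [v|].
  by elim: (b v) => [|m IHm]; rewrite ?big_ord0 //= IHm big_ord_recr.
apply: recursive_add; first exact/recursive_ttail/recursive_thead.
have Rt (i : 'I_k) : recursive (fun w : k.+2.-tuple nat => tnth (ttail (ttail w)) i).
  exact: recursive_ttail (recursive_ttail (rec_proj i)).
apply: eq_recursive (recursive_cons (t := fun w => ttail (ttail w)) RF (recursive_thead _) Rt) => w.
by congr F; apply: val_inj.
Qed.

(** * Decidable predicates *)

Definition decides k (p : k.-tuple nat -> bool) := recursive (fun v => nat_of_bool (p v)).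

Lemma decides_not k (p : k.-tuple nat -> bool) : decides p -> decides (fun v => ~~ p v).
Proof.
move=> Rp; apply: eq_recursive (recursive_sub (recursive_cst k 1) Rp) => v.
by case: (p v).
Qed.

Lemma decides_and k (p q : k.-tuple nat -> bool) :
  decides p -> decides q -> decides (fun v => p v && q v).
Proof.
move=> Rp Rq; apply: eq_recursive (recursive_mul Rp Rq) => v.
by rewrite mulnb.
Qed.

Lemma decides_or k (p q : k.-tuple nat -> bool) :
  decides p -> decides q -> decides (fun v => p v || q v).
Proof.
move=> Rp Rq; apply: eq_recursive (decides_not (decides_and (decides_not Rp) (decides_not Rq))).
by move=> v; rewrite negb_and !negbK.
Qed.

Lemma decides_imp k (p q : k.-tuple nat -> bool) :
  decides p -> decides q -> decides (fun v => p v ==> q v).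
Proof.
move=> Rp Rq; apply: eq_recursive (decides_or (decides_not Rp) Rq).
by move=> v; rewrite implybE.
Qed.

Lemma decides_leq k (f g : k.-tuple nat -> nat) :
  recursive f -> recursive g -> decides (fun v => f v <= g v).
Proof.
move=> Rf Rg; apply: eq_recursive (recursive_sub (recursive_cst k 1) (recursive_sub Rf Rg)).
by move=> v; rewrite [in RHS]/leq; case: (f v - g v).
Qed.

Lemma decides_eq k (f g : k.-tuple nat -> nat) :
  recursive f -> recursive g -> decides (fun v => f v == g v).
Proof.
move=> Rf Rg; apply: eq_recursive (decides_and (decides_leq Rf Rg) (decides_leq Rg Rf)).
by move=> v; rewrite eqn_leq.
Qed.

Lemma recursive_if k (p : k.-tuple nat -> bool) (f g : k.-tuple nat -> nat) :
  decides p -> recursive f -> recursive g ->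
  recursive (fun v => if p v then f v else g v).
Proof.
move=> Rp Rf Rg; apply: eq_recursive
  (recursive_add (recursive_mul Rp Rf) (recursive_mul (decides_not Rp) Rg)) => v.
by case: (p v); rewrite !(mul1n, mul0n, addn0, add0n).
Qed.

Lemma decides_all k (b : k.-tuple nat -> nat) (p : nat -> k.-tuple nat -> bool) :
  recursive b -> decides (fun w : k.+1.-tuple nat => p (thead w) (ttail w)) ->
  decides (fun v => [forall i : 'I_(b v), p i v]).
Proof.
move=> Rb Rp; have Rnp := recursive_sum (F := fun i v => ~~ p i v) Rb (decides_not Rp).
apply: eq_recursive (decides_eq Rnp (recursive_cst k 0)) => v; congr nat_of_bool.
rewrite sum_nat_eq0; apply/forallP/forallP => h i; have := h i; by case: (p i v).
Qed.

Lemma decides_has k (b : k.-tuple nat -> nat) (p : nat -> k.-tuple nat -> bool) :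
  recursive b -> decides (fun w : k.+1.-tuple nat => p (thead w) (ttail w)) ->
  decides (fun v => [exists i : 'I_(b v), p i v]).
Proof.
move=> Rb Rp; have Rnp := decides_all (p := fun i v => ~~ p i v) Rb (decides_not Rp).
by apply: eq_recursive (decides_not Rnp) => v; rewrite negb_forall; under eq_existsb do rewrite negbK.
Qed.

Lemma decides_dvdn k (f g : k.-tuple nat -> nat) :
  recursive f -> recursive g -> decides (fun v => f v %| g v).
Proof.
move=> Rf Rg; apply: eq_recursive
  (decides_has (p := fun q v => q * f v == g v) (recursive_succ Rg) _) => [v|].
  congr nat_of_bool; apply/existsP/dvdnP => [[i /eqP <-]|[q gq]]; first by exists i.
  (* the quotient is at most [g v], except that 0 also divides 0 *)
  have [f0|f0] := posnP (f v); first by exists ord0; rewrite gq f0 !muln0.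
  have qg : q < (g v).+1 by rewrite ltnS gq leq_pmulr.
  by exists (Ordinal qg); rewrite [in eqbRHS]gq.
apply: decides_eq (recursive_ttail Rg).
exact: recursive_mul (recursive_thead _) (recursive_ttail Rf).
Qed.

Lemma decides_prime k (f : k.-tuple nat -> nat) :
  recursive f -> decides (fun v => prime (f v)).
Proof.
move=> Rf; apply: eq_recursive (decides_and (decides_leq (recursive_cst k 2) Rf)
  (decides_all (p := fun d v => (d %| f v) ==> (d <= 1)) Rf _)) => [v|].
  congr nat_of_bool; apply/andP/primeP => -[f1 h]; split => //.
    move=> d df; have := dvdn_leq (ltnW f1) df; rewrite leq_eqVlt => /orP[->|dlt]; first by rewrite orbT.
    move/forallP: h => /(_ (Ordinal dlt)); rewrite df /= leq_eqVlt ltnS leqn0 => /orP[->//|/eqP d0].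
    by move: df f1; rewrite d0 dvd0n => /eqP ->.
  apply/forallP => i; apply/implyP => /h /orP[/eqP -> //|/eqP ei].
  by have := ltn_ord i; rewrite {1}ei ltnn.
apply: decides_imp; first exact: decides_dvdn (recursive_thead _) (recursive_ttail Rf).
exact: decides_leq (recursive_thead _) (recursive_cst _ 1).
Qed.

(** The multiplicity of [p] in [f v] is the number of powers of [p] that divide
    it, and only exponents below [f v] matter. *)
Lemma recursive_logn k p (f : k.-tuple nat -> nat) : prime p ->
  recursive f -> recursive (fun v => logn p (f v)).
Proof.
move=> pp Rf; pose F i (v : k.-tuple nat) : nat := (p ^ i.+1 %| f v).
apply: eq_recursive (recursive_mul (decides_leq (recursive_cst k 1) Rf)
  (recursive_sum (b := f) (F := F) Rf _)) => [v|].
  have [->|f0] := posnP (f v); first by rewrite mul0n logn0.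
  rewrite mul1n logn_count_dvd // big_add1 /=.
  rewrite -(big_mkord xpredT (fun i => nat_of_bool (p ^ i.+1 %| f v))).
  case: (f v) f0 => // n _; rewrite big_nat_recr //= [X in _ + X](_ : _ = 0) ?addn0 //.
  apply/eqP; rewrite eqb0; apply/negP => /dvdn_leq => /(_ isT).
  by apply/negP; rewrite -ltnNge ltn_expl // prime_gt1.
apply: decides_dvdn (recursive_ttail Rf).
by apply: recursive_exp (recursive_cst _ p) _; apply/recursive_succ/recursive_thead.
Qed.

(** Minimisation is allowed only for functions that have a zero, so the search
    is also stopped at the bound; below the bound this does not change the result. *)
Lemma recursive_bounded_min k (b : k.-tuple nat -> nat) (p : nat -> k.-tuple nat -> bool) :
  recursive b -> decides (fun w : k.+1.-tuple nat => p (thead w) (ttail w)) ->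
  exists2 g, recursive g & forall v m, m <= b v -> p m v ->
    p (g v) v /\ forall m', p m' v -> g v <= m'.
Proof.
move=> Rb Rp.
(* zero exactly when the predicate holds or the bound is reached *)
pose f (w : k.+1.-tuple nat) : nat := ~~ (p (thead w) (ttail w) || (b (ttail w) <= thead w)).
have Rf : recursive f.
  apply: decides_not (decides_or Rp _).
  exact: decides_leq (recursive_ttail Rb) (recursive_thead _).
have fE n (v : k.-tuple nat) : (f [tuple of n :: v] == 0) = p n v || (b v <= n).
  rewrite /f eqb0 negbK (_ : ttail _ = v); last exact: val_inj.
  by rewrite theadE.
have f0 (v : k.-tuple nat) : exists n, f [tuple of n :: v] == 0.
  by exists (b v); rewrite fE leqnn orbT.
exists (fun v => ex_minn (f0 v)); first exact: rec_min.
move=> v m mb pm; case: ex_minnP => n; rewrite fE => pn nmin.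
have nle m' : p m' v -> n <= m' by move=> pm'; apply: nmin; rewrite fE pm'.
split=> //; case/orP: pn => // bn.
by have -> : n = m by apply/eqP; rewrite eqn_leq nle // (leq_trans mb).
Qed.

End NatFunctions.

(** * Integers and rationals *)

(** An integer is represented as a difference of naturals, so that no case
    distinction on signs occurs in the ring operations. *)
Variant computes_int k (f : k.-tuple nat -> int) : Prop :=
  ComputesInt g h of recursive g & recursive h & forall v, f v = (g v)%:Z - (h v)%:Z.

(** The denominator is a successor, hence never zero. *)
Variant computes_rat k (f : k.-tuple nat -> rat) : Prop :=
  ComputesRat g d of computes_int g & recursive d &
    forall v, f v = (g v)%:~R / (d v).+1%:R.

Section IntRat.
Variable k : nat.
Implicit Types (f g : k.-tuple nat -> int) (x y : k.-tuple nat -> rat).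

Lemma computes_int_nat (f : k.-tuple nat -> nat) : recursive f -> computes_int (fun v => (f v)%:Z).
Proof. by move=> Rf; exists f (fun=> 0%N) => // [|v]; [exact: rec_zero|rewrite subr0]. Qed.

Lemma computes_int_opp f : computes_int f -> computes_int (fun v => - f v).
Proof. by case=> a b Ra Rb fE; exists b a => // v; rewrite fE opprB. Qed.

Lemma computes_int_add f g : computes_int f -> computes_int g -> computes_int (fun v => f v + g v).
Proof.
case=> a b Ra Rb fE [c d Rc Rd gE].
exists (fun v => a v + c v)%N (fun v => b v + d v)%N; try exact: recursive_add.
by move=> v; rewrite fE gE; lia.
Qed.

Lemma computes_int_mul f g : computes_int f -> computes_int g -> computes_int (fun v => f v * g v).
Proof.
case=> a b Ra Rb fE [c d Rc Rd gE].
exists (fun v => a v * c v + b v * d v)%N (fun v => a v * d v + b v * c v)%N.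
- exact: recursive_add (recursive_mul _ _) (recursive_mul _ _).
- exact: recursive_add (recursive_mul _ _) (recursive_mul _ _).
- by move=> v; rewrite fE gE !PoszD !PoszM; ring.
Qed.

Lemma computes_int_if (p : k.-tuple nat -> bool) f g :
  decides p -> computes_int f -> computes_int g ->
  computes_int (fun v => if p v then f v else g v).
Proof.
move=> Rp [a b Ra Rb fE] [c d Rc Rd gE].
exists (fun v => if p v then a v else c v) (fun v => if p v then b v else d v).
- exact: recursive_if.
- exact: recursive_if.
- by move=> v; rewrite fE gE; case: (p v).
Qed.

Lemma recursive_absz f : computes_int f -> recursive (fun v => `|f v|%N).
Proof.
case=> a b Ra Rb fE.
apply: eq_recursive (recursive_add (recursive_sub Ra Rb) (recursive_sub Rb Ra)) => v.
by rewrite fE; lia.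
Qed.

Lemma computes_rat_int f : computes_int f -> computes_rat (fun v => (f v)%:~R).
Proof. by move=> Rf; exists f (fun=> 0%N) => // [|v]; [exact: rec_zero|rewrite divr1]. Qed.

Lemma computes_rat_nat (f : k.-tuple nat -> nat) : recursive f -> computes_rat (fun v => (f v)%:R).
Proof. by move=> Rf; exact: computes_rat_int (computes_int_nat Rf). Qed.

Lemma computes_rat_opp x : computes_rat x -> computes_rat (fun v => - x v).
Proof.
case=> g d Rg Rd xE; exists (fun v => - g v) d => //; first exact: computes_int_opp.
by move=> v; rewrite xE mulrNz mulNr.
Qed.

Lemma computes_rat_add x y : computes_rat x -> computes_rat y -> computes_rat (fun v => x v + y v).
Proof.
case=> g d Rg Rd xE [h e Rh Re yE].
have Rd1 := recursive_succ Rd; have Re1 := recursive_succ Re.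
exists (fun v => g v * ((e v).+1)%:Z + h v * ((d v).+1)%:Z)
       (fun v => ((d v).+1 * (e v).+1).-1)%N.
- exact: computes_int_add (computes_int_mul Rg (computes_int_nat Re1))
    (computes_int_mul Rh (computes_int_nat Rd1)).
- exact: recursive_pred (recursive_mul _ _).
move=> v; rewrite xE yE prednK ?muln_gt0 // natrM intrD !intrM -!pmulrn.
by rewrite addf_div ?pnatr_eq0.
Qed.

Lemma computes_rat_mul x y : computes_rat x -> computes_rat y -> computes_rat (fun v => x v * y v).
Proof.
case=> g d Rg Rd xE [h e Rh Re yE].
have Rd1 := recursive_succ Rd; have Re1 := recursive_succ Re.
exists (fun v => g v * h v) (fun v => ((d v).+1 * (e v).+1).-1)%N.
- exact: computes_int_mul.
- exact: recursive_pred (recursive_mul _ _).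
move=> v; rewrite xE yE prednK ?muln_gt0 // natrM intrM.
by rewrite mulf_div.
Qed.

Lemma computes_rat_inv x : computes_rat x -> computes_rat (fun v => (x v)^-1).
Proof.
case=> g d Rg Rd xE.
exists (fun v => g v * ((d v).+1)%:Z) (fun v => (`|g v| * `|g v|).-1)%N.
- exact: computes_int_mul Rg (computes_int_nat (recursive_succ Rd)).
- exact/recursive_pred/recursive_mul/recursive_absz/Rg/recursive_absz.
move=> v; rewrite xE; have [->|g0] := eqVneq (g v) 0; first by rewrite !mul0r invr0.
rewrite prednK; last by rewrite muln_gt0 absz_gt0 g0.
have -> : (`|g v| * `|g v|)%:R = (g v)%:~R * (g v)%:~R :> rat.
  by rewrite -intrM pmulrn PoszM !abszE -normrM ger0_norm // -expr2 sqr_ge0.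
rewrite intrM -!pmulrn invf_div -mulf_div divff ?mul1r ?intr_eq0 //.
Qed.

Lemma decides_int_eq0 f : computes_int f -> decides (fun v => f v == 0).
Proof.
move=> Rf; apply: eq_recursive (decides_eq (recursive_absz Rf) (recursive_cst k 0)) => v.
by rewrite absz_eq0.
Qed.

Lemma decides_rat_eq x y : computes_rat x -> computes_rat y -> decides (fun v => x v == y v).
Proof.
move=> Rx Ry; have [g d Rg _ xE] := computes_rat_add Rx (computes_rat_opp Ry).
apply: eq_recursive (decides_int_eq0 Rg) => v.
have /negPf d0 : (d v).+1%:R^-1 != 0 :> rat by rewrite lt0r_neq0 // invr_gt0 ltr0Sn.
by rewrite -[x v == _]subr_eq0 xE mulf_eq0 intr_eq0 d0 orbF.
Qed.

Lemma computes_rat_if (p : k.-tuple nat -> bool) x y :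
  decides p -> computes_rat x -> computes_rat y ->
  computes_rat (fun v => if p v then x v else y v).
Proof.
move=> Rp [a b Ra Rb fE] [c d Rc Rd gE].
exists (fun v => if p v then a v else c v) (fun v => if p v then b v else d v).
- exact: computes_int_if.
- exact: recursive_if.
- by move=> v; rewrite fE gE; case: (p v).
Qed.

End IntRat.

(** * Primitive recursion with a rational state *)

Lemma computes_int_subst k m (f : m.-tuple nat -> int) (t : k.-tuple nat -> m.-tuple nat) :
  computes_int f -> (forall i, recursive (fun v => tnth (t v) i)) ->
  computes_int (fun v => f (t v)).
Proof.
case=> a b Ra Rb fE Rt; exists (fun v => a (t v)) (fun v => b (t v)) => //;
  exact: recursive_subst.
Qed.

Lemma computes_rat_subst k m (x : m.-tuple nat -> rat) (t : k.-tuple nat -> m.-tuple nat) :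
  computes_rat x -> (forall i, recursive (fun v => tnth (t v) i)) ->
  computes_rat (fun v => x (t v)).
Proof.
case=> a b Ra Rb fE Rt; exists (fun v => a (t v)) (fun v => b (t v)) => //.
  exact: computes_int_subst.
exact: recursive_subst.
Qed.

Lemma computes_rat_ttail k (x : k.-tuple nat -> rat) :
  computes_rat x -> computes_rat (fun w : k.+1.-tuple nat => x (ttail w)).
Proof. by move=> Rx; apply: computes_rat_subst Rx _ => i; exact: recursive_ttail (rec_proj i). Qed.

(** Primitive recursion carries a single natural number, so a rational state is
    stored in the exponents of 2, 3 and 5. *)
Definition rat_of_code (e : nat) : rat :=
  ((logn 2 e)%:Z - (logn 3 e)%:Z)%:~R / (logn 5 e).+1%:R.

Lemma rat_of_code_computes k (e : k.-tuple nat -> nat) :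
  recursive e -> computes_rat (fun v => rat_of_code (e v)).
Proof.
move=> Re; exists (fun v => (logn 2 (e v))%:Z - (logn 3 (e v))%:Z) (fun v => logn 5 (e v)) => //.
  by apply: computes_int_add (computes_int_opp _); apply: computes_int_nat; apply: recursive_logn.
exact: recursive_logn.
Qed.

Lemma computes_rat_code k (x : k.-tuple nat -> rat) :
  computes_rat x -> exists2 e, recursive e & forall v, x v = rat_of_code (e v).
Proof.
case=> g d [a b Ra Rb gE] Rd xE.
exists (fun v => 2 ^ a v * 3 ^ b v * 5 ^ d v)%N.
  by do !apply: recursive_mul; apply: recursive_exp => //; exact: recursive_cst.
move=> v; rewrite xE gE /rat_of_code !lognM ?muln_gt0 ?expn_gt0 // !lognX !logn_prime //=.
by rewrite !(muln0, muln1, addn0, add0n).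
Qed.

(** The step may be any computable operation on a rational state: it is applied
    to the decoded state, and the result is encoded again. The codes need not be
    unique, since only the decoded values are compared. *)
Lemma computes_rat_iter k (n : k.-tuple nat -> nat) (x : k.-tuple nat -> rat)
    (s : k.-tuple nat -> rat -> rat) :
  recursive n -> computes_rat x ->
  (forall y : k.+2.-tuple nat -> rat,
     computes_rat y -> computes_rat (fun w => s (ttail (ttail w)) (y w))) ->
  computes_rat (fun v => iter (n v) (s v) (x v)).
Proof.
move=> Rn Rx Rs; have [e Re xE] := computes_rat_code Rx.
pose y (w : k.+2.-tuple nat) := rat_of_code (thead (ttail w)).
have Ry : computes_rat y by apply/rat_of_code_computes/recursive_ttail/recursive_thead.
have [f Rf fE] := computes_rat_code (Rs y Ry).
pose h i c (v : k.-tuple nat) := f [tuple of i :: [tuple of c :: v]].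
have Rh : recursive (fun w : k.+2.-tuple nat => h (thead w) (thead (ttail w)) (ttail (ttail w))).
  apply: eq_recursive Rf => w; congr f; case/tupleP: w => i w; case/tupleP: w => c w.
  by apply: val_inj.
have [g d Rg Rd E] := rat_of_code_computes (recursive_loop (s := h) Rn Re Rh).
exists g d => // v; rewrite -E; elim: (n v) => /= [|m ->]; first exact: xE.
rewrite /h -fE; congr (s _ _); first by apply: val_inj.
Qed.

(** * The ell-adic floor of a rational number *)

Lemma in_Zinv_int (ell : nat) (pr : prime ell) (a : rat) :
  in_Zinv ell a -> rat_abs ell a <= 1 -> a \is a Num.int.
Proof.
move=> [n aZ] a1; have l0 : ell%:R != 0 :> rat by rewrite pnatr_eq0 -lt0n prime_gt0.
have laZ : in_Zinv ell (ell%:R * a) by exists n; rewrite -mulrA rpredM ?natr_int.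
have [|k /(mulfI l0) ->] := in_Zinv_lt1 pr laZ; last exact: intr_int.
rewrite rat_absM // rat_abs_ell // mulrC; apply: le_lt_trans (ler_pM _ _ a1 (lexx _)) _.
- exact: rat_abs_ge0.
- by rewrite invr_ge0 ler0n.
- by rewrite mul1r invf_lt1 ?ltr0n ?prime_gt0 // ltr1n prime_gt1.
Qed.

(** Composite [ell] are allowed so that the function is total, as recursive
    functions are. *)
Definition rat_floor (ell : nat) (x : rat) : rat :=
  if @idP (prime ell) is ReflectT pr then padic_floor (ratr x : padic pr) else 0.

Lemma rat_floorE (ell : nat) (pr : prime ell) x :
  rat_floor ell x = padic_floor (ratr x : padic pr).
Proof. by rewrite /rat_floor; case: {-}_ / idP => // pr'; rewrite (bool_irrelevance pr' pr). Qed.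

(** For a possibly reducible fraction, [|x| < 1] says that some power of [ell]
    divides the numerator but not the denominator. *)
Lemma rat_abs_lt1P (ell : nat) (pr : prime ell) (g : int) (d : nat) :
  (rat_abs ell (g%:~R / d.+1%:R) < 1) =
  [exists e : 'I_d.+1, (ell ^ e.+1 %| `|g|)%N && ~~ (ell ^ e.+1 %| d.+1)%N].
Proof.
have [->|g0] := eqVneq g 0.
  (* 0 is divisible by every power; the exponent [d.+1] is too large for [d.+1] *)
  rewrite mul0r rat_abs0 ltr01; apply/esym/existsP; exists ord_max.
  rewrite dvdn0; apply/negP => /dvdn_leq => /(_ isT); apply/negP.
  by rewrite -ltnNge ltn_expl // prime_gt1.
have dz : d.+1%:R = (d.+1%:Z)%:~R :> rat by [].
rewrite dz rat_abs_frac //= ltr_pdivrMr ?exprn_gt0 ?ltr0n ?prime_gt0 // mul1r.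
rewrite ltr_eXn2l ?ltr1n ?prime_gt1 //.
apply/idP/existsP => [h|[e]]; last first.
  rewrite !pfactor_dvdn ?absz_gt0 // -ltnNge ltnS => /andP[h1 h2].
  exact: leq_ltn_trans h1.
have ed : (logn ell d.+1 < d.+1)%N.
  apply: leq_trans (dvdn_leq (ltn0Sn d) (pfactor_dvdnn ell d.+1)).
  by rewrite ltn_expl // prime_gt1.
exists (Ordinal ed) => /=; rewrite !pfactor_dvdn ?absz_gt0 // h /=.
by rewrite -ltnNge.
Qed.

Lemma decides_rat_abs_lt1 k (ell : k.-tuple nat -> nat) (x : k.-tuple nat -> rat) :
  recursive ell -> computes_rat x ->
  decides (fun v => prime (ell v) && (rat_abs (ell v) (x v) < 1)).
Proof.
move=> Rl [g d Rg Rd xE].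
pose p e v := (ell v ^ e.+1 %| `|g v|)%N && ~~ (ell v ^ e.+1 %| (d v).+1)%N.
have Rp : decides (fun w => p (thead w) (ttail w)).
  have Re : recursive (fun w : k.+1.-tuple nat => (ell (ttail w) ^ (thead w).+1)%N).
    exact: recursive_exp (recursive_ttail Rl) (recursive_succ (recursive_thead _)).
  apply: decides_and (decides_not _); apply: decides_dvdn Re _.
    exact: recursive_ttail (recursive_absz Rg).
  exact: recursive_ttail (recursive_succ Rd).
apply: eq_recursive (decides_and (decides_prime Rl) (decides_has (recursive_succ Rd) Rp)) => v.
case: (boolP (prime (ell v))) => //= pr.
by rewrite xE rat_abs_lt1P.
Qed.

(** With [x = g / e], the floor has absolute value at most [ell ^ e], so it is
    [m / ell ^ e] for a natural number [m < ell ^ e.+1] and is found by bounded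
    search. *)
Lemma rat_floor_computes k (ell : k.-tuple nat -> nat) (x : k.-tuple nat -> rat) :
  recursive ell -> computes_rat x -> computes_rat (fun v => rat_floor (ell v) (x v)).
Proof.
move=> Rl Rx; have [g d Rg Rd xE] := Rx.
pose e v := (d v).+1; have Re : recursive e by exact: recursive_succ.
pose q m v : rat := m%:R / (ell v ^ e v)%N%:R.
pose p m v := prime (ell v) && (rat_abs (ell v) (x v - q m v) < 1).
have Rb : recursive (fun v => ell v ^ (e v).+1)%N.
  exact: recursive_exp Rl (recursive_succ Re).
have Rq (m : k.+1.-tuple nat -> nat) : recursive m ->
    computes_rat (fun w => q (m w) (ttail w)).
  move=> Rm; apply: computes_rat_mul (computes_rat_nat Rm) (computes_rat_inv _).
  apply: computes_rat_nat; exact: recursive_ttail (recursive_exp Rl Re).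
have Rp : decides (fun w => p (thead w) (ttail w)).
  apply: decides_rat_abs_lt1 (recursive_ttail Rl) _.
  exact: computes_rat_add (computes_rat_ttail Rx) (computes_rat_opp (Rq _ (recursive_thead _))).
have [m Rm mP] := recursive_bounded_min Rb Rp.
have Rres : computes_rat (fun v => if prime (ell v) then q (m v) v else 0).
  apply: computes_rat_if (decides_prime Rl) _ (computes_rat_int (computes_int_nat (recursive_cst _ 0))).
  exact: computes_rat_mul (computes_rat_nat Rm) (computes_rat_inv (computes_rat_nat (recursive_exp Rl Re))).
have [g' d' Rg' Rd' E] := Rres; exists g' d' => // v; rewrite -E.
case: (boolP (prime (ell v))) => [pr|npr]; last first.
  by rewrite /rat_floor; case: {-}_ / idP => // pr; rewrite pr in npr.
rewrite (rat_floorE pr); set a := padic_floor _.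
have [aZ /andP[a0 al] xa] := padic_floorP (ratr (x v) : padic pr).
rewrite -/a -[ratr a]/(padic_of_rat pr a) -[ratr _]/(padic_of_rat pr _) in aZ a0 al xa.
rewrite -rmorphB padic_abs_rat in xa.
have l0 : 0 < (ell v)%:R :> rat by rewrite ltr0n prime_gt0.
have l1 : 1 <= (ell v)%:R :> rat by rewrite ler1n prime_gt0.
have le0 : 0 < ((ell v)%:R ^+ e v : rat) by rewrite exprn_gt0.
have xle : rat_abs (ell v) (x v) <= (ell v)%:R ^+ e v.
  have dz : (d v).+1%:R = ((d v).+1%:Z)%:~R :> rat by [].
  rewrite xE dz -[X in X / _]mulr1 -mulrA rat_absM // div1r rat_absV // rat_abs_int // invrK.
  apply: le_trans (ler_piMl _ (rat_abs_int_le1 pr _)) _; first by rewrite exprn_ge0 // ltW.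
  rewrite ler_weXn2l //= ltnW // (leq_trans (ltn_expl _ (prime_gt1 pr))) //.
  exact: dvdn_leq (pfactor_dvdnn _ _).
have ale : rat_abs (ell v) a <= (ell v)%:R ^+ e v.
  rewrite -(subKr (x v) a); apply: le_trans (rat_absB pr _ _) _.
  by rewrite ge_max xle (le_trans (ltW xa)) // exprn_ege1.
have /intrP[z zE] : a * (ell v)%:R ^+ e v \is a Num.int.
  apply: (in_Zinv_int pr).
    by case: aZ => n aZ; exists n; rewrite mulrAC rpredM // rpredX // natr_int.
  by rewrite rat_absM // rat_abs_ellX // ler_pdivrMr // mul1r.
have z0 : 0 <= z by rewrite -(ler_int rat) -zE mulr_ge0 // ltW.
case: z z0 zE => // z _ zE.
have aE : a = q z v.
  by rewrite /q natrX -[z%:R]/((Posz z)%:~R) -zE mulfK ?gt_eqF.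
have zle : (z <= ell v ^ (e v).+1)%N.
  rewrite -(ler_nat rat) -[z%:R]/((Posz z)%:~R) -zE natrX exprS.
  by rewrite ler_wpM2r ?ltW.
have pz : p z v by rewrite /p pr -aE.
have [/andP[_ pm] mmin] := mP v z zle pz.
apply: padic_floor_unique (padic_floorP _) _; split.
- by exists (e v); rewrite /q natrX divfK ?gt_eqF // natr_int.
- rewrite /q divr_ge0 ?ler0n //=; apply: le_lt_trans al.
  by rewrite aE /q ler_wpM2r ?invr_ge0 ?ler0n // ler_nat mmin.
rewrite -[ratr _]/(padic_of_rat pr _) -[X in X - _]/(padic_of_rat pr _).
by rewrite -rmorphB padic_abs_rat.
Qed.

(** * A recursive function that computes partial quotients *)

Definition newton (a b c x : rat) : rat :=
  x - (a * x ^+ 2 + b * x + c) / (a * x *+ 2 + b).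

Definition ruban_step (ell : nat) (x : rat) : rat := (x - rat_floor ell x)^-1.

Section Algorithm.
Variable c : 9.-tuple nat.
Local Notation "c .[ i ]" := (tnth c (@Ordinal 9 i isT)) : nat_scope.

(** A code stores each signed entry as a sign bit and an absolute value. *)
Definition signed (s m : nat) : int := if s == 0%N then m%:Z else - m%:Z.

(** An upper bound for the coefficients of the form of the [n]-th complete
    quotient: one step multiplies them by at most [(ell + 1) ^ 2]. *)
Definition height (n : nat) : nat :=
  ((c.[1] + c.[3] + c.[5]) * (c.[0] + 1) ^ (2 * n))%N.

Definition disc_bound : nat := (c.[3] ^ 2 + 4 * c.[1] * c.[5])%N.

(** After [disc_bound + 2] steps the forms are integral; their coefficients are
    then at most the height, which bounds the wait for opposite signs; the last
    term counts the pairs (A, B) that may follow. *)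
Definition search_bound : nat :=
  (disc_bound + 3 + height (disc_bound + 2) + (2 * disc_bound + 1) ^ 2)%N.

(** The number of Newton steps is large enough for the partial quotients up to
    the [n]-th to be those of alpha. *)
Definition approximation (n : nat) : rat :=
  iter (c.[1] + 2 * n * height n)
    (newton c.[1]%:R (signed c.[2] c.[3])%:~R (signed c.[4] c.[5])%:~R)
    ((signed c.[6] c.[7])%:~R / c.[8]%:R).

Definition digit (n : nat) : rat :=
  rat_floor c.[0] (iter n (ruban_step c.[0]) (approximation n)).

(** Agreement is tested on a finite range only, so that it is decidable; when a
    repetition occurs below the bound, this range is long enough. *)
Definition digits_agree (N k : nat) : bool :=
  [forall n : 'I_(2 * search_bound), (N <= n)%N ==> (digit (n + k) == digit n)].

End Algorithm.

Lemma newton_computes k (a b c x : k.-tuple nat -> rat) :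
  computes_rat a -> computes_rat b -> computes_rat c -> computes_rat x ->
  computes_rat (fun v => newton (a v) (b v) (c v) (x v)).
Proof.
by move=> Ra Rb Rc Rx; do ?[apply: computes_rat_add|apply: computes_rat_opp|
  apply: computes_rat_mul|apply: computes_rat_inv].
Qed.

Section AlgorithmComputes.
Variable (k : nat) (t : k.-tuple nat -> 9.-tuple nat).
Hypothesis Rt : forall i, recursive (fun v => tnth (t v) i).

Lemma signed_computes i j :
  computes_int (fun v => signed (tnth (t v) i) (tnth (t v) j)).
Proof.
apply: computes_int_if; first exact: decides_eq (Rt i) (recursive_cst _ 0).
  exact: computes_int_nat.
exact: computes_int_opp (computes_int_nat _).
Qed.

Lemma recursive_height n : recursive n -> recursive (fun v => height (t v) (n v)).
Proof.
move=> Rn; apply: recursive_mul; first by do ?apply: recursive_add.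
apply: recursive_exp; first exact: recursive_add (recursive_cst _ 1).
exact: recursive_mul (recursive_cst _ 2) Rn.
Qed.

Lemma recursive_disc_bound : recursive (fun v => disc_bound (t v)).
Proof.
apply: recursive_add; first exact: recursive_exp (recursive_cst _ 2).
apply: recursive_mul => //; exact: recursive_mul (recursive_cst _ 4) _.
Qed.

Lemma recursive_search_bound : recursive (fun v => search_bound (t v)).
Proof.
have RE := recursive_disc_bound; apply: recursive_add; first apply: recursive_add.
- exact: recursive_add RE (recursive_cst _ 3).
- exact: recursive_height (recursive_add RE (recursive_cst _ 2)).
- apply: recursive_exp (recursive_cst _ 2); apply: recursive_add (recursive_cst _ 1).
  exact: recursive_mul (recursive_cst _ 2) RE.
Qed.

Lemma approximation_computes n :
  recursive n -> computes_rat (fun v => approximation (t v) (n v)).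
Proof.
move=> Rn; apply: computes_rat_iter => [||y Ry].
- apply: recursive_add => //; apply: recursive_mul (recursive_height Rn).
  exact: recursive_mul (recursive_cst _ 2) Rn.
- exact: computes_rat_mul (computes_rat_int (signed_computes _ _))
    (computes_rat_inv (computes_rat_nat (Rt _))).
have R2 x : computes_rat x -> computes_rat (fun w : k.+2.-tuple nat => x (ttail (ttail w))).
  by move=> /computes_rat_ttail/computes_rat_ttail.
apply: newton_computes Ry.
- exact: (R2 _ (computes_rat_nat (Rt _))).
- exact: (R2 _ (computes_rat_int (signed_computes _ _))).
- exact: (R2 _ (computes_rat_int (signed_computes _ _))).
Qed.

Lemma digit_computes n : recursive n -> computes_rat (fun v => digit (t v) (n v)).
Proof.
move=> Rn; apply: rat_floor_computes => //; apply: computes_rat_iter => // [|y Ry].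
  exact: approximation_computes.
apply: computes_rat_inv (computes_rat_add Ry (computes_rat_opp _)); apply: rat_floor_computes Ry.
exact: recursive_ttail (recursive_ttail (Rt _)).
Qed.

End AlgorithmComputes.

Lemma digits_agree_decided k (t : k.-tuple nat -> 9.-tuple nat) N p :
  (forall i, recursive (fun v => tnth (t v) i)) -> recursive N -> recursive p ->
  decides (fun v => digits_agree (t v) (N v) (p v)).
Proof.
move=> Rt RN Rp.
apply: (decides_all (b := fun v => (2 * search_bound (t v))%N)
  (p := fun n v => (N v <= n)%N ==> (digit (t v) (n + p v) == digit (t v) n))).
  exact: recursive_mul (recursive_cst _ 2) (recursive_search_bound Rt).
have Rt' i : recursive (fun w : k.+1.-tuple nat => tnth (t (ttail w)) i).
  exact: recursive_ttail (Rt i).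
apply: decides_imp; first exact: decides_leq (recursive_ttail RN) (recursive_thead _).
apply: decides_rat_eq; apply: (digit_computes (t := fun w => t (ttail w)) Rt').
  exact: recursive_add (recursive_thead _) (recursive_ttail Rp).
exact: recursive_thead.
Qed.

Lemma rat_num_den k (x : k.-tuple nat -> rat) : computes_rat x ->
  exists num den, [/\ recursive num, recursive den &
    forall v, (0 < den v)%N /\ (0 <= x v -> x v = (num v)%:R / (den v)%:R)].
Proof.
case=> g d [a b Ra Rb gE] Rd xE.
exists (fun v => a v - b v)%N, (fun v => (d v).+1); split.
- exact: recursive_sub.
- exact: recursive_succ.
move=> v; split=> // x0; rewrite xE; congr (_ / _).
move: x0; rewrite xE pmulr_lge0 ?invr_gt0 ?ltr0n // ler0z gE subr_ge0 => h.
by rewrite pmulrn -subzn.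
Qed.

(** The three clauses specify the partial quotients, the least period of the
    tail and the least pre-period for this period, the last two under the hypothesis
    that makes the corresponding bounded search succeed. *)
Lemma expansion_recursive :
  exists (pre per : 9.-tuple nat -> nat) (num den : 10.-tuple nat -> nat),
    [/\ recursive pre, recursive per, recursive num & recursive den] /\
    forall c : 9.-tuple nat, [/\
      (forall n : nat, (0 < den [tuple of n :: c])%N /\ (0 <= digit c n ->
         digit c n = (num [tuple of n :: c])%:R / (den [tuple of n :: c])%:R)),
      (forall k, (0 < k <= search_bound c)%N -> digits_agree c (search_bound c) k ->
         [/\ (0 < per c)%N, digits_agree c (search_bound c) (per c) &
         forall k', (0 < k')%N -> digits_agree c (search_bound c) k' -> (per c <= k')%N]) &
      (forall N, (N <= search_bound c)%N -> digits_agree c N (per c) ->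
         digits_agree c (pre c) (per c) /\
         forall N', digits_agree c N' (per c) -> (pre c <= N')%N)].
Proof.
have Rid := @rec_proj 9.
have Rb := recursive_search_bound Rid.
have Rtl (i : 'I_9) : recursive (fun w : 10.-tuple nat => tnth (ttail w) i).
  exact: recursive_ttail (rec_proj i).
have [|per Rper perP] := recursive_bounded_min
    (p := fun k c => (0 < k)%N && digits_agree c (search_bound c) k) Rb _.
  apply: decides_and; first exact: decides_leq (recursive_cst _ 1) (recursive_thead _).
  exact: digits_agree_decided Rtl (recursive_search_bound Rtl) (recursive_thead _).
have [|pre Rpre preP] := recursive_bounded_min
    (p := fun N c => digits_agree c N (per c)) Rb _.
  exact: digits_agree_decided Rtl (recursive_thead _) (recursive_ttail Rper).
have [num [den [Rnum Rden numP]]] := rat_num_den (digit_computes Rtl (recursive_thead _)).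
exists pre, per, num, den; split; first exact: And4.
move=> c; split.
- move=> n; have := numP [tuple of n :: c].
  by rewrite theadE (_ : ttail _ = c) //; apply: val_inj.
- move=> k /andP[k0 kb] ak; have [|/andP[p0 pa] pmin] := perP c k kb; first by rewrite k0.
  by split=> // k' k'0 ak'; apply: pmin; rewrite k'0.
- by move=> N Nb aN; apply: preP aN.
Qed.

(** * Ruban expansions and the quadratic forms of their complete quotients *)

Section Orbit.
Variables (a : nat -> rat) (A0 B0 C0 : rat).

(** The coefficients of [A X^2 + B X + C] under the substitutions
    [X = a n + 1 / Y]. *)
Fixpoint coefs (n : nat) : rat * rat * rat :=
  if n is m.+1 then
    let: (A, B, C) := coefs m in
    (A * a m ^+ 2 + B * a m + C, A * a m *+ 2 + B, A)
  else (A0, B0, C0).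

Definition quadA n := (coefs n).1.1.
Definition quadB n := (coefs n).1.2.
Definition quadC n := (coefs n).2.

Lemma quadAS n : quadA n.+1 = quadA n * a n ^+ 2 + quadB n * a n + quadC n.
Proof. by rewrite /quadA /quadB /quadC /=; case: (coefs n) => -[]. Qed.

Lemma quadBS n : quadB n.+1 = quadA n * a n *+ 2 + quadB n.
Proof. by rewrite /quadA /quadB /=; case: (coefs n) => -[]. Qed.

Lemma quadCS n : quadC n.+1 = quadA n.
Proof. by rewrite /quadA /quadC /=; case: (coefs n) => -[]. Qed.

Lemma disc_coefs n :
  quadB n ^+ 2 - 4 * quadA n * quadC n = B0 ^+ 2 - 4 * A0 * C0.
Proof. by elim: n => // n <-; rewrite quadAS quadBS quadCS; ring. Qed.

Variables (F : fieldType) (phi : {rmorphism rat -> F}).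

(** Both roots of a form, and their images in a real field, are transformed by
    the same digits; hence the target field is arbitrary. *)
Fixpoint ruban_orbit (x : F) (n : nat) : F :=
  if n is m.+1 then (ruban_orbit x m - phi (a m))^-1 else x.

Definition root_of (A B C : rat) (x : F) : Prop :=
  phi A * x ^+ 2 + phi B * x + phi C = 0.

(** Vieta's relations, which unlike [root_of] determine the second root. *)
Definition roots_of (A B C : rat) (x y : F) : Prop :=
  phi B = - phi A * (x + y) /\ phi C = phi A * x * y.

Lemma roots_of_root A B C x y : roots_of A B C x y -> root_of A B C x.
Proof. by rewrite /root_of => -[-> ->]; ring. Qed.

Lemma orbit_root x : (forall n, ruban_orbit x n != phi (a n)) ->
  root_of A0 B0 C0 x -> forall n, root_of (quadA n) (quadB n) (quadC n) (ruban_orbit x n).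
Proof.
move=> xa x0; elim=> //= n; rewrite /root_of quadAS quadBS quadCS.
have := xa n; rewrite -subr_eq0; move: (ruban_orbit x n) => z za rz.
rewrite !(rmorphD, rmorphM, rmorphXn, rmorphMn) /=.
apply: (mulIf (expf_neq0 2 za)); rewrite mul0r -rz; field.
exact: za.
Qed.

Lemma orbit_roots x y :
  (forall n, ruban_orbit x n != phi (a n)) -> (forall n, ruban_orbit y n != phi (a n)) ->
  roots_of A0 B0 C0 x y ->
  forall n, roots_of (quadA n) (quadB n) (quadC n) (ruban_orbit x n) (ruban_orbit y n).
Proof.
move=> xa ya r0; elim=> //= n; rewrite /roots_of quadAS quadBS quadCS.
have := xa n; rewrite -subr_eq0 => xan; have := ya n; rewrite -subr_eq0.
move: (ruban_orbit x n) (ruban_orbit y n) xan => z t za ta [rB rC].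
rewrite !(rmorphD, rmorphM, rmorphXn, rmorphMn) /= rB rC.
by split; field; rewrite ?za ?ta.
Qed.

(** The quantity [2 A z + B] is a square root of the discriminant; each step
    changes its sign. This decides which real root an embedding selects. *)
Lemma orbit_delta x : (forall n, ruban_orbit x n != phi (a n)) ->
  root_of A0 B0 C0 x -> forall n,
  phi (quadA n) * ruban_orbit x n *+ 2 + phi (quadB n) =
  (-1) ^+ n * (phi A0 * x *+ 2 + phi B0).
Proof.
move=> xa x0; elim=> [|n IHn]; first by rewrite mul1r.
rewrite [in RHS]exprS -[in RHS]mulrA -IHn quadAS quadBS /=.
have := orbit_root xa x0 n; rewrite /root_of; have := xa n; rewrite -subr_eq0.
move: (ruban_orbit x n) => z za rz.
rewrite !(rmorphD, rmorphM, rmorphXn, rmorphMn) /=.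
have -> : phi (quadC n) = - (phi (quadA n) * z ^+ 2 + phi (quadB n) * z).
  by rewrite -[LHS]addr0 -oppr0 -rz; ring.
by field.
Qed.

Lemma eq_orbit x y n : (forall m, ruban_orbit x m != phi (a m)) ->
  (forall m, ruban_orbit y m != phi (a m)) -> ruban_orbit x n = ruban_orbit y n -> x = y.
Proof.
move=> xa ya; elim: n => //= n IHn /invr_inj/addIr; exact: IHn.
Qed.

End Orbit.

Lemma sub_inv (F : fieldType) (x y : F) : x != 0 -> y != 0 ->
  x - y = - ((x^-1 - y^-1) * x * y).
Proof. by move=> x0 y0; field; rewrite x0 y0. Qed.

Section Expansion.
Variables (ell : nat) (pr : prime ell).
Implicit Types x y : padic pr.
Local Notation "|` x |" := (padic_abs x) (at level 0, x at level 99).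
Local Notation "q %:K" := (padic_of_rat pr q) (at level 2, format "q %:K").

Definition padic_irrational x := forall q, x != q%:K.

Lemma complete_quotientE x n :
  complete_quotient x n = ruban_orbit (partial_quotient x) (padic_of_rat pr) x n.
Proof.
elim: n => [//|n IHn].
rewrite [RHS]/= -IHn.
reflexivity.
Qed.

Lemma complete_quotientD x m n :
  complete_quotient x (m + n) = complete_quotient (complete_quotient x m) n.
Proof. by elim: n => [|n IHn]; rewrite ?addn0 // addnS /= IHn. Qed.

Lemma partial_quotientD x m n :
  partial_quotient x (m + n) = partial_quotient (complete_quotient x m) n.
Proof. by rewrite /partial_quotient complete_quotientD. Qed.

Lemma irrational_inv_sub x q : padic_irrational x -> padic_irrational (x - q%:K)^-1.
Proof.
move=> xi r; apply/eqP => h; have /eqP := xi (r^-1 + q); apply.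
by rewrite rmorphD fmorphV /= -h invrK subrK.
Qed.

Lemma irrational_complete x n : padic_irrational x -> padic_irrational (complete_quotient x n).
Proof. by move=> xi; elim: n => [|n IHn]; [exact xi|exact (irrational_inv_sub _ IHn)]. Qed.

Lemma irrational_orbit a x n : padic_irrational x -> padic_irrational (ruban_orbit a (padic_of_rat pr) x n).
Proof. by move=> xi; elim: n => [|n IHn]; [exact xi|exact (irrational_inv_sub _ IHn)]. Qed.

Lemma partial_quotient_near x n : |` complete_quotient x n - (partial_quotient x n)%:K | < 1.
Proof. by have [] := padic_floorP (complete_quotient x n). Qed.

Lemma partial_quotient_Zinv x n : in_Zinv ell (partial_quotient x n).
Proof. by have [] := padic_floorP (complete_quotient x n). Qed.

Lemma partial_quotient_itv x n : 0 <= partial_quotient x n < ell%:R.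
Proof. by have [] := padic_floorP (complete_quotient x n). Qed.

Lemma complete_quotient_gt1 x n : padic_irrational x -> 1 < |` complete_quotient x n.+1 |.
Proof.
move=> /(irrational_complete n)/(_ (partial_quotient x n)); rewrite -subr_eq0 => nz.
by rewrite /= padic_absV invf_gt1 ?padic_abs_gt0 // partial_quotient_near.
Qed.

Lemma abs_partial_quotient x n : padic_irrational x ->
  |` (partial_quotient x n.+1)%:K | = |` complete_quotient x n.+1 |.
Proof.
move=> xi; have x1 := complete_quotient_gt1 n xi; have near := partial_quotient_near x n.+1.
exact: padic_abs_near (lt_trans near x1).
Qed.

Lemma partial_quotient_gt0 x n : padic_irrational x -> 0 < partial_quotient x n.+1.
Proof.
move=> xi; have /andP[a0 _] := partial_quotient_itv x n.+1.
rewrite lt_neqAle a0 andbT eq_sym; apply/negP => /eqP az.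
by have := abs_partial_quotient n xi; have := complete_quotient_gt1 n xi;
  rewrite az rmorph0 padic_abs0 => h1 h2; move: h1; rewrite -h2 ltr10.
Qed.

Lemma abs_sub_inv x y : x != 0 -> y != 0 ->
  |` x - y | = |` x^-1 - y^-1 | * |` x | * |` y |.
Proof.
by move=> x0 y0; rewrite -!padic_absM -[RHS]padic_absN -sub_inv.
Qed.

(** Each common partial quotient multiplies the distance of the complete
    quotients by at least [ell], while they stay within distance 1. *)
Lemma eq_expansion x y : padic_irrational x -> padic_irrational y ->
  partial_quotient x =1 partial_quotient y -> x = y.
Proof.
move=> xi yi xy.
have h n : |` x - y | <= |` complete_quotient x n - complete_quotient y n | * ell%:R ^- n.
  elim: n => [|n IHn]; first by rewrite divr1.
  apply: le_trans IHn _; rewrite exprS invfM mulrA ler_wpM2r ?invr_ge0 ?exprn_ge0 ?ler0n //.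
  have a0 z m : padic_irrational z -> complete_quotient z m - (partial_quotient z m)%:K != 0.
    by move=> /(irrational_complete m)/(_ (partial_quotient z m)); rewrite -subr_eq0.
  have -> : complete_quotient x n - complete_quotient y n =
    (complete_quotient x n - (partial_quotient x n)%:K) -
    (complete_quotient y n - (partial_quotient y n)%:K).
    by rewrite xy opprB addrA subrK.
  rewrite abs_sub_inv ?a0 //= -mulrA ler_wpM2l ?padic_abs_ge0 //.
  rewrite -[leRHS]mulr1; apply: ler_pM; rewrite ?padic_abs_ge0 //.
    exact/padic_abs_lt1/partial_quotient_near.
  exact/ltW/partial_quotient_near.
apply/eqP/negPn/negP => xy0; have {xy0} : 0 < |` x - y | by rewrite padic_abs_gt0 subr_eq0.
move=> d0; set n := Num.bound |` x - y |^-1.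
have : |` x - y | <= ell%:R ^- n.
  apply: le_trans (h n) _; rewrite ler_piMl ?invr_ge0 ?exprn_ge0 ?ler0n // ltW //.
  have -> : complete_quotient x n - complete_quotient y n =
    (complete_quotient x n - (partial_quotient x n)%:K) -
    (complete_quotient y n - (partial_quotient y n)%:K).
    by rewrite xy opprB addrA subrK.
  by rewrite padic_abs_ltD ?padic_absN ?partial_quotient_near.
apply/negP; rewrite -ltNge invf_plt ?posrE ?exprn_gt0 ?ltr0n ?prime_gt0 //.
apply: lt_trans (archi_boundP (_ : 0 <= _)) _; first by rewrite invr_ge0 ltW.
by rewrite -natrX ltr_nat ltn_expl // prime_gt1.
Qed.

(** Periodicity of the partial quotients is repetition of a complete quotient,
    because an irrational number is determined by its expansion. *)
Lemma periodic_fromE x N k : padic_irrational x ->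
  periodic_from x N k <-> complete_quotient x (N + k) = complete_quotient x N.
Proof.
move=> xi; split=> [h|h n Nn].
  apply: eq_expansion; try exact: irrational_complete.
  by move=> n; rewrite -!partial_quotientD addnAC h // leq_addr.
by rewrite -(subnKC Nn) addnAC !partial_quotientD h.
Qed.

End Expansion.

(** * The conjugate root and the integrality of the forms *)

Lemma in_ZinvM (ell : nat) (a b : rat) : in_Zinv ell a -> in_Zinv ell b -> in_Zinv ell (a * b).
Proof.
move=> [m am] [n bn]; exists (m + n)%N.
by rewrite exprD mulrACA rpredM.
Qed.

Lemma in_Zinv_intr ell (z : int) : in_Zinv ell z%:~R.
Proof. by exists 0%N; rewrite mulr1 intr_int. Qed.

Lemma in_ZinvD (ell : nat) (a b : rat) : in_Zinv ell a -> in_Zinv ell b -> in_Zinv ell (a + b).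
Proof.
move=> aZ bZ; rewrite -[b]opprK; apply: in_ZinvB => //.
by rewrite -sub0r; apply: in_ZinvB bZ; exact: (in_Zinv_intr ell 0).
Qed.

(** For an element of Z[1/ell], every other prime contributes a factor at most
    1 to the product formula. *)
Lemma product_formula ell (pr : prime ell) (q : rat) :
  in_Zinv ell q -> q != 0 -> 1 <= rat_abs ell q * `|q|.
Proof.
move=> [n /intrP[z zE]] q0; have l0 : 0 < ell%:R :> rat by rewrite ltr0n prime_gt0.
have ln0 : 0 < ell%:R ^+ n :> rat by rewrite exprn_gt0.
have z0 : z != 0 by rewrite -(intr_eq0 rat) -zE mulf_neq0 // gt_eqF.
have -> : q = z%:~R / ell%:R ^+ n by rewrite -zE mulfK ?gt_eqF.
rewrite rat_absM // rat_absV // rat_abs_ellX // invrK normrM normfV (gtr0_norm ln0).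
rewrite mulrACA divff ?gt_eqF // mulr1 rat_abs_int // ler_pdivlMl ?exprn_gt0 // mulr1.
rewrite -intr_norm -natrX -abszE -pmulrn ler_nat.
by rewrite dvdn_leq ?absz_gt0 // pfactor_dvdnn.
Qed.

(** The constants come from [1 + 2 t + t ^ 2 = (t + 1) ^ 2]. *)
Lemma height_step (F : realFieldType) (P Q R t L : F) : 0 <= t -> t <= L ->
  `|P * t ^+ 2 + Q * t + R| + `|P * t *+ 2 + Q| + `|P| <=
  (`|P| + `|Q| + `|R|) * (L + 1) ^+ 2.
Proof.
move=> t0 tL; have h1 : `|P * t ^+ 2 + Q * t + R| <= `|P| * t ^+ 2 + `|Q| * t + `|R|.
  apply: le_trans (ler_normD _ _) _; rewrite lerD2r; apply: le_trans (ler_normD _ _) _.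
  by rewrite !normrM (ger0_norm t0).
have h2 : `|P * t *+ 2 + Q| <= `|P| * t *+ 2 + `|Q|.
  by apply: le_trans (ler_normD _ _) _; rewrite normrMn normrM (ger0_norm t0).
have h3 : (t + 1) ^+ 2 <= (L + 1) ^+ 2 by rewrite lerXn2r ?nnegrE; lra.
have h4 : (`|P| + `|Q| + `|R|) * (t + 1) ^+ 2 <= (`|P| + `|Q| + `|R|) * (L + 1) ^+ 2.
  by rewrite ler_wpM2l // !addr_ge0.
apply: le_trans h4; have := normr_ge0 P; have := normr_ge0 Q; have := normr_ge0 R.
move: `|P * t ^+ 2 + Q * t + R| `|P * t *+ 2 + Q| `|P| `|Q| `|R| h1 h2 => U V p q r h1 h2.
by move=> r0 q0 p0; nra.
Qed.

Lemma roots_of_disc (F : fieldType) (A B C x y : F) :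
  B = - A * (x + y) -> C = A * x * y -> B ^+ 2 - 4 * A * C = (A * (x - y)) ^+ 2.
Proof. by move=> -> ->; ring. Qed.

Section Conjugate.
Variables (ell : nat) (pr : prime ell) (x y : padic pr) (A0 B0 C0 : int).
Local Notation "|` x |" := (padic_abs x) (at level 0, x at level 99).
Local Notation "q %:K" := (padic_of_rat pr q) (at level 2, format "q %:K").
Hypotheses (xi : padic_irrational x) (yi : padic_irrational y) (xy : x != y).
Hypotheses (A00 : A0 != 0)
  (r0 : roots_of (padic_of_rat pr) A0%:~R B0%:~R C0%:~R x y).

Local Notation a := (partial_quotient x).
Local Notation A := (quadA a A0%:~R B0%:~R C0%:~R).
Local Notation B := (quadB a A0%:~R B0%:~R C0%:~R).
Local Notation C := (quadC a A0%:~R B0%:~R C0%:~R).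
Local Notation X := (complete_quotient x).
Local Notation Y := (ruban_orbit a (padic_of_rat pr) y).
Local Notation D := (B0 ^+ 2 - 4 * A0 * C0).

Let l0 : 0 < ell%:R :> rat. Proof. by rewrite ltr0n prime_gt0. Qed.
Let l1 : 1 < ell%:R :> rat. Proof. by rewrite ltr1n prime_gt1. Qed.

Lemma roots_coefs n : roots_of (padic_of_rat pr) (A n) (B n) (C n) (X n) (Y n).
Proof.
rewrite complete_quotientE; apply: orbit_roots r0 n => m; exact: irrational_orbit.
Qed.

(** The discriminant is the square of the leading coefficient times the
    difference of the roots, at every step. *)
Lemma abs_disc n : rat_abs ell D%:~R = (|` (A n)%:K | * |` X n - Y n |) ^+ 2.
Proof.
rewrite -padic_absM -padic_absX -(padic_abs_rat pr); congr padic_abs.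
have -> : D%:~R = B n ^+ 2 - 4 * A n * C n.
  by rewrite disc_coefs !(intrD, intrN, intrM, rmorphXn).
have [rB rC] := roots_coefs n.
by rewrite !(rmorphB, rmorphM, rmorphXn, rmorph_nat) /=; exact: roots_of_disc.
Qed.

Lemma disc_neq0 : D != 0.
Proof.
have := abs_disc 0 => h; have : 0 < rat_abs ell D%:~R.
  rewrite h exprn_gt0 // mulr_gt0 // padic_abs_gt0 ?subr_eq0 //.
  by rewrite fmorph_eq0 intr_eq0.
by rewrite rat_abs_gt0 // intr_eq0.
Qed.

Lemma quadA_neq0 n : A n != 0.
Proof.
apply/eqP => An; have := abs_disc n; rewrite An rmorph0 padic_abs0 mul0r expr0n /=.
by apply/eqP; rewrite gt_eqF // rat_abs_gt0 // intr_eq0 disc_neq0.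
Qed.

Lemma abs_quadAS n : |` (A n)%:K | = |` (A n.+1)%:K | * |` X n.+1 | * |` Y n.+1 |.
Proof. by have [_] := roots_coefs n.+1; rewrite quadCS => ->; rewrite !padic_absM. Qed.

Lemma abs_disc_le1 : rat_abs ell D%:~R <= 1.
Proof. exact: rat_abs_int_le1. Qed.

(** If the conjugate lies outside the unit disc, [abs_quadAS] shows that the
    leading coefficient decreases; otherwise its size is controlled by the
    discriminant. *)
Lemma abs_quadA_le1 n : |` (A n)%:K | <= 1.
Proof.
elim: n => [|n IHn]; first by rewrite padic_abs_rat rat_abs_int_le1.
have X1 := complete_quotient_gt1 n xi.
have [Y1|Y1] := leP |` Y n.+1 | 1; last first.
  apply: le_trans IHn; rewrite (abs_quadAS n) -mulrA ler_peMr ?padic_abs_ge0 //.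
  by rewrite mulr_ege1 ?ltW.
have XY : |` X n.+1 - Y n.+1 | = |` X n.+1 |.
  by rewrite padic_abs_dominant // padic_absN (le_lt_trans Y1).
have := abs_disc_le1; rewrite (abs_disc n.+1) XY expr_le1 ?mulr_ge0 ?padic_abs_ge0 //.
by apply: le_trans; rewrite ler_peMr ?padic_abs_ge0 // ltW.
Qed.

Lemma abs_quadA_mul_le1 n : |` (A n.+1)%:K | * |` X n.+1 | <= 1.
Proof.
have X1 := complete_quotient_gt1 n xi.
have [Y1|Y1] := leP |` Y n.+1 | 1; last first.
  apply: le_trans (abs_quadA_le1 n); rewrite (abs_quadAS n) ler_peMr ?ltW //.
  apply: mulr_gt0 (lt_trans ltr01 X1).
  by rewrite padic_abs_gt0 fmorph_eq0 quadA_neq0.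
have XY : |` X n.+1 - Y n.+1 | = |` X n.+1 |.
  by rewrite padic_abs_dominant // padic_absN (le_lt_trans Y1).
have := abs_disc_le1; rewrite (abs_disc n.+1) XY expr_le1 ?mulr_ge0 ?padic_abs_ge0 //.
Qed.

Lemma quad_coefs_Zinv n : [/\ in_Zinv ell (A n), in_Zinv ell (B n) & in_Zinv ell (C n)].
Proof.
elim: n => [|n [AZ BZ CZ]]; first by split; exact: in_Zinv_intr.
have aZ : in_Zinv ell (a n) by exact: partial_quotient_Zinv.
rewrite quadAS quadBS quadCS expr2; split=> //.
  by do !apply: in_ZinvD => //; do ?apply: in_ZinvM.
by apply: in_ZinvD => //; apply: in_ZinvD; apply: in_ZinvM.
Qed.

Lemma height_coefs n : `|A n| + `|B n| + `|C n| <=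
  (`|A0|%N + `|B0|%N + `|C0|%N)%:R * (ell%:R + 1) ^+ (2 * n).
Proof.
elim: n => [|n IHn].
  by rewrite muln0 expr0 mulr1 !natrD !pmulrn !abszE !intr_norm.
rewrite mulnSr exprD mulrA.
apply: le_trans (ler_wpM2r _ IHn); last by rewrite exprn_ge0 // addr_ge0 // ltW.
have /andP[a0 al] := partial_quotient_itv x n.
by rewrite quadAS quadBS quadCS; exact: height_step (ltW al).
Qed.

(** A conjugate in the closed unit disc cannot share the floor of the complete
    quotient, which has absolute value larger than 1. *)
Lemma abs_conj_lt1S m : |` Y m.+1 | <= 1 -> |` Y m.+2 | < 1.
Proof.
move=> Ym; have X1 := complete_quotient_gt1 m xi.
rewrite [Y _]/= padic_absV -[ltLHS]div1r ltr_pdivrMr; last first.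
  rewrite padic_abs_gt0 subr_eq0; exact (irrational_orbit a m.+1 yi (a m.+1)).
rewrite mul1r padic_abs_dist padic_abs_dominant abs_partial_quotient //.
by rewrite padic_absN (le_lt_trans Ym).
Qed.

(** As long as both roots are outside the unit disc, the leading coefficient
    shrinks by [ell] at each step, and if they also have the same floor, then the
    discriminant is at least as small. This contradicts the product formula, since
    the real size of the discriminant is at most [e]. *)
Lemma abs_conj_lt1 (e : nat) : `|D%:~R| <= e%:R :> rat ->
  forall n, (e.+2 <= n)%N -> |` Y n | < 1.
Proof.
move=> De; suff [m] : exists m, |` Y m.+1 | <= 1 /\ (m <= e)%N.
  case=> Ym me n en; have {en} en : (m.+2 <= n)%N by apply: leq_trans en.
  rewrite -(subnKC en); elim: (n - m.+2)%N => [|k IHk].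
    by rewrite addn0; exact: abs_conj_lt1S.
  by rewrite addnS; apply: abs_conj_lt1S; exact: ltW.
have [//|h] := pselect (exists m, |` Y m.+1 | <= 1 /\ (m <= e)%N); exfalso.
have Y1 m : (m <= e)%N -> 1 < |` Y m.+1 |.
  by move=> me; rewrite ltNge; apply/negP => Ym; apply: h; exists m.
have Am m : (m <= e)%N -> |` (A m)%:K | <= ell%:R ^- m.
  elim: m => [|m IHm] me; first by rewrite invr1 abs_quadA_le1.
  have := IHm (ltnW me); rewrite (abs_quadAS m) exprSr invfM => Am.
  rewrite -ler_pdivrMr ?invr_gt0 // invrK; apply: le_trans Am.
  rewrite -mulrA ler_wpM2l ?padic_abs_ge0 //.
  apply: le_trans (padic_abs_gt1 (complete_quotient_gt1 m xi)) _.
  by rewrite ler_peMr ?padic_abs_ge0 // ltW // Y1 // ltnW.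
have XY : |` X e - Y e | < 1.
  have -> : X e - Y e = (X e - (a e)%:K) - (Y e - (a e)%:K) by rewrite opprB addrA subrK.
  apply: padic_abs_ltD; first exact: partial_quotient_near.
  rewrite padic_absN -[Y e - _]invrK padic_absV invf_lt1; first exact: Y1.
  exact: lt_trans (Y1 e (leqnn e)).
have Dl : rat_abs ell D%:~R <= ell%:R ^- e.
  rewrite (abs_disc e) expr2; apply: le_trans (Am e (leqnn e)).
  apply: le_trans (_ : |` (A e)%:K | * |` X e - Y e | <= _).
    rewrite ler_piMl ?mulr_ge0 ?padic_abs_ge0 // mulr_ile1 ?padic_abs_ge0 ?abs_quadA_le1 ?ltW //.
  by rewrite ler_piMr ?padic_abs_ge0 // ltW.
have := product_formula pr (in_Zinv_intr ell D); rewrite intr_eq0 disc_neq0 => /(_ isT).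
apply/negP; rewrite -ltNge; apply: le_lt_trans (ler_pM _ _ Dl De) _ => //.
  exact: rat_abs_ge0.
by rewrite mulrC ltr_pdivrMr ?exprn_gt0 // mul1r -natrX ltr_nat ltn_expl // prime_gt1.
Qed.

(** With one root outside and one inside the unit disc, [B] has the absolute value
    of [A x], which the discriminant bounds, and [C] is the preceding leading
    coefficient. *)
Lemma quad_coefs_int n : |` Y n.+1 | < 1 ->
  [/\ A n.+1 \is a Num.int, B n.+1 \is a Num.int & C n.+1 \is a Num.int].
Proof.
move=> Yn; have [AZ BZ CZ] := quad_coefs_Zinv n.+1; have X1 := complete_quotient_gt1 n xi.
split; apply: (in_Zinv_int pr) => //; rewrite -(padic_abs_rat pr).
- exact: abs_quadA_le1.
- have [-> _] := roots_coefs n.+1; rewrite padic_absM padic_absN padic_abs_dominant.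
    exact: abs_quadA_mul_le1.
  exact: lt_trans X1.
- by rewrite quadCS abs_quadA_le1.
Qed.

End Conjugate.

(** * Real embeddings of a quadratic field *)

Lemma lin_div (F : fieldType) (z u v n : F) : u / n + v / n * z = (u + v * z) / n.
Proof. by rewrite mulrDl mulrAC. Qed.

Section Quadratic.
Variables (F : fieldType) (phi : {rmorphism rat -> F}) (a b c : rat) (z : F).
Hypotheses (a0 : a != 0) (rz : root_of phi a b c z).

Let c_eq : phi c = - (phi a * z ^+ 2 + phi b * z).
Proof. by rewrite -[LHS]addr0 -oppr0 -rz; ring. Qed.

Let phi_a0 : phi a != 0. Proof. by rewrite fmorph_eq0. Qed.

Lemma lin_mul u v u' v' :
  (phi u + phi v * z) * (phi u' + phi v' * z) =
  phi (u * u' - v * v' * c / a) + phi (u * v' + v * u' - v * v' * b / a) * z.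
Proof.
rewrite !(rmorphD, rmorphN, rmorphM, fmorphV) /= c_eq; field.
exact: phi_a0.
Qed.

Lemma lin_norm u v :
  (phi u + phi v * z) * (phi (u - v * b / a) + phi (- v) * z) =
  phi (u ^+ 2 - u * v * b / a + v ^+ 2 * c / a).
Proof.
rewrite !(rmorphD, rmorphN, rmorphM, fmorphV, rmorphXn) /= c_eq; field.
exact: phi_a0.
Qed.

End Quadratic.

Section Embeddings.
Variables (ell : nat) (pr : prime ell) (x : padic pr) (A0 B0 C0 : rat).
Local Notation "q %:K" := (padic_of_rat pr q) (at level 2, format "q %:K").
Hypotheses (xi : padic_irrational x) (A00 : A0 != 0).
Hypothesis r0 : root_of (padic_of_rat pr) A0 B0 C0 x.

Lemma padic_of_rat_eq0 q : (q%:K == 0) = (q == 0).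
Proof. exact: fmorph_eq0. Qed.

Lemma irrational_lin u v : u%:K + v%:K * x = 0 -> u = 0 /\ v = 0.
Proof.
move=> uv; have v0 : v = 0.
  apply/eqP/negPn/negP => v0; have /eqP := xi (- u / v); apply.
  have vK0 : v%:K != 0 by rewrite padic_of_rat_eq0.
  apply: (mulfI vK0); rewrite -rmorphM [v * _]mulrC divfK // rmorphN.
  by apply/eqP; rewrite -addr_eq0 addrC uv.
split=> //; move: uv; rewrite v0 rmorph0 mul0r addr0 => /eqP.
by rewrite padic_of_rat_eq0 => /eqP.
Qed.

Lemma irrational_lin_inj u v u' v' :
  u%:K + v%:K * x = u'%:K + v'%:K * x -> u = u' /\ v = v'.
Proof.
move=> e; have [|/eqP + /eqP] := @irrational_lin (u - u') (v - v').
  by rewrite !rmorphB mulrBl addrACA -opprD e subrr.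
by rewrite !subr_eq0 => /eqP -> /eqP ->.
Qed.

Definition lin_pred : {pred padic pr} :=
  fun z => `[< exists u v : rat, z = u%:K + v%:K * x >].

(** The inverse of [u + v x] is its conjugate divided by its norm. *)
Lemma lin_closed : divring_closed lin_pred.
Proof.
split=> [|_ _ /asboolP[u [v ->]] /asboolP[u' [v' ->]]|].
- by apply/asboolP; exists 1, 0; rewrite rmorph0 rmorph1 mul0r addr0.
- by apply/asboolP; exists (u - u'), (v - v'); rewrite !rmorphB mulrBl addrACA -opprD.
move=> z _ /asboolP[u [v ->]] /asboolP[u' [v' ->]]; apply/asboolP.
have [e0|ne0] := eqVneq (u'%:K + v'%:K * x) 0.
  by exists 0, 0; rewrite e0 invr0 mulr0 rmorph0 mul0r addr0.
set n : rat := u' ^+ 2 - u' * v' * B0 / A0 + v' ^+ 2 * C0 / A0.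
have nE : (u'%:K + v'%:K * x) * ((u' - v' * B0 / A0)%:K + (- v')%:K * x) = n%:K.
  exact: (lin_norm A00 r0).
have n0 : n%:K != 0.
  rewrite -nE mulf_neq0 //; apply/eqP => /irrational_lin[h1 h2].
  move/eqP: ne0; apply; have v'0 : v' = 0 by rewrite -[v']opprK h2 oppr0.
  by move: h1; rewrite v'0 !mul0r subr0 => ->; rewrite !rmorph0 mul0r addr0.
have -> : (u'%:K + v'%:K * x)^-1 = ((u' - v' * B0 / A0) / n)%:K + ((- v') / n)%:K * x.
  apply: (mulfI ne0); rewrite mulfV // !rmorphM !fmorphV.
  by rewrite lin_div mulrA nE mulfV.
by rewrite (lin_mul A00 r0); eexists; eexists.
Qed.

(** Q(x) is contained in every subfield containing [x], in particular in
    Q + Q x. *)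
Lemma Qadj_lin (z : Qadj x) : exists u v : rat, Qadj_val z = u%:K + v%:K * x.
Proof.
have /asboolP/(_ lin_pred lin_closed) h := Qadj_valP z.
apply/asboolP/h/asboolP; exists 0, 1.
by rewrite rmorph0 rmorph1 add0r mul1r.
Qed.

Variable R : realType.
Local Notation ratrR := (@ratr R).

Local Notation gen := (complete_quotientQ x 0).

(** Named with its morphism structure, so that the morphism lemmas apply without
    unfolding the subfield. *)
Definition Qadj_emb : {rmorphism Qadj x -> padic pr} := \val.

Lemma Qadj_embE z : Qadj_emb z = Qadj_val z.
Proof. reflexivity. Qed.

Lemma Qadj_emb_inj : injective Qadj_emb.
Proof. exact: val_inj. Qed.

Lemma Qadj_emb_ratr q : Qadj_emb (ratr q) = q%:K.
Proof. by rewrite fmorph_rat. Qed.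

Lemma Qadj_lin_gen (z : Qadj x) : exists u v : rat, z = ratr u + ratr v * gen.
Proof.
have [u [v zE]] := Qadj_lin z; exists u, v; apply: Qadj_emb_inj.
by rewrite rmorphD (rmorphM Qadj_emb (ratr v)) !Qadj_emb_ratr Qadj_embE.
Qed.

Lemma eq_embedding (j j' : {rmorphism Qadj x -> R}) : j gen = j' gen -> j =1 j'.
Proof.
move=> jj' z; have [u [v ->]] := Qadj_lin_gen z.
by rewrite !rmorphD !(rmorphM _ (ratr v)) /= jj' !fmorph_rat.
Qed.

(** The coordinates on the basis 1, [x] are unique, so sending [x] to another
    root of the same form is well defined and multiplicative. *)
Lemma embedding_exists (rho : R) : root_of ratrR A0 B0 C0 rho ->
  exists j : {rmorphism Qadj x -> R}, j gen = rho.
Proof.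
move=> rr.
have c (z : Qadj x) : {uv : rat * rat | Qadj_val z = uv.1%:K + uv.2%:K * x}.
  by apply: cid; have [u [v zE]] := Qadj_lin z; exists (u, v).
pose f z : R := ratr (sval (c z)).1 + ratr (sval (c z)).2 * rho.
have fE z u v : Qadj_val z = u%:K + v%:K * x -> f z = ratr u + ratr v * rho.
  rewrite /f; case: (c z) => -[u' v'] /= -> /irrational_lin_inj[]// -> -> //.
have fB : zmod_morphism f.
  move=> z t; have [u [v zE]] := Qadj_lin z; have [u' [v' tE]] := Qadj_lin t.
  rewrite (fE _ _ _ zE) (fE _ _ _ tE) (fE _ (u - u') (v - v')).
    by rewrite !rmorphB mulrBl addrACA -opprD.
  by rewrite -Qadj_embE rmorphB !Qadj_embE zE tE !rmorphB mulrBl addrACA -opprD.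
have fM : monoid_morphism f.
  split=> [|z t]; first by rewrite (fE _ 1 0) -?Qadj_embE ?rmorph1 ?rmorph0 ?mul0r ?addr0.
  have [u [v zE]] := Qadj_lin z; have [u' [v' tE]] := Qadj_lin t.
  have ztE : Qadj_val (z * t) = Qadj_val z * Qadj_val t by rewrite -!Qadj_embE rmorphM.
  rewrite zE tE (lin_mul A00 r0) in ztE.
  rewrite (fE _ _ _ zE) (fE _ _ _ tE) (fE _ _ _ ztE).
  exact/esym/(lin_mul A00 rr).
pose fBm := GRing.isZmodMorphism.Build _ _ f fB.
pose fMm := GRing.isMonoidMorphism.Build _ _ f fM.
pose j : {rmorphism Qadj x -> R} := HB.pack f fBm fMm.
exists j; rewrite -[LHS]/(f gen) (fE _ 0 1).
  by rewrite rmorph0 rmorph1 add0r mul1r.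
by rewrite rmorph0 rmorph1 add0r mul1r.
Qed.

Lemma embedding_orbit (j : {rmorphism Qadj x -> R}) n :
  j (complete_quotientQ x n) = ruban_orbit (partial_quotient x) ratrR (j gen) n.
Proof.
elim: n => // n IHn.
have -> : complete_quotientQ x n.+1 =
    (complete_quotientQ x n - ratr (partial_quotient x n))^-1.
  by apply: Qadj_emb_inj; rewrite fmorphV rmorphB Qadj_emb_ratr !Qadj_embE.
by rewrite fmorphV rmorphB /= fmorph_rat IHn.
Qed.

Lemma embedding_irrational (j : {rmorphism Qadj x -> R}) n q :
  j (complete_quotientQ x n) != ratr q.
Proof.
rewrite -(fmorph_rat j); apply/eqP => /fmorph_inj/(congr1 Qadj_emb).
rewrite Qadj_emb_ratr Qadj_embE; apply/eqP; exact: (irrational_complete n xi q).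
Qed.

Lemma embedding_root (j : {rmorphism Qadj x -> R}) : root_of ratrR A0 B0 C0 (j gen).
Proof.
have g0 : ratr A0 * gen ^+ 2 + ratr B0 * gen + ratr C0 = 0.
  apply: Qadj_emb_inj.
  by rewrite !rmorphD !(rmorphM _ (ratr _)) rmorphXn !Qadj_emb_ratr rmorph0 Qadj_embE.
have := congr1 j g0; rewrite !rmorphD !(rmorphM _ (ratr _)) rmorphXn rmorph0 /= !fmorph_rat.
exact.
Qed.

End Embeddings.

(** * Signs of the coefficients of the forms *)

(** When [A C > 0] the two roots have the same sign, so the sum [- B / A] of the
    roots is positive. *)
Lemma positive_root_sign (R : realType) (A B C : rat) (rho : R) :
  root_of (@ratr R) A B C rho -> 0 < rho -> 0 < A * C -> A * B < 0.
Proof.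
rewrite /root_of /= => rr rho0 AC; rewrite -(ltrq0 R) rmorphM /=.
have {}AC : 0 < ratr A * ratr C :> R by rewrite -rmorphM /= ltr0q.
move: (ratr A) (ratr B) (ratr C) rr AC => a b c rr ac.
rewrite -(pmulr_llt0 _ rho0).
have -> : a * b * rho = - (a ^+ 2 * rho ^+ 2 + a * c).
  rewrite -[RHS]addr0 -[X in _ + X](mulr0 a) -rr; ring.
by rewrite oppr_lt0 ltr_wpDl // mulr_ge0 ?sqr_ge0.
Qed.

Lemma same_sign_trans (F : realFieldType) (a b c : F) : 0 < a * b -> 0 < b * c -> 0 < a * c.
Proof.
move=> ab bc; have := mulr_gt0 ab bc; have -> : a * b * (b * c) = b ^+ 2 * (a * c) by ring.
by rewrite pmulr_rgt0 // exprn_even_gt0 //=; apply: contraTneq ab => ->; rewrite mulr0 ltxx.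
Qed.

(** If [A C < 0] and [t > 0] lies beyond the positive root, then the derivative
    at [t] has the sign of [A]. *)
Lemma escape (F : realFieldType) (A B C t : F) : A * C < 0 -> 0 < t ->
  0 < (A * t ^+ 2 + B * t + C) * A ->
  0 < (A * t ^+ 2 + B * t + C) * (A * t *+ 2 + B).
Proof.
move=> AC t0 A'A.
have h : 0 < A * (A * t *+ 2 + B).
  rewrite -(pmulr_lgt0 _ t0).
  have -> : A * (A * t *+ 2 + B) * t = (A * t ^+ 2 + B * t + C) * A - A * C + A ^+ 2 * t ^+ 2 by ring.
  by apply: ltr_wpDr; [rewrite mulr_ge0 ?sqr_ge0|rewrite subr_gt0 (lt_trans AC)].
exact: same_sign_trans A'A h.
Qed.

(** [B] moves towards 0 by [2 A t] and does not cross it. *)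
Lemma descent (F : realFieldType) (A B t A' : F) : A * B < 0 -> 0 < t ->
  0 < A * A' -> A' * (A * t *+ 2 + B) < 0 -> `|A * t *+ 2 + B| < `|B|.
Proof.
have [A0|A0|->] := ltgtP A 0; last by rewrite mul0r ltxx.
  rewrite nmulr_rlt0 // => B0 t0; rewrite nmulr_rgt0 // => A'0.
  rewrite nmulr_rlt0 // => B'0; rewrite !gtr0_norm //.
  by have At : A * t < 0; [rewrite nmulr_rlt0|lra].
rewrite pmulr_rlt0 // => B0 t0; rewrite pmulr_rgt0 // => A'0.
rewrite pmulr_rlt0 // => B'0; rewrite !ltr0_norm // ltrN2.
by have := mulr_gt0 A0 t0; lra.
Qed.

Section Signs.
Variables (a : nat -> rat) (A0 B0 C0 : rat).
Hypothesis a0 : forall n, 0 < a n.+1.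
Local Notation A := (quadA a A0 B0 C0).
Local Notation B := (quadB a A0 B0 C0).
Local Notation C := (quadC a A0 B0 C0).
Hypothesis An0 : forall n, A n != 0.

(** The increments of [B] are [2 A a], so they all have the sign of [A]. *)
Lemma mid_monotone m k : (forall n, (m <= n)%N -> 0 < A n * A n.+1) ->
  (0 < m)%N -> 0 < A m * A (m + k)%N /\ ((0 < k)%N -> 0 < A m * (B (m + k)%N - B m)).
Proof.
move=> h m0; elim: k => [|k [IH1 IH2]].
  by rewrite addn0 -expr2 exprn_even_gt0 //=.
have Ak := h (m + k)%N (leq_addr _ _).
rewrite addnS; split; first exact: same_sign_trans Ak.
move=> _; rewrite quadBS.
have amk : 0 < a (m + k)%N by case: (m) m0 => // m' _; rewrite addSn.
have -> : A m * (A (m + k) * a (m + k)%N *+ 2 + B (m + k) - B m) =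
  A m * A (m + k) * a (m + k)%N *+ 2 + A m * (B (m + k) - B m) by ring.
have := mulr_gt0 IH1 amk; case: (k) IH2 => [_|k' IH2]; last by have := IH2 isT; lra.
by rewrite addn0 subrr mulr0; lra.
Qed.

(** Without a sign change of [A] the middle coefficient is strictly monotone and
    never takes the same value twice. *)
Lemma sign_change m k : (0 < m)%N -> (0 < k)%N ->
  `|A (m + k)| = `|A m| -> (A (m + k) = A m -> B (m + k) = B m) ->
  exists2 n, (m <= n)%N & A n * A n.+1 < 0.
Proof.
move=> m0 k0 Aeq Beq.
have [//|no] := pselect (exists2 n, (m <= n)%N & A n * A n.+1 < 0); exfalso.
have h n : (m <= n)%N -> 0 < A n * A n.+1.
  move=> mn; rewrite lt_neqAle eq_sym mulf_neq0 //= leNgt; apply/negP => lt0.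
  by apply: no; exists n.
have [Ap /(_ k0)] := mid_monotone k h m0.
suff AA : A (m + k) = A m by rewrite Beq // subrr mulr0 ltxx.
have /eqP := Aeq; rewrite eqr_norm2 => /orP[/eqP //|/eqP AN].
by move: Ap; rewrite AN mulrN oppr_gt0 -expr2 ltNge sqr_ge0.
Qed.

Section PositiveRoots.
Variables (n0 h N : nat).
Hypotheses (n00 : (0 < n0)%N) (hN : (n0 + h < N)%N).
Hypothesis neg : forall n, (n <= N)%N -> 0 < A n * C n -> A n * B n < 0.
Hypothesis Bint : forall n, (n0 <= n)%N -> B n \is a Num.int.
Hypothesis Bh : `|B n0| <= h%:R.

(** Otherwise [descent] would apply [h.+1] times to an integer of absolute value
    at most [h]. *)
Lemma sign_change_early : exists2 n, (n0 <= n <= n0 + h.+1)%N & A n * C n < 0.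
Proof.
have [//|no] := pselect (exists2 n, (n0 <= n <= n0 + h.+1)%N & A n * C n < 0); exfalso.
have pos n : (n0 <= n.+1 <= n0 + h.+1)%N -> 0 < A n.+1 * C n.+1.
  move=> nn; have nz : A n.+1 * C n.+1 != 0 by rewrite quadCS mulf_neq0.
  rewrite lt_neqAle eq_sym nz leNgt.
  by apply/negP => lt0; apply: no; exists n.+1.
have step i : (i <= h.+1)%N -> `|B (n0 + i)%N| + i%:R <= h%:R.
  elim: i => [|i IHi] ih; first by rewrite addn0 addr0.
  apply: le_trans (IHi (ltnW ih)); rewrite addnS -natr1 addrA addrAC lerD2r.
  have ni0 : (0 < n0 + i)%N by rewrite addn_gt0 n00.
  have p1 : 0 < A (n0 + i).+1%N * C (n0 + i).+1%N.
    by apply: pos; rewrite -addnS leq_addr leq_add2l.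
  have p0 : 0 < A (n0 + i)%N * C (n0 + i)%N.
    by rewrite -(prednK ni0); apply: pos; rewrite prednK // leq_addr leq_add2l ltnW.
  have q0 := neg (_ : n0 + i <= N)%N p0; have q1 := neg (_ : (n0 + i).+1 <= N)%N p1.
  have {q0} q0 : A (n0 + i)%N * B (n0 + i)%N < 0 by apply: q0; lia.
  have {q1} q1 : A (n0 + i).+1%N * B (n0 + i).+1%N < 0 by apply: q1; lia.
  have ai : 0 < a (n0 + i)%N by rewrite -(prednK ni0).
  rewrite quadCS in p1; rewrite [A (n0 + i)%N * C _]mulrC in p0.
  rewrite quadBS in q1; rewrite mulrC in p1.
  have := descent q0 ai p1 q1; rewrite -quadBS.
  have /intrP[z zE] := Bint (leq_addr i n0).
  have /intrP[t tE] : B (n0 + i).+1%N \is a Num.int by apply: Bint; lia.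
  by rewrite zE tE -!intr_norm ltr_int -[1]/(1%:~R) -intrD ler_int lezD1.
have := step h.+1 (leqnn _); rewrite -natr1.
by have := normr_ge0 (B (n0 + h.+1)%N); lra.
Qed.

Lemma sign_change_persists n : (0 < n)%N -> (n < N)%N -> A n * C n < 0 ->
  A n.+1 * C n.+1 < 0.
Proof.
move=> np nN AC; rewrite ltNge le_eqVlt negb_or eq_sym quadCS mulf_neq0 //=.
apply/negP => A'A; have := neg nN; rewrite quadCS => /(_ A'A).
apply/negP; rewrite -leNgt ltW // quadAS quadBS; apply: escape => //.
  by rewrite -(prednK np).
by rewrite -quadAS.
Qed.

Lemma sign_change_after n : (n0 + h.+1 <= n <= N)%N -> A n * C n < 0.
Proof.
have [m /andP[m0 mh] ACm] := sign_change_early; move=> /andP[hn nN].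
have mn : (m <= n)%N by apply: leq_trans hn.
rewrite -(subnKC mn) in nN *; elim: (n - m)%N nN => [|i IHi]; first by rewrite addn0.
rewrite addnS => iN; apply: sign_change_persists => //; last exact/IHi/ltnW.
by rewrite (leq_trans n00) // (leq_trans m0) // leq_addr.
Qed.

End PositiveRoots.
End Signs.

(** With [A C < 0] the discriminant is a sum of nonnegative integers. *)
Lemma int_box (E : nat) (A B C D : rat) : A \is a Num.int -> B \is a Num.int ->
  C \is a Num.int -> A * C < 0 -> B ^+ 2 - 4 * A * C = D -> D <= E%:R ->
  `|A| <= E%:R /\ `|B| <= E%:R.
Proof.
move=> /intrP[x ->] /intrP[y ->] /intrP[z ->] + <-.
rewrite -[4]/(4%:~R) -[E%:R]/(E%:Z%:~R) -rmorphXn /= -!intrM -intrB ler_int -!intr_norm.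
rewrite !ler_int -[0]/(0%:~R) ltr_int => xz yxz.
have xz' : `|x| * `|z| = - (x * z) by rewrite -normrM ltr0_norm.
have z0 : `|z| >= 1 by rewrite -gtz0_ge1 normr_gt0; apply: contraTneq xz => ->; rewrite mulr0 ltxx.
have x1 : `|x| <= `|x| * `|z| by rewrite ler_peMr.
have y1 : `|y| <= y ^+ 2.
  have [->|y0] := eqVneq y 0; first by rewrite normr0.
  by rewrite -[y ^+ 2]ger0_norm ?sqr_ge0 // normrX expr2 ler_peMr // -gtz0_ge1 normr_gt0.
have y2 := sqr_ge0 y; rewrite -mulrA in yxz; move: (x * z) (y ^+ 2) xz xz' x1 y1 y2 yxz => p q.
by split; lia.
Qed.

(** Pigeonhole: each entry takes at most [2 E + 1] values. *)
Lemma repeated_pair (E M : nat) (u v : nat -> rat) :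
  (forall n, (M <= n <= M + (2 * E + 1) ^ 2)%N ->
    [/\ u n \is a Num.int, v n \is a Num.int, `|u n| <= E%:R & `|v n| <= E%:R]) ->
  exists n1 n2, [/\ (M <= n1)%N, (n1 < n2 <= M + (2 * E + 1) ^ 2)%N, u n1 = u n2 & v n1 = v n2].
Proof.
move=> box.
(* an integer of absolute value at most [E], shifted to [0, 2 E] *)
pose code (q : rat) : 'I_(2 * E).+1 := inord (absz (Num.floor q + E%:Z)).
have code_inj p q : p \is a Num.int -> q \is a Num.int -> `|p| <= E%:R -> `|q| <= E%:R ->
    code p = code q -> p = q.
  move=> /intrP[x ->] /intrP[y ->]; rewrite -!intr_norm -[E%:R]/(E%:Z%:~R) !ler_int.
  rewrite /code !intrKfloor => xE yE /(congr1 val) /=; rewrite !inordK; try lia.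
  by move=> e; congr (_%:~R); lia.
pose f (i : 'I_((2 * E + 1) ^ 2).+1) := (code (u (M + i)%N), code (v (M + i)%N)).
have /injectivePn[i [j ij fij]] : ~~ injectiveb f.
  apply/negP => /injectiveP/leq_card; rewrite card_prod !card_ord; lia.
have bnd (k : 'I_((2 * E + 1) ^ 2).+1) : (M <= M + k <= M + (2 * E + 1) ^ 2)%N.
  by rewrite leq_addr leq_add2l -ltnS ltn_ord.
have [ui vi uiE viE] := box _ (bnd i); have [uj vj ujE vjE] := box _ (bnd j).
case: fij => /code_inj - /(_ ui uj uiE ujE) eu /code_inj - /(_ vi vj viE vjE) ev.
have [lt|gt|/val_inj e] := ltngtP i j; last by rewrite e eqxx in ij.
- exists (M + i)%N, (M + j)%N; split=> //; first by rewrite leq_addr.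
  by rewrite ltn_add2l lt; have /andP[] := bnd j.
- exists (M + j)%N, (M + i)%N; split=> //; first by rewrite leq_addr.
  by rewrite ltn_add2l gt; have /andP[] := bnd i.
Qed.

(** * Repetitions and embeddings of the complete quotients *)

Lemma cross_root (F : fieldType) (phi : {rmorphism rat -> F}) (A B C A' B' C' : rat) z :
  root_of phi A B C z -> root_of phi A' B' C' z ->
  phi (A * C' - A' * C) + phi (A * B' - A' * B) * z = 0.
Proof.
rewrite /root_of => r r'; rewrite !rmorphB !rmorphM.
transitivity (phi A * (phi A' * z ^+ 2 + phi B' * z + phi C')
              - phi A' * (phi A * z ^+ 2 + phi B * z + phi C)); first by ring.
by rewrite r r' !mulr0 subrr.
Qed.

Lemma vieta (F : fieldType) (a b c x y : F) : a != 0 -> a * x ^+ 2 + b * x + c = 0 ->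
  y = - b / a - x -> b = - a * (x + y) /\ c = a * x * y.
Proof.
move=> a0 r ->; split; first by field.
have -> : c = - (a * x ^+ 2 + b * x) by rewrite -[LHS]addr0 -oppr0 -r; ring.
by field.
Qed.

Section Proportional.
Variables (ell : nat) (pr : prime ell) (x : padic pr).
Local Notation phi := (padic_of_rat pr).
Hypothesis xi : padic_irrational x.

Lemma proportional A B C A' B' C' : root_of phi A B C x -> root_of phi A' B' C' x ->
  A * B' = A' * B /\ A * C' = A' * C.
Proof.
move=> r r'; have [/eqP + /eqP] := irrational_lin xi (cross_root r r').
by rewrite !subr_eq0 => /eqP -> /eqP ->.
Qed.

(** Two forms with a common irrational root are proportional; equal
    discriminants leave only the factors 1 and -1. *)
Lemma same_disc A B C A' B' C' : A != 0 -> A' != 0 ->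
  root_of phi A B C x -> root_of phi A' B' C' x ->
  B ^+ 2 - 4 * A * C = B' ^+ 2 - 4 * A' * C' -> B ^+ 2 - 4 * A * C != 0 ->
  `|A'| = `|A| /\ (A' = A -> B' = B).
Proof.
move=> A0 A'0 r r' DD D0; have [AB AC] := proportional r r'; split; last first.
  by move=> AA; rewrite AA in AB; exact: mulfI AB.
have e : A ^+ 2 * (B' ^+ 2 - 4 * A' * C') = A' ^+ 2 * (B ^+ 2 - 4 * A * C).
  transitivity ((A * B') ^+ 2 - 4 * A * A' * (A * C')); first by ring.
  by rewrite AB AC; ring.
rewrite -DD in e; have /eqP := mulIf D0 e; rewrite eqf_sqr => /orP[]/eqP -> //.
by rewrite normrN.
Qed.

Lemma conjugate_exists A B C : A != 0 -> root_of phi A B C x ->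
  B ^+ 2 - 4 * A * C != 0 ->
  exists y, [/\ padic_irrational y, x != y, roots_of phi A B C x y & y = - phi B / phi A - x].
Proof.
move=> A0 r D0; have phiA0 : phi A != 0 by rewrite padic_of_rat_eq0.
exists (- phi B / phi A - x); set y := _ - x.
have [rB rC] := vieta phiA0 r (erefl y).
split=> //.
- move=> q; apply/eqP => yq; have /eqP := xi (- B / A - q); apply.
  by rewrite !(rmorphB, rmorphM, fmorphV, rmorphN) /= -yq /y opprB addrC subrK.
- apply/eqP => xy; move: D0; rewrite -(padic_of_rat_eq0 pr) => /eqP; apply.
  rewrite !(rmorphB, rmorphM, rmorphXn, rmorph_nat) /=.
  by rewrite (roots_of_disc rB rC) -xy subrr mulr0 expr0n.
Qed.

End Proportional.

Lemma disc_delta (F : fieldType) (phi : {rmorphism rat -> F}) (A B C : rat) z :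
  root_of phi A B C z -> phi (B ^+ 2 - 4 * A * C) = (phi A * z *+ 2 + phi B) ^+ 2.
Proof.
rewrite /root_of => r; rewrite !(rmorphB, rmorphM, rmorphXn, rmorph_nat) /=.
have -> : phi C = - (phi A * z ^+ 2 + phi B * z) by rewrite -[LHS]addr0 -oppr0 -r; ring.
by ring.
Qed.

(** If the discriminant vanished, the root would be [- B / (2 A)]. *)
Lemma irrational_disc (ell : nat) (pr : prime ell) (x : padic pr) A B C :
  padic_irrational x -> A != 0 -> root_of (padic_of_rat pr) A B C x ->
  B ^+ 2 - 4 * A * C != 0.
Proof.
move=> xi A0 r; apply/eqP => D0; have := disc_delta r; rewrite D0 rmorph0.
move=> /esym/eqP; rewrite expf_eq0 /= => /eqP h.
have [|_ /eqP] := @irrational_lin _ _ _ xi B (A *+ 2).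
  by rewrite rmorphMn mulrnAl addrC.
by rewrite mulrn_eq0 (negPf A0).
Qed.

(** If both roots of the form were positive, then [A C = A ^ 2 z t] would be too. *)
Lemma unique_positive_root (F : realFieldType) (a b c z t : F) :
  a * c < 0 -> a * z ^+ 2 + b * z + c = 0 -> a * t ^+ 2 + b * t + c = 0 ->
  0 < z -> 0 < t -> z = t.
Proof.
move=> ac rz rt z0 t0; apply/eqP/negPn/negP => zt.
have zt0 : z - t != 0 by rewrite subr_eq0.
have s : a * (z + t) + b = 0.
  apply: (mulfI zt0); rewrite mulr0.
  transitivity ((a * z ^+ 2 + b * z + c) - (a * t ^+ 2 + b * t + c)); first by ring.
  by rewrite rz rt subrr.
have p : c = a * z * t.
  transitivity ((a * z ^+ 2 + b * z + c) - z * (a * (z + t) + b) + a * z * t); first by ring.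
  by rewrite rz s mulr0 subrr add0r.
move: ac; rewrite p -!mulrA [z * t]mulrC mulrA -expr2 pmulr_llt0; last exact: mulr_gt0.
by rewrite ltNge sqr_ge0.
Qed.

Lemma same_roots (F : fieldType) (a x y x' y' : F) : a != 0 ->
  - a * (x + y) = - a * (x' + y') -> a * x * y = a * x' * y' -> x' = x \/ x' = y.
Proof.
move=> a0; rewrite !mulNr -!mulrA => /oppr_inj/(mulfI a0) s /(mulfI a0) p.
have /eqP : (x' - x) * (x' - y) = 0.
  transitivity (x' ^+ 2 - x' * (x + y) + x * y); first by ring.
  by rewrite s p; ring.
by rewrite mulf_eq0 !subr_eq0 => /orP[]/eqP; [left|right].
Qed.

Section Main.
Variables (R : realType) (ell : nat) (pr : prime ell) (x : padic pr) (A0 B0 C0 : int).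
Local Notation "|` x |" := (padic_abs x) (at level 0, x at level 99).
Local Notation phi := (padic_of_rat pr).
Hypotheses (xi : padic_irrational x) (A00 : A0 != 0).
Hypothesis r0 : root_of phi A0%:~R B0%:~R C0%:~R x.

Local Notation a := (partial_quotient x).
Local Notation A := (quadA a A0%:~R B0%:~R C0%:~R).
Local Notation B := (quadB a A0%:~R B0%:~R C0%:~R).
Local Notation C := (quadC a A0%:~R B0%:~R C0%:~R).
Local Notation X := (complete_quotient x).
Local Notation XQ := (complete_quotientQ x).
Local Notation D := (B0 ^+ 2 - 4 * A0 * C0).

Let A0Q : A0%:~R != 0 :> rat. Proof. by rewrite intr_eq0. Qed.

Lemma root_complete n : root_of phi (A n) (B n) (C n) (X n).
Proof.
rewrite complete_quotientE; apply: orbit_root r0 n => m; exact: irrational_orbit.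
Qed.

Lemma root_embedding (j : {rmorphism Qadj x -> R}) n :
  root_of (@ratr R) (A n) (B n) (C n) (j (XQ n)).
Proof.
rewrite embedding_orbit; apply: orbit_root.
  by move=> m; rewrite -embedding_orbit /=; exact: embedding_irrational.
exact: embedding_root.
Qed.

Lemma discE n : B n ^+ 2 - 4 * A n * C n = D%:~R.
Proof. by rewrite disc_coefs !(intrD, intrN, intrM, rmorphXn). Qed.

Lemma disc_nz : D%:~R != 0 :> rat.
Proof. by rewrite -(discE 0); exact: irrational_disc xi A0Q r0. Qed.

(** Since [x n = a n + 1 / x n.+1] with [a n >= 0], positivity propagates to
    smaller indices. *)
Lemma pos_embedding_pred (j : {rmorphism Qadj x -> R}) m n :
  (n <= m)%N -> 0 < j (XQ m) -> 0 < j (XQ n).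
Proof.
move=> nm; rewrite -(subnKC nm); elim: (m - n)%N => [|i IHi]; first by rewrite addn0.
rewrite addnS => h; apply: IHi; move: h.
rewrite (embedding_orbit j (n + i)) (embedding_orbit j (n + i).+1) /= invr_gt0 subr_gt0.
apply: le_lt_trans.
by rewrite ler0q; have /andP[] := partial_quotient_itv x (n + i).
Qed.

Lemma eq_complete_quotientQ m n : X m = X n -> XQ m = XQ n.
Proof. by move=> e; apply: val_inj. Qed.

Lemma embedding_eq (j j' : {rmorphism Qadj x -> R}) n :
  j (XQ n) = j' (XQ n) -> j =1 j'.
Proof.
rewrite (embedding_orbit j) (embedding_orbit j') => e; apply: (eq_embedding xi A0Q r0).
by apply: eq_orbit e => m; rewrite -embedding_orbit /=; exact: embedding_irrational.
Qed.

(** Choosing an embedding amounts to choosing a square root of the discriminant. *)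
Lemma embedding_with_delta (s : R) : s ^+ 2 = ratr D%:~R ->
  exists j : {rmorphism Qadj x -> R}, forall n,
    ratr (A n) * j (XQ n) *+ 2 + ratr (B n) = (-1) ^+ n * s.
Proof.
move=> sD; have AR0 : ratr A0%:~R != 0 :> R by rewrite fmorph_eq0.
(* the root with [2 A rho + B = s] *)
pose rho : R := (s - ratr B0%:~R) / (ratr A0%:~R *+ 2).
have rhoE : ratr A0%:~R * rho *+ 2 + ratr B0%:~R = s.
  by rewrite -mulrnAl mulrC divfK ?mulrn_eq0 // subrK.
have [|j jE] := @embedding_exists _ _ _ _ _ _ xi A0Q r0 R rho.
  have : ratr A0%:~R *+ 2 *+ 2 != 0 :> R by rewrite !mulrn_eq0.
  move/mulfI; apply; rewrite mulr0 /root_of /=.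
  transitivity ((ratr A0%:~R * rho *+ 2 + ratr B0%:~R) ^+ 2
    - (ratr B0%:~R ^+ 2 - 4 * ratr A0%:~R * ratr C0%:~R) : R); first by ring.
  rewrite rhoE sD -(discE 0) /=.
  by rewrite !(rmorphB, rmorphM, rmorphXn, rmorph_nat) /= subrr.
exists j => n; rewrite embedding_orbit orbit_delta ?jE ?rhoE //.
- by move=> m; rewrite -jE -embedding_orbit /=; exact: embedding_irrational.
- by rewrite -jE; exact: embedding_root.
Qed.

(** The roots selected by the two embeddings are the two roots of the form, whose
    product [C / A] is negative. *)
Lemma positive_embedding p : A p * C p < 0 ->
  exists j : {rmorphism Qadj x -> R}, 0 < j (XQ p).
Proof.
move=> AC; have D0 : 0 < D%:~R :> rat.
  by rewrite -(discE p) -mulrA subr_gt0; apply: lt_le_trans (sqr_ge0 _); lra.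
pose s : R := Num.sqrt (ratr D%:~R).
have sD : s ^+ 2 = ratr D%:~R by rewrite sqr_sqrtr // ler0q ltW.
have sD' : (- s) ^+ 2 = ratr D%:~R by rewrite sqrrN.
have [j jE] := embedding_with_delta sD; have [j' jE'] := embedding_with_delta sD'.
have Ap : A p != 0 by apply: contraTneq AC => ->; rewrite mul0r ltxx.
have ApR : ratr (A p) != 0 :> R by rewrite fmorph_eq0.
have := root_embedding j p; rewrite /root_of /=.
have : ratr (A p) * j' (XQ p) *+ 2 + ratr (B p) = - (ratr (A p) * j (XQ p) *+ 2 + ratr (B p)).
  by rewrite jE jE' mulrN.
have : ratr (A p) * ratr (C p) < 0 :> R by rewrite -rmorphM /= ltrq0.
have [j0|j0] := ltP 0 (j (XQ p)); first by exists j.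
have [j'0|j'0] := ltP 0 (j' (XQ p)); first by exists j'.
move: (j (XQ p)) (j' (XQ p)) (ratr (A p)) (ratr (B p)) (ratr (C p)) j0 j'0 ApR.
move=> z t u v w z0 t0 u0 uw e r.
have e' : v = - u * (z + t) by lra.
have wE : w = u * z * t.
  by rewrite -[LHS]addr0 -oppr0 -r e'; ring.
move: uw; rewrite wE -!mulrA mulrA -expr2 ltNge mulr_ge0 ?sqr_ge0 //.
by rewrite mulr_le0.
Qed.

Lemma positive_embedding_unique p (j j' : {rmorphism Qadj x -> R}) : A p * C p < 0 ->
  0 < j (XQ p) -> 0 < j' (XQ p) -> j' =1 j.
Proof.
move=> AC jp j'p; apply: (@embedding_eq j' j p).
apply: unique_positive_root (root_embedding j' p) (root_embedding j p) j'p jp.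
by rewrite -rmorphM /= ltrq0.
Qed.

Lemma conjugate : exists y, [/\ padic_irrational y, x != y &
  roots_of phi A0%:~R B0%:~R C0%:~R x y].
Proof.
have D0 : B0%:~R ^+ 2 - 4 * A0%:~R * C0%:~R != 0 :> rat by have := disc_nz; rewrite -(discE 0).
by have [y [yi xy rr _]] := conjugate_exists xi A0Q r0 D0; exists y.
Qed.

Lemma quadA_nz n : A n != 0.
Proof. by have [y [yi xy rr]] := conjugate; exact: quadA_neq0 xi yi xy A00 rr n. Qed.

(** The embedding is chosen at a sign change inside the periodic part; the same
    complete quotient occurs at arbitrarily large indices. *)
Lemma periodic_embedding : periodic x ->
  exists j : {rmorphism Qadj x -> R}, (forall n, 0 < j (XQ n)) /\
    (forall j' : {rmorphism Qadj x -> R}, (forall n, 0 < j' (XQ n)) -> j' =1 j).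
Proof.
case=> N [k [k0 per]].
have Xk m : (N <= m)%N -> X (m + k) = X m.
  move=> Nm; apply/(periodic_fromE _ _ xi) => n mn; apply: per; exact: leq_trans mn.
have rk : root_of phi (A (N.+1 + k)) (B (N.+1 + k)) (C (N.+1 + k)) (X N.+1).
  by rewrite -(Xk N.+1) //; exact: root_complete.
have dd := etrans (discE N.+1) (esym (discE (N.+1 + k))).
have d0 : B N.+1 ^+ 2 - 4 * A N.+1 * C N.+1 != 0 by rewrite discE disc_nz.
have [AA' BB'] := same_disc (irrational_complete N.+1 xi) (quadA_nz _) (quadA_nz _)
  (root_complete _) rk dd d0.
have a0 n : 0 < a n.+1 by exact: partial_quotient_gt0.
have [n Nn] := sign_change a0 quadA_nz (ltn0Sn N) k0 AA' BB'.
rewrite mulrC => AC; have {AC} AC : A n.+1 * C n.+1 < 0 by rewrite quadCS.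
have [j jn] := positive_embedding AC.
have XQk t : XQ (n.+1 + t * k) = XQ n.+1.
  apply: eq_complete_quotientQ; elim: t => [|t IHt]; first by rewrite mul0n addn0.
  have -> : (n.+1 + t.+1 * k = n.+1 + t * k + k)%N by rewrite mulSn; lia.
  have Nt : (N <= n.+1 + t * k)%N by apply: leq_trans (leq_addr _ _); exact/leqW/ltnW.
  by rewrite (Xk _ Nt); exact IHt.
exists j; split=> [m|j' j'p].
  apply: (@pos_embedding_pred j (n.+1 + m * k)); last by rewrite XQk.
  by rewrite (leq_trans (leq_pmulr m k0)) // leq_addl.
exact: positive_embedding_unique AC jn (j'p _).
Qed.

(** These are the expressions [disc_bound], [height] and [search_bound] in the
    coefficients themselves instead of their code. *)
Definition disc_size : nat := (`|B0| ^ 2 + 4 * `|A0| * `|C0|)%N.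
Definition coef_height (n : nat) : nat :=
  ((`|A0| + `|B0| + `|C0|) * (ell + 1) ^ (2 * n))%N.
Definition repeat_bound : nat :=
  (disc_size + 3 + coef_height (disc_size + 2) + (2 * disc_size + 1) ^ 2)%N.

Lemma disc_size_ge : `|D%:~R| <= disc_size%:R :> rat.
Proof.
rewrite -intr_norm -[disc_size%:R]/((Posz disc_size)%:~R) ler_int /disc_size.
rewrite PoszD !PoszM !abszE.
apply: le_trans (ler_normB _ _) _; rewrite lerD //.
  by rewrite normrX expr2.
by rewrite !normrM.
Qed.

Lemma coef_heightE n : `|A n| + `|B n| + `|C n| <= (coef_height n)%:R.
Proof.
have [y [yi xy rr]] := conjugate.
apply: le_trans (height_coefs _ _ _ _ n) _.
by rewrite /coef_height natrM natrX (natrD _ ell).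
Qed.

(** Bounded integral forms repeat, and a form determines the complete quotient,
    its other root being in the open unit disc. *)
Lemma complete_quotient_repeats :
  (forall n, (n <= repeat_bound)%N -> exists j : {rmorphism Qadj x -> R}, 0 < j (XQ n)) ->
  exists n1 n2, (n1 < n2 <= repeat_bound)%N /\ X n1 = X n2.
Proof.
move=> pos; have [y [yi xy rr]] := conjugate.
set E := disc_size; set h := coef_height (E + 2).
have Ylt := abs_conj_lt1 xi yi xy A00 rr disc_size_ge.
have ints n : (E + 2 <= n)%N ->
    [/\ A n \is a Num.int, B n \is a Num.int & C n \is a Num.int].
  case: n => [|n] En; first by rewrite addn2 in En.
  by apply: (quad_coefs_int xi yi xy A00 rr); apply: Ylt; rewrite -addn2.
have neg n : (n <= repeat_bound)%N -> 0 < A n * C n -> A n * B n < 0.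
  by move=> /pos[j jn]; exact: positive_root_sign (root_embedding j n) jn.
have a0 n : 0 < a n.+1 by exact: partial_quotient_gt0.
have Bh : `|B (E + 2)%N| <= h%:R.
  apply: le_trans (coef_heightE _); rewrite -addrA [leRHS]addrCA lerDl.
  by rewrite addr_ge0.
have AC n : (E + 2 + h.+1 <= n <= repeat_bound)%N -> A n * C n < 0.
  apply: (sign_change_after a0 quadA_nz (n0 := E + 2) (h := h)) => //.
  - by rewrite addn2.
  - rewrite /repeat_bound -/E -/h; lia.
  - by move=> m /ints[].
have [|n1 [n2 [Mn1 n12 eA eB]]] := @repeated_pair E (E + 2 + h.+1) A B.
  move=> n /andP[Mn nN].
  have nb : (E + 2 + h.+1 <= n <= repeat_bound)%N.
    by rewrite Mn (leq_trans nN) // /repeat_bound -/E -/h; lia.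
  have [|AZ BZ CZ] := ints n; first by lia.
  have [|Ab Bb] := int_box (E := E) AZ BZ CZ (AC n nb) (discE n); last by [].
  exact: le_trans (ler_norm _) disc_size_ge.
exists n1, n2; split; first by rewrite /repeat_bound -/E -/h; lia.
have eC : C n1 = C n2.
  have := etrans (discE n1) (esym (discE n2)); rewrite eA eB => /addrI/oppr_inj/mulfI; apply.
  by rewrite mulf_neq0 // quadA_nz.
have [s1 p1] := roots_coefs xi yi rr n1; have [s2 p2] := roots_coefs xi yi rr n2.
rewrite -eA -eB -eC in s2 p2.
have phiA0 : phi (A n1) != 0 by rewrite padic_of_rat_eq0 quadA_nz.
have [XX|XY] := same_roots phiA0 (etrans (esym s1) s2) (etrans (esym p1) p2).
  exact (esym XX).
exfalso.
have n1b : (E.+2 <= n1)%N by lia.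
have Yl := Ylt n1 n1b; rewrite -XY in Yl.
have n20 : (0 < n2)%N by lia.
have X1 := complete_quotient_gt1 n2.-1 xi; rewrite (prednK n20) in X1.
by have := lt_trans Yl X1; rewrite ltxx.
Qed.

End Main.

(** * Rational approximations sharing the first partial quotients *)

(** The quadratic convergence of Newton iteration, as an exact identity. *)
Lemma newton_error (F : fieldType) (phi : {rmorphism rat -> F}) (A B C r : rat) (x y : F) :
  roots_of phi A B C x y -> phi A != 0 -> (phi r - x) + (phi r - y) != 0 ->
  phi (newton A B C r) - x = (phi r - x) ^+ 2 / ((phi r - x) + (phi r - y)).
Proof.
case=> rB rC A0 s0; rewrite /newton.
rewrite !(rmorphB, rmorphD, rmorphM, fmorphV, rmorphXn, rmorphMn) /= rB rC.
have -> : phi A * phi r *+ 2 + - phi A * (x + y) = phi A * ((phi r - x) + (phi r - y)) by ring.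
set P := (X in phi r - X / _); have -> : P = phi A * ((phi r - x) * (phi r - y)) by rewrite /P; ring.
rewrite addrAC; move: (phi r - x) (phi r - y) s0 => u w s0.
by field; rewrite A0 s0.
Qed.

Section Approximation.
Variables (ell : nat) (pr : prime ell) (x y : padic pr).
Local Notation "|` x |" := (padic_abs x) (at level 0, x at level 99).
Local Notation phi := (padic_of_rat pr).

Let l0 : 0 < ell%:R :> rat. Proof. by rewrite ltr0n prime_gt0. Qed.
Let l1 : 1 < ell%:R :> rat. Proof. by rewrite ltr1n prime_gt1. Qed.

(** The starting point is closer to [x] than to [y], so the denominator in
    [newton_error] has the absolute value of [x - y]. The geometric rate is weaker
    than the true quadratic one but simple and sufficient. *)
Lemma newton_converges A B C q k : A != 0 -> roots_of phi A B C x y ->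
  |` x - phi q | < |` y - phi q | ->
  |` phi (iter k (newton A B C) q) - x | <= |` x - y | * ell%:R ^- k.+1.
Proof.
move=> A0 rr close; set d := |` x - y |.
have AK0 : phi A != 0 by rewrite padic_of_rat_eq0.
have dE : d = |` y - phi q |.
  rewrite /d padic_abs_dist -(padic_abs_dominant (x := y - phi q) (y := - (x - phi q))).
    by congr padic_abs; rewrite opprB addrA subrK.
  by rewrite padic_absN.
have d0 : 0 < d by rewrite dE (le_lt_trans (padic_abs_ge0 _) close).
elim: k => [|k IHk].
  have xy0 : x - y != 0 by rewrite -padic_abs_gt0.
  have : |` (phi q - x) / (x - y) | < 1.
    by rewrite padic_absM padic_absV ltr_pdivrMr // mul1r padic_abs_dist -/d dE.
  move/padic_abs_lt1; rewrite padic_absM padic_absV ler_pdivrMr //.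
  by rewrite mulrC.
rewrite iterS; set r := iter k _ q in IHk *.
have ld : d * ell%:R ^- k.+1 < d.
  by rewrite gtr_pMr // invf_lt1 ?exprn_gt0 // exprn_egt1.
have ry : |` (phi r - x) + (x - y) | = d.
  by rewrite addrC padic_abs_dominant // (le_lt_trans IHk).
have rs : |` (phi r - x) + (phi r - y) | = d.
  have -> : phi r - y = (phi r - x) + (x - y) by rewrite addrA subrK.
  by rewrite addrC padic_abs_dominant ry // (le_lt_trans IHk).
have rs0 : (phi r - x) + (phi r - y) != 0 by rewrite -padic_abs_gt0 rs.
rewrite (newton_error rr AK0 rs0) padic_absM padic_absV rs padic_absX.
rewrite ler_pdivrMr //.
apply: le_trans (_ : _ <= (d * ell%:R ^- k.+1) ^+ 2) _.
  by rewrite lerXn2r ?nnegrE ?padic_abs_ge0 // mulr_ge0 ?ltW // invr_gt0 exprn_gt0.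
rewrite [in leRHS]exprS invfM; set L := ell%:R ^- k.+1.
have L0 : 0 <= L by rewrite invr_ge0 exprn_ge0 // ltW.
have L1 : L <= ell%:R^-1 by rewrite lef_pV2 ?posrE ?exprn_gt0 // ler_eXnr // ltW.
have -> : (d * L) ^+ 2 = d * d * L * L by ring.
have -> : d * (ell%:R^-1 * L) * d = d * d * L * ell%:R^-1 by ring.
by rewrite ler_wpM2l // !mulr_ge0 // ltW.
Qed.

Lemma padic_floor_near z r : |` phi r - z | < 1 -> rat_floor ell r = padic_floor z.
Proof.
move=> rz; rewrite (rat_floorE pr); have [aZ ai za] := padic_floorP z.
apply: padic_floor_unique (padic_floorP _) _; split=> //.
have -> : ratr r - ratr (padic_floor z) = (phi r - z) + (z - ratr (padic_floor z)).
  by rewrite addrA subrK.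
exact: padic_abs_ltD.
Qed.

(** A step multiplies the error by [|x n.+1| ^ 2], since the rational and the
    irrational complete quotients have the same absolute value as long as the
    error is below [1 / |x n.+1|]; the induction keeps track of the factors still to come. *)
Lemma expansion_near n r (G : rat) : padic_irrational x -> 1 <= G ->
  (forall i, (i < n)%N -> |` complete_quotient x i.+1 | <= G) ->
  |` phi r - x | * G ^+ (2 * n) < 1 ->
  rat_floor ell (iter n (ruban_step ell) r) = partial_quotient x n.
Proof.
move=> xi G1 XG close; have G0 := lt_le_trans ltr01 G1.
suff h i : (i <= n)%N ->
    |` phi (iter i (ruban_step ell) r) - complete_quotient x i | * G ^+ (2 * (n - i)) < 1.
  apply: padic_floor_near; have := h n (leqnn n); rewrite subnn mulr1; exact.
elim: i => [|i IHi] iN; first by rewrite subn0.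
have {IHi} := IHi (ltnW iN); rewrite iterS; move: (iter i _ r) => s.
set e := |` _ - _ | => eG.
have eG1 m : (m <= 2 * (n - i))%N -> e * G ^+ m < 1.
  move=> mn; apply: le_lt_trans eG.
  by rewrite ler_wpM2l ?padic_abs_ge0 // ler_weXn2l.
have e1 : e < 1 by have := eG1 0%N isT; rewrite mulr1.
rewrite /ruban_step (padic_floor_near e1) -/(partial_quotient x i).
set a := partial_quotient x i; set u := complete_quotient x i - phi a.
have u0 : u != 0 by rewrite subr_eq0; exact: (irrational_complete i xi a).
have uV : |` u^-1 | <= G by exact: XG.
have ua : 0 < |` u | by rewrite padic_abs_gt0.
have eu : e < |` u |.
  have : e * G ^+ 1 < 1 by apply: eG1; rewrite muln_gt0 subn_gt0.
  rewrite expr1 -ltr_pdivlMr // div1r => /lt_le_trans; apply.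
  by rewrite -[leRHS]invrK -padic_absV lef_pV2 ?posrE // padic_absV invr_gt0.
have saE : phi (s - a) = (phi s - complete_quotient x i) + u.
  by rewrite rmorphB /u addrA subrK.
have sa : |` phi (s - a) | = |` u |.
  by rewrite saE addrC padic_abs_dominant.
have sa0 : phi (s - a) != 0 by rewrite -padic_abs_gt0 sa.
have diff : |` phi (s - a)^-1 - u^-1 | = e * |` u^-1 | ^+ 2.
  have sV0 : phi (s - a)^-1 != 0 by rewrite fmorphV invr_eq0.
  rewrite abs_sub_inv ?invr_eq0 // fmorphV /= !invrK !padic_absV sa expr2 mulrA.
  by congr (_ * _ * _); rewrite /e saE addrK.
rewrite -[complete_quotient x i.+1]/(u^-1) diff.
apply: le_lt_trans eG.
rewrite -(subnSK iN) mulnS exprD mulrA ler_wpM2r ?exprn_ge0 ?(ltW G0) // ler_wpM2l ?padic_abs_ge0 //.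
by rewrite lerXn2r ?nnegrE ?padic_abs_ge0 // ltW.
Qed.

End Approximation.

(** * Descriptions of a quadratic irrational *)

Section Described.
Variables (ell : nat) (pr : prime ell) (x : padic pr) (d : quad_data).
Local Notation "|` x |" := (padic_abs x) (at level 0, x at level 99).
Local Notation phi := (padic_of_rat pr).
Hypotheses (qx : quadratic_irrational x) (dx : describes d x).

Local Notation A0 := (Posz (qd_lead d)).
Local Notation B0 := (qd_lin d).
Local Notation C0 := (qd_cst d).
Local Notation c := (quad_code ell d).

Lemma quadratic_padic_irrational : padic_irrational x.
Proof. by case: qx. Qed.

Lemma quad_evalE z : quad_eval d z = 0 <-> root_of phi A0%:~R B0%:~R C0%:~R z.
Proof. by rewrite /root_of !rmorph_int. Qed.

Lemma describes_root : root_of phi A0%:~R B0%:~R C0%:~R x.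
Proof. by apply/quad_evalE; case: dx. Qed.

Lemma describes_lead : A0 != 0.
Proof. by case: dx => l0 _ _ _; rewrite -lt0n. Qed.

Let xi := quadratic_padic_irrational.
Let r0 := describes_root.
Let A00 := describes_lead.

Lemma signed_abs (z : int) : signed (z < 0)%R `|z|%N = z.
Proof. by rewrite /signed; case: ltP => z0 /=; lia. Qed.

Lemma quad_code_approx : (signed (tnth c (@Ordinal 9 6 isT)) (tnth c (@Ordinal 9 7 isT)))%:~R /
  (tnth c (@Ordinal 9 8 isT))%:R = qd_approx d.
Proof.
rewrite -[RHS]divq_num_den.
rewrite -[tnth _ _]/(nat_of_bool (qd_approx d < 0)%R) -[X in signed _ X]/`|numq (qd_approx d)|%N.
rewrite -[X in X%:R]/`|denq (qd_approx d)|%N -numq_lt0 signed_abs; congr (_ / _).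
by rewrite pmulrn gez0_abs ?denq_ge0.
Qed.

Lemma approximation_quad_code n : approximation c n =
  iter (qd_lead d + 2 * n * height c n) (newton A0%:~R B0%:~R C0%:~R) (qd_approx d).
Proof.
rewrite /approximation quad_code_approx; congr (iter _ (newton _ _%:~R _%:~R) _).
  exact: signed_abs.
exact: signed_abs.
Qed.

Lemma height_quad_code n : height c n = coef_height ell A0 B0 C0 n.
Proof. by []. Qed.

Lemma search_bound_quad_code : search_bound c = repeat_bound ell A0 B0 C0.
Proof. by []. Qed.

Lemma coef_height_mono m n : (m <= n)%N ->
  (coef_height ell A0 B0 C0 m <= coef_height ell A0 B0 C0 n)%N.
Proof. by move=> mn; rewrite leq_mul2l leq_pexp2l ?orbT ?addn1 ?leq_mul2l ?mn ?orbT. Qed.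

(** By the product formula, [1 / |q|] is at most the real size of [q]. *)
Lemma padic_abs_le_norm q (z : padic pr) : in_Zinv ell q -> q != 0 ->
  |` phi q | * |` z | <= 1 -> |` z | <= `|q|.
Proof.
move=> qZ q0 h; have := product_formula pr qZ q0; rewrite -(padic_abs_rat pr) => p.
have ql : 0 < |` phi q | by rewrite padic_abs_gt0 padic_of_rat_eq0.
by rewrite -(ler_pM2l ql); exact: le_trans h p.
Qed.

(** The precision needed is [G ^ (2 n)] for [G] bounding the complete quotients;
    [G < ell ^ G] turns it into a number of Newton steps, and the distance of the
    two roots is at most the leading coefficient. *)
Lemma digit_quad_code n : digit c n = partial_quotient x n.
Proof.
have A0Q : A0%:~R != 0 :> rat by rewrite intr_eq0.
have [y [yi xy rr yE]] := conjugate_exists xi A0Q r0 (irrational_disc xi A0Q r0).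
have l0 : 0 < ell%:R :> rat by rewrite ltr0n prime_gt0.
have l1 : 1 < ell%:R :> rat by rewrite ltr1n prime_gt1.
set G := coef_height ell A0 B0 C0 n.
have lead0 : (0 < qd_lead d)%N by rewrite lt0n.
have G0 : (0 < G)%N by rewrite muln_gt0 expn_gt0 !addn_gt0 lead0 orbT.
have XG i : (i < n)%N -> |` complete_quotient x i.+1 | <= G%:R.
  move=> iN; have [AZ _ _] := quad_coefs_Zinv x A0 B0 C0 i.+1.
  apply: le_trans (padic_abs_le_norm AZ _ (abs_quadA_mul_le1 xi yi xy A00 rr i)) _.
    exact: quadA_neq0 xi yi xy A00 rr _.
  apply: le_trans (_ : (coef_height ell A0 B0 C0 i.+1)%:R <= _).
    by apply: le_trans (coef_heightE xi A00 r0 _); rewrite -addrA lerDl addr_ge0.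
  by rewrite ler_nat coef_height_mono.
have close : |` x - phi (qd_approx d) | < |` y - phi (qd_approx d) |.
  have [_ _ _ cl] := dx; apply: cl; last by rewrite eq_sym.
  apply/quad_evalE; have [rB rC] := rr; apply: (roots_of_root (y := x)); split.
    by rewrite rB [x + y]addrC.
  by rewrite rC mulrAC.
have delta_le : |` x - y | <= (qd_lead d)%:R.
  have -> : (qd_lead d)%:R = `|A0%:~R| :> rat by rewrite -intr_norm.
  apply: padic_abs_le_norm A0Q _; first exact: in_Zinv_intr.
  have := abs_disc_le1 pr A0 B0 C0; rewrite (abs_disc xi yi rr 0) expr_le1 //.
  by rewrite mulr_ge0 ?padic_abs_ge0.
rewrite /digit; apply: (expansion_near (G := G%:R)) => //; first by rewrite ler1n.
rewrite approximation_quad_code height_quad_code -/G.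
set K := (qd_lead d + 2 * n * G)%N.
have conv := newton_converges K A0Q rr close.
have Kbig : |` x - y | * G%:R ^+ (2 * n) <= ell%:R ^+ K.
  rewrite [in leRHS]/K [in leRHS]exprD; apply: ler_pM; rewrite ?padic_abs_ge0 ?exprn_ge0 ?ler0n //.
    apply: le_trans delta_le _.
    by rewrite -natrX ler_nat ltnW // ltn_expl // prime_gt1.
  rewrite -!natrX ler_nat [(2 * n * G)%N]mulnC [in leqRHS]expnM.
  by case: (2 * n)%N => // e; rewrite leq_exp2r // ltnW // ltn_expl // prime_gt1.
apply: le_lt_trans (ler_wpM2r _ conv) _; first by rewrite exprn_ge0.
rewrite mulrAC ltr_pdivrMr ?exprn_gt0 // mul1r; apply: le_lt_trans Kbig _.
by rewrite ltr_eXn2l.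
Qed.

End Described.

Lemma primitive_lead (A A' B B' C C' : nat) :
  gcdn (gcdn A B) C = 1%N -> (A * B' = A' * B)%N -> (A * C' = A' * C)%N -> (A %| A')%N.
Proof.
move=> g1 AB AC; rewrite -[A']muln1 -g1 !muln_gcdr !dvdn_gcd.
by rewrite -AB -AC dvdn_mull //= !dvdn_mulr.
Qed.

(** Proportional primitive triples with positive leading coefficient are equal.
    This makes the bound independent of the chosen description. *)
Lemma describes_unique (ell : nat) (pr : prime ell) (x : padic pr) d d' :
  quadratic_irrational x -> describes d x -> describes d' x ->
  [/\ qd_lead d' = qd_lead d, qd_lin d' = qd_lin d & qd_cst d' = qd_cst d].
Proof.
move=> qx dx dx'; have xi := quadratic_padic_irrational qx.
have [AB AC] := proportional xi (describes_root dx) (describes_root dx').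
have [A0 gcd1 _ _] := dx; have [A'0 gcd1' _ _] := dx'.
move/eqP: AB; rewrite -!intrM eqr_int => /eqP AB.
move/eqP: AC; rewrite -!intrM eqr_int => /eqP AC.
have := congr1 absz AB; have := congr1 absz AC; rewrite !abszM /= => ACn ABn.
have AA : qd_lead d' = qd_lead d.
  apply/eqP; rewrite eqn_dvd.
  by rewrite (primitive_lead gcd1' (esym ABn) (esym ACn)) (primitive_lead gcd1 ABn ACn).
have lead0 : Posz (qd_lead d) != 0 by rewrite -lt0n.
by rewrite AA in AB AC *; split=> //; [exact: mulfI lead0 _ _ AB|exact: mulfI lead0 _ _ AC].
Qed.

Section Periods.
Variables (a : nat -> rat).

Lemma period_mul N k t n : (forall n, (N <= n)%N -> a (n + k) = a n) ->
  (N <= n)%N -> a (n + t * k) = a n.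
Proof.
move=> h Nn; elim: t => [|t IHt]; first by rewrite mul0n addn0.
by rewrite mulSnr addnA h // (leq_trans Nn) // leq_addr.
Qed.

Variables (b n1 p : nat).
Hypotheses (p0 : (0 < p)%N) (n1p : (n1 + p <= b)%N)
  (per : forall n, (n1 <= n)%N -> a (n + p) = a n).

(** Beyond [2 b] one goes back by the known period [p] without leaving the range
    where both it and [k] apply. *)
Lemma agreement_suffices N k : (N <= b)%N ->
  (forall n, (n < 2 * b)%N -> (N <= n)%N -> a (n + k) = a n) ->
  forall n, (N <= n)%N -> a (n + k) = a n.
Proof.
move=> Nb agree; elim/ltn_ind => n IHn Nn.
have [nb|bn] := ltnP n (2 * b); first exact: agree.
rewrite -[n in RHS](subnK (_ : p <= n)%N); last by lia.
rewrite per; last by lia.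
rewrite -(IHn (n - p)%N); try lia.
by rewrite -(per (n := n - p + k)) ; [congr a; lia|lia].
Qed.

(** Any period of the tail is one from [b] on, by shifting far to the right with
    the known period. *)
Lemma period_early N' k' : (forall n, (N' <= n)%N -> a (n + k') = a n) ->
  forall n, (b <= n)%N -> a (n + k') = a n.
Proof.
move=> per' n bn; have n1n : (n1 <= n)%N by lia.
(* [N' * p >= N'] because [p > 0] *)
rewrite -(period_mul N' per (n := n)) // -(per' (n + N' * p)%N).
  by rewrite addnAC (period_mul N' per) //; lia.
by rewrite (leq_trans (leq_pmulr N' p0)) // leq_addl.
Qed.

(** Shifting by the period [k'] into the range where [k] is a period and back.
    So the least pre-period is the same for all periods. *)
Lemma preperiod_early N' k' k : (0 < k')%N ->
  (forall n, (N' <= n)%N -> a (n + k') = a n) ->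
  (forall n, (b <= n)%N -> a (n + k) = a n) ->
  forall n, (N' <= n)%N -> a (n + k) = a n.
Proof.
move=> k'0 per' perk n Nn.
rewrite -(period_mul b per' Nn) -(perk (n + b * k')%N).
  by rewrite addnAC (period_mul b per') // (leq_trans Nn) // leq_addr.
by rewrite (leq_trans (leq_pmulr b k'0)) // leq_addl.
Qed.

End Periods.

(** * The criterion *)

Lemma repeat_periodic (ell : nat) (pr : prime ell) (x : padic pr) n1 n2 :
  padic_irrational x -> (n1 < n2)%N -> complete_quotient x n1 = complete_quotient x n2 ->
  periodic_from x n1 (n2 - n1).
Proof.
move=> xi n12 XX; apply/(periodic_fromE _ _ xi).
by rewrite subnKC 1?ltnW //; exact (esym XX).
Qed.

(** A bound attached to [x] itself; it is computable from any description because
    descriptions differ only in the approximation. *)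
Definition stopping_bound (ell : nat) (pr : prime ell) (x : padic pr) : nat :=
  if pselect (exists d, describes d x) is left dx
  then search_bound (quad_code ell (projT1 (cid dx))) else 0%N.

Lemma stopping_boundE (ell : nat) (pr : prime ell) (x : padic pr) d :
  quadratic_irrational x -> describes d x ->
  search_bound (quad_code ell d) = stopping_bound x.
Proof.
move=> qx dx; rewrite /stopping_bound; case: pselect => [h|[]]; last by exists d.
case: (cid h) => d' dx' /=.
have [e1 e2 e3] := describes_unique qx dx dx'.
by rewrite !search_bound_quad_code e1 e2 e3.
Qed.

Section Criterion.
Variables (R : realType) (ell : nat) (pr : prime ell) (x : padic pr) (d : quad_data).
Hypotheses (qx : quadratic_irrational x) (dx : describes d x).

Let xi := quadratic_padic_irrational qx.

Lemma repeats_or_negative :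
  (exists2 n, (n <= stopping_bound x)%N &
     ~ exists j : {rmorphism Qadj x -> R}, 0 < j (complete_quotientQ x n)) \/
  (exists n1 n2, (n1 < n2 <= stopping_bound x)%N /\
     complete_quotient x n1 = complete_quotient x n2).
Proof.
rewrite -(stopping_boundE qx dx) search_bound_quad_code; set N := repeat_bound _ _ _ _.
have [h|] := pselect (exists2 n, (n <= N)%N &
     ~ exists j : {rmorphism Qadj x -> R}, 0 < j (complete_quotientQ x n)); first by left.
move=> h; right.
apply: (complete_quotient_repeats (R := R) xi (describes_lead dx) (describes_root dx)).
by move=> n nN; have [//|no] := pselect (exists j : {rmorphism Qadj x -> R},
   0 < j (complete_quotientQ x n)); case: h; exists n.
Qed.

Lemma periodic_iff : periodic x <->
  exists j : {rmorphism Qadj x -> R},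
    (forall n, 0 < j (complete_quotientQ x n)) /\
    (forall j' : {rmorphism Qadj x -> R},
       (forall n, 0 < j' (complete_quotientQ x n)) -> j' =1 j).
Proof.
split; first exact: periodic_embedding xi (describes_lead dx) (describes_root dx).
case=> j [jpos _]; have [[n _ []]|[n1 [n2 [/andP[n12 _] XX]]]] := repeats_or_negative.
  by exists j.
by exists n1, (n2 - n1)%N; split; [rewrite subn_gt0|exact: repeat_periodic].
Qed.

Lemma dichotomy :
  ((exists2 n, (n <= stopping_bound x)%N &
     ~ exists j : {rmorphism Qadj x -> R}, 0 < j (complete_quotientQ x n)) /\ ~ periodic x) \/
  ((exists n1 n2, (n1 < n2 <= stopping_bound x)%N /\
     complete_quotient x n1 = complete_quotient x n2) /\ periodic x).
Proof.
have [[n nN neg]|[n1 [n2 [n12 XX]]]] := repeats_or_negative.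
  left; split; first by exists n.
  by move=> /periodic_iff[j [jpos _]]; apply: neg; exists j.
right; split; first by exists n1, n2.
have /andP[lt12 _] := n12.
by exists n1, (n2 - n1)%N; split; [rewrite subn_gt0|exact: repeat_periodic].
Qed.

End Criterion.

Theorem theorem1p3 (R : realType) :
  [/\ (forall (ell : nat) (pr : prime ell) (alpha : padic pr),
        quadratic_irrational alpha ->
        (periodic alpha <->
         exists j : {rmorphism Qadj alpha -> R},
           (forall n, 0 < j (complete_quotientQ alpha n)) /\
           (forall j' : {rmorphism Qadj alpha -> R},
              (forall n, 0 < j' (complete_quotientQ alpha n)) -> j' =1 j))),
      (exists N : forall (ell : nat) (pr : prime ell), padic pr -> nat,
        effectively_computable N /\
        forall (ell : nat) (pr : prime ell) (alpha : padic pr),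
          quadratic_irrational alpha ->
          ((exists2 n : nat, (n <= N ell pr alpha)%N &
              ~ exists j : {rmorphism Qadj alpha -> R},
                  0 < j (complete_quotientQ alpha n)) /\
           ~ periodic alpha) \/
          ((exists n1 n2 : nat, (n1 < n2 <= N ell pr alpha)%N /\
              complete_quotient alpha n1 = complete_quotient alpha n2) /\
           periodic alpha)) &
      (exists (pre per : 9.-tuple nat -> nat) (num den : 10.-tuple nat -> nat),
        [/\ recursive pre, recursive per, recursive num & recursive den] /\
        forall (ell : nat) (pr : prime ell) (alpha : padic pr) (d : quad_data),
          quadratic_irrational alpha -> describes d alpha -> periodic alpha ->
          let c := quad_code ell d in
          preperiod_period alpha (pre c) (per c) /\
          forall n : nat, (n < pre c + per c)%N ->
            (0 < den [tuple of n :: c])%N /\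
            partial_quotient alpha n =
              (num [tuple of n :: c])%:R / (den [tuple of n :: c])%:R)].
Proof.
split.
- move=> ell pr alpha qx; have [d dx] := describes_exists qx.
  exact: periodic_iff qx dx.
- exists stopping_bound; split; last first.
    by move=> ell pr alpha qx; have [d dx] := describes_exists qx; exact: dichotomy qx dx.
  exists search_bound; first exact: (recursive_search_bound (t := id) (@rec_proj 9)).
  by move=> ell pr alpha d qx dx; exact: stopping_boundE.
have [pre [per [num [den [Rec spec]]]]] := expansion_recursive.
exists pre, per, num, den; split; first exact: Rec.
move=> ell pr alpha d qx dx palpha c.
have xi := quadratic_padic_irrational qx.
have [numP perP preP] := spec c; clear spec Rec.
have aE n : digit c n = partial_quotient alpha n by exact: digit_quad_code.
split; last first.
  move=> n _; have [den0 aq] := numP n; split; first exact: den0.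
  rewrite -aE aq // aE; by have /andP[] := partial_quotient_itv alpha n.
set b := search_bound c in perP preP.
have [n1 [n2 [n12 XX]]] : exists n1 n2, (n1 < n2 <= b)%N /\
    complete_quotient alpha n1 = complete_quotient alpha n2.
  rewrite /b /c (stopping_boundE qx dx).
  by have [[_ /(_ palpha)]|[]] := dichotomy R qx dx.
have /andP[lt12 n2b] := n12.
have per12 := repeat_periodic xi lt12 XX.
set p := (n2 - n1)%N in per12.
have p0 : (0 < p)%N by rewrite subn_gt0.
have n1p : (n1 + p <= b)%N by rewrite /p subnKC // ltnW.
have agreeP N k : (N <= b)%N -> digits_agree c N k -> periodic_from alpha N k.
  move=> Nb /forallP agree; apply: (agreement_suffices p0 n1p per12 Nb) => n nb Nn.
  by have := agree (Ordinal nb); rewrite /= Nn /= !aE => /eqP.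
have agreeI N k : periodic_from alpha N k -> digits_agree c N k.
  by move=> h; apply/forallP => i; apply/implyP => Ni; rewrite !aE h.
have early N' k' : periodic_from alpha N' k' -> periodic_from alpha b k'.
  by move=> h; exact: (period_early p0 n1p per12 h).
have [|per0 aper permin] := perP p _ (agreeI _ _ (early _ _ per12)).
  by rewrite p0 (leq_trans _ n2b) // leq_subr.
have bper := agreeP _ _ (leqnn b) aper.
have [apre premin] := preP b (leqnn b) aper.
split; first exact: per0.
  by apply: agreeP apre; exact: premin.
move=> N' k' k'0 h; split.
  by apply: premin; apply: agreeI; exact (preperiod_early k'0 h bper).
by apply: (permin _ k'0); apply: agreeI; exact (early _ _ h).
Qed.
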